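(* Let $G$ be a Lie groupoid, let $R:G\curvearrowright E$ be a representation up to homotopy on a bounded graded vector bundle $E=\bigoplus_{n\ge0}E_n\to G_0$, and let $C=C_{lin}(G\ltimes_RE)$. In the decreasing filtration by subcomplexes $$\hat F_0C=C_{lin}(G\ltimes_RE)\supset\hat F_1C\supset\cdots\supset\hat F_mC\supset\cdots\supset C_{proj}(G\ltimes_RE),$$ where $\hat F_mC$ is the subcomplex of $m$-projectable cochains, each inclusion $\hat F_{m+1}C\to\hat F_mC$ ($m\ge0$) is a quasi-isomorphism. In particular, the inclusion $C_{proj}(G\ltimes_RE)\to C_{lin}(G\ltimes_RE)$ is a quasi-isomorphism.
   Context: Vector bundles are real, smooth and of finite rank. Nerve. For a Lie groupoid $G$, $G_n$ is the manifold of chains $g=(x_n\xleftarrow{g_n}x_{n-1}\leftarrow\cdots\xleftarrow{g_1}x_0)$ of $n$ composable arrows; $x_i:G_n\to G_0$ are the vertex maps, $s=x_0$, $t=x_n$. Let $[n]=\{0,\dots,n\}$. For an order-preserving $\theta:[p]\to[n]$, $g\theta\in G_p$ is the chain $x_{\theta(p)}\leftarrow\cdots\leftarrow x_{\theta(0)}$ formed by the corresponding composites (or identities). $\delta_i:[n-1]\to[n]$ is the injection missing $i$, and $d_ig=g\delta_i$. $\iota_p:[p]\to[n]$, $\iota_p(i)=i$; $\tau_q:[q]\to[n]$, $\tau_q(i)=n-q+i$. A simplex is degenerate if one of its arrows is an identity. Representation up to homotopy. $R=(R_m)_{m\ge0}:G\curvearrowright E$ consists of smooth sections $R_m\in\Gamma(G_m,\hom^{m-1}(s^*E,t^*E))$,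 i.e. $R_m^g:E_n^{s(g)}\to E_{n+m-1}^{t(g)}$, such that: (RH1) $R_1^g=\mathrm{id}$ if $g$ is a unit and $R_m^g=0$ for $m\ge2$ and $g$ degenerate; (RH2) $\sum_{k=1}^{m-1}(-1)^kR_{m-1}^{g\delta_k}=\sum_{k=0}^m(-1)^kR_{m-k}^{g\tau_{m-k}}\circ R_k^{g\iota_k}$ for all $g\in G_m$, $m\ge0$. Semi-direct product. An index is an injective order-preserving map $\alpha:[k]\to[n]$ with $\alpha(0)=0$. $G\ltimes_RE$ is the simplicial vector bundle over the nerve of $G$ with $(G\ltimes_RE)_n=\bigoplus_{\alpha:[k]\to[n]}x_{\alpha(k)}^*E_k$, the sum over all indices. Its elements are written $(g,v)$ with $g\in G_n$, $v=(v_\alpha)_\alpha$, $v_\alpha\in E_k^{x_{\alpha(k)}(g)}$; $\pi_\alpha(g,v)=v_\alpha$. For $\beta:[l]\to[n-1]$ define $\beta':[l+1]\to[n]$ by $\beta'(0)=0$, $\beta'(i+1)=\beta(i)+1$ for $i\ge 0$. The faces $d_i:(G\ltimes_RE)_n\to(G\ltimes_RE)_{n-1}$ cover those of $G$ and are given, over $g\in G_n$, by $\pi_\beta d_i=\pi_{\delta_i\beta}$ for $i>0$ and $$\pi_\beta d_0=\sum_{k=0}^{l+1}(-1)^lR_{l+1-k}^{g\beta'\tau_{l+1-k}}\pi_{\beta'\iota_k}-\sum_{i=1}^l(-1)^i\pi_{\beta'\delta_i}.$$ (The degeneracies play no role here.) Linear cochains. $C^n=C^n_{lin}(G\ltimes_RE)$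 is the space of smooth fiberwise linear functions $c$ on $(G\ltimes_RE)_n$, with differential $\delta(c)=\sum_{r=0}^{n+1}(-1)^rc\circ d_r$. Such $c$ decomposes uniquely as $c(g,v)=\sum_\alpha c_\alpha(g)(v_\alpha)$ with $c_\alpha\in\Gamma(G_n,x_{\alpha(k)}^*E_k^* )$; its support is $\{\alpha:c_\alpha\ne0\}$. Regularity. An index $\alpha:[k]\to[n]$ is regular if $\alpha=\iota_k$, and $m$-regular if $\alpha(i)=i$ for every $i\le\min(k,m)$. A cochain $c$ is projectable if both $c$ and $\delta(c)$ are supported on regular indices; it is $m$-regular if it is supported on $m$-regular indices, and $m$-projectable if both $c$ and $\delta(c)$ are $m$-regular. $C_{proj}(G\ltimes_RE)$ is the subcomplex of projectable cochains and $\hat F_mC$ the subcomplex of $m$-projectable cochains. *)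

(* Defs.v *)
From HB Require Import structures.
From mathcomp Require Import all_boot all_order all_algebra.
From mathcomp Require Import all_classical all_reals all_analysis.

Set Implicit Arguments.
Unset Strict Implicit.
Unset Printing Implicit Defensive.

Import Order.TTheory GRing.Theory Num.Theory.
Import numFieldNormedType.Exports.

Local Open Scope classical_set_scope.
Local Open Scope ring_scope.

Section Smooth.
Context (R : realType).

(* [Cr k O f]: on the open set [O], all iterated partial derivatives of [f] of
   order at most [k] exist and are continuous. *)
Fixpoint Cr (k n : nat) (O : set 'rV[R]_n) (f : 'rV[R]_n -> R) : Prop :=
  (forall x, O x -> {for x, continuous f}) /\
  if k is k'.+1 then
    forall i : 'I_n,
      (forall x, O x -> derivable f x (delta_mx 0 i)) /\
      Cr k' O (fun x => 'D_(delta_mx 0 i) f x)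
  else True.

Definition smooth_on n d (O : set 'rV[R]_n) (f : 'rV[R]_n -> 'rV[R]_d) : Prop :=
  forall (j : 'I_d) (k : nat), Cr k O (fun x => f x 0 j).

(* [cmap] and [cinv] are only meaningful on [cdom] and on its image. *)
Record chart (T : topologicalType) := Chart {
  cdom : set T;
  cdim : nat;
  cmap : T -> 'rV[R]_cdim;
  cinv : 'rV[R]_cdim -> T;
  cdom_open : open cdom;
  cimg_open : open (cmap @` cdom);
  cmapK : forall x, cdom x -> cinv (cmap x) = x;
  cmap_cont : forall x, cdom x -> {for x, continuous cmap};
  cinv_cont : forall y, (cmap @` cdom) y -> {for y, continuous cinv} }.

Arguments cinv [T] c y.

(* The atlas need not be maximal, and the dimension may depend on the connected
   component. *)
Record manifold := Manifold {
  carrier :> topologicalType;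
  atlas : set (chart carrier);
  man_hausdorff : hausdorff_space carrier;
  man_countable : @second_countable carrier;
  atlas_cover : forall x, exists2 c, atlas c & cdom c x;
  atlas_compat : forall c c', atlas c -> atlas c' ->
    smooth_on (cmap c @` (cdom c `&` cdom c')) (cmap c' \o cinv c) }.

(* A set embedded in a finite product of manifolds. Smoothness on it is
   smoothness of local extensions to the ambient product; on an embedded
   submanifold this is the usual notion. *)
Record embspace := Space {
  pts :> Type;
  fidx : finType;
  fac : fidx -> manifold;
  emb : pts -> forall i, fac i }.

Definition man_space (M : manifold) : embspace :=
  @Space M unit (fun=> M) (fun x _ => x).

Definition coords (X : embspace) (c : forall i : fidx X, chart (fac i)) (p : X) :
    'rV[R]_#|{: {i : fidx X & 'I_(cdim (c i))}}| :=
  \row_j let k := enum_val j in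
    cmap (c (tag k)) (emb p (tag k)) 0 (tagged k).

(* [D] is a neighbourhood of [p] in [X], and [F] (whose values off [D] are
   irrelevant) is smooth near [p]. *)
Definition smooth_near (X : embspace) d (D : set X) (F : X -> 'rV[R]_d) (p : X) :
    Prop :=
  exists2 c : forall i : fidx X, chart (fac i),
    forall i, atlas (c i) /\ cdom (c i) (emb p i) &
  exists O, exists h : _ -> 'rV[R]_d,
    [/\ open O, O (coords c p), smooth_on O h &
        forall q, (forall i, cdom (c i) (emb q i)) -> O (coords c q) ->
          D q /\ F q = h (coords c q)].

Definition smooth_map (X : embspace) (N : manifold) (F : X -> N) : Prop :=
  forall p, exists c : chart N,
    [/\ atlas c, cdom c (F p) &
        smooth_near [set q | cdom c (F q)] (fun q => cmap c (F q)) p].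

Definition jacobian_mx n m (f : 'rV[R]_n -> 'rV[R]_m) (x : 'rV[R]_n) :
    'M[R]_(n, m) :=
  \matrix_(i, j) 'D_(delta_mx 0 i) (fun y => f y 0 j) x.

Definition submersion (M N : manifold) (F : M -> N) : Prop :=
  @smooth_map (man_space M) N F /\
  forall (p : M) (c : chart M) (d : chart N),
    atlas c -> atlas d -> cdom c p -> cdom d (F p) ->
    row_full (jacobian_mx (cmap d \o F \o cinv c) (cmap c p)).

(* [tmap x] and [tinv x] are only meaningful for [x] in [tdom]. *)
Record triv (B : manifold) (fib : B -> lmodType R) := Triv {
  tdom : set B;
  trank : nat;
  tmap : forall x, {linear fib x -> 'rV[R]_trank};
  tinv : forall x, 'rV[R]_trank -> fib x;
  tdom_open : open tdom;
  tmapK : forall x, tdom x -> cancel (tmap x) (@tinv x);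
  tinvK : forall x, tdom x -> cancel (@tinv x) (tmap x) }.

Arguments tinv [B fib] t x w.

(* A smooth vector bundle, given by its fibers and local trivializations with
   smooth transition functions; these determine the smooth total space. The
   rank may depend on the connected component. *)
Record vbundle (B : manifold) := VBundle {
  fib :> B -> lmodType R;
  trivs : set (triv fib);
  triv_cover : forall x, exists2 a, trivs a & tdom a x;
  triv_compat : forall a b, trivs a -> trivs b ->
    forall p, tdom a p -> tdom b p ->
    @smooth_near (man_space B) _ (tdom a `&` tdom b)
      (fun x => mxvec (lin1_mx (fun w => tmap b x (tinv a x w)))) p }.

(* Sections of hom(f^* E, g^* F) and of (f^* E)^*, in local trivializations. *)

Definition smooth_hom (X : embspace) (B : manifold) (E F : vbundle B)
    (f g : X -> B) (S : forall q : X, E (f q) -> F (g q)) : Prop :=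
  forall p, exists a : triv E, exists b : triv F,
    [/\ trivs a, trivs b, tdom a (f p), tdom b (g p) &
        smooth_near [set q | tdom a (f q) /\ tdom b (g q)]
          (fun q => mxvec (lin1_mx
             (fun w => tmap b (g q) (S q (tinv a (f q) w))))) p].

Definition smooth_dual (X : embspace) (B : manifold) (E : vbundle B)
    (f : X -> B) (S : forall q : X, E (f q) -> R) : Prop :=
  forall p, exists a : triv E,
    [/\ trivs a, tdom a (f p) &
        smooth_near [set q | tdom a (f q)]
          (fun q => \row_i S q (tinv a (f q) (delta_mx 0 i))) p].

(* The identity of a fiber, as a map between the fibers at two points that are
   provably but not syntactically equal (and 0 if the points differ). *)
Definition tr (B : manifold) (E : vbundle B) (x y : B) (v : E x) : E y :=
  match pselect (x = y) with
  | left e => eq_rect x (fun z => E z : Type) v y e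
  | right _ => 0
  end.

Definition composable (G0 G1 : manifold) (s t : G1 -> G0) : embspace :=
  @Space {p : G1 * G1 | s p.1 = t p.2} bool (fun=> G1)
    (fun p i => if i then (sval p).1 else (sval p).2).

(* [mul g h] is the composite g h, meaningful only if [src g = tgt h]. *)
Record lieGroupoid := LieGroupoid {
  obj : manifold;
  arw : manifold;
  src : arw -> obj;
  tgt : arw -> obj;
  uni : obj -> arw;
  ginv : arw -> arw;
  mul : arw -> arw -> arw;
  src_uni : forall x, src (uni x) = x;
  tgt_uni : forall x, tgt (uni x) = x;
  src_inv : forall g, src (ginv g) = tgt g;
  tgt_inv : forall g, tgt (ginv g) = src g;
  src_mul : forall g h, src g = tgt h -> src (mul g h) = src h;
  tgt_mul : forall g h, src g = tgt h -> tgt (mul g h) = tgt g;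
  mulA : forall g h k, src g = tgt h -> src h = tgt k ->
    mul g (mul h k) = mul (mul g h) k;
  mul_unil : forall g, mul (uni (tgt g)) g = g;
  mul_unir : forall g, mul g (uni (src g)) = g;
  mul_invl : forall g, mul (ginv g) g = uni (src g);
  mul_invr : forall g, mul g (ginv g) = uni (tgt g);
  src_subm : submersion src;
  tgt_subm : submersion tgt;
  uni_smooth : @smooth_map (man_space obj) arw uni;
  inv_smooth : @smooth_map (man_space arw) arw ginv;
  mul_smooth : @smooth_map (composable src tgt) arw
    (fun p => mul (sval p).1 (sval p).2) }.

Record chain (G : lieGroupoid) (n : nat) := Chain {
  vtx : 'I_n.+1 -> obj G;
  arr : 'I_n -> arw G;
  src_arr : forall i, src (arr i) = vtx (widen_ord (leqnSn n) i);
  tgt_arr : forall i, tgt (arr i) = vtx (lift ord0 i) }.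

(* For n > 0 the vertices are smooth functions of the arrows, so this is the
   submanifold structure induced by G_1^n; for n = 0 it is that of G_0. *)
Definition nerve (G : lieGroupoid) (n : nat) : embspace :=
  @Space (chain G n) ('I_n.+1 + 'I_n)%type
    (fun i => match i with inl _ => obj G | inr _ => arw G end)
    (fun g i => match i with inl j => vtx g j | inr j => arr g j end).

Definition degenerate G n (g : chain G n) : Prop :=
  exists i x, arr g i = uni x.

(* Order-preserving maps [p] -> [n]. *)
Record ordmap (p n : nat) := OMap {
  ofun :> 'I_p.+1 -> 'I_n.+1;
  ofunP : forall i j : 'I_p.+1, (i <= j)%N -> (ofun i <= ofun j)%N }.

Lemma omap_clip_subproof p n (f : nat -> nat)
    (f_mono : {homo f : i j / (i <= j)%N}) (i j : 'I_p.+1) :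
  (i <= j)%N ->
  ((inord (minn (f i) n) : 'I_n.+1) <= (inord (minn (f j) n) : 'I_n.+1))%N.
Proof.
move=> ij; rewrite !inordK ?ltnS ?geq_minr//.
by rewrite leq_min geq_minr andbT (leq_trans (geq_minl _ _)) ?f_mono.
Qed.

(* The map i |-> f i; truncation at n only makes it total in p and n, and plays
   no role in the ranges where it is used. *)
Definition omap_clip p n f (f_mono : {homo f : i j / (i <= j)%N}) : ordmap p n :=
  OMap (@omap_clip_subproof p n f f_mono).

Lemma bump_homo k : {homo bump k : i j / (i <= j)%N}.
Proof. by move=> i j; rewrite leq_bump2. Qed.

Lemma add_homo k : {homo addn k : i j / (i <= j)%N}.
Proof. by move=> i j; rewrite leq_add2l. Qed.

Definition oiota p n : ordmap p n := omap_clip p n (fun i j (h : (i <= j)%N) => h).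
Definition otau q n : ordmap q n := omap_clip q n (@add_homo (n - q)).
Definition odelta p n k : ordmap p n := omap_clip p n (@bump_homo k).

Definition ocomp p q n (b : ordmap q n) (a : ordmap p q) : ordmap p n :=
  @OMap p n (fun i => b (a i)) (fun _ _ h => ofunP b (ofunP a h)).

Definition oprime_fun l n (b : ordmap l n) (i : 'I_l.+2) : 'I_n.+2 :=
  if unlift ord0 i is Some j then lift ord0 (b j) else ord0.

Lemma oprime_subproof l n (b : ordmap l n) (i j : 'I_l.+2) :
  (i <= j)%N -> (oprime_fun b i <= oprime_fun b j)%N.
Proof.
rewrite /oprime_fun; case: unliftP => [i' ->|->//].
case: unliftP => [j' ->|->//]; rewrite !lift0 !ltnS; exact: ofunP.
Qed.

Definition oprime l n (b : ordmap l n) : ordmap l.+1 n.+1 :=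
  OMap (@oprime_subproof l n b).

(* [composite g i d] is the composite arrow from x_i to x_{i+d}. *)
Fixpoint composite G n (g : chain G n) (i d : nat) : arw G :=
  if d is d'.+1 then
    if insub (i + d')%N is Some k then mul (arr g k) (composite g i d')
    else composite g i d'
  else uni (vtx g (inord i)).

Lemma composite_ends G n (g : chain G n) i d : (i + d <= n)%N ->
  src (composite g i d) = vtx g (inord i) /\
  tgt (composite g i d) = vtx g (inord (i + d)).
Proof.
elim: d => [|d IH] /= le_n; first by rewrite addn0 src_uni tgt_uni.
have lt_n : (i + d < n)%N by rewrite -addnS.
have [IHs IHt] := IH (ltnW lt_n).
rewrite (insubT (fun m => (m < n)%N) lt_n) /=.
have E : src (arr g (Ordinal lt_n)) = tgt (composite g i d).
  rewrite src_arr IHt; congr vtx; apply: val_inj; rewrite /= inordK//.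
  exact: leqW.
rewrite src_mul// tgt_mul// tgt_arr IHs; split=> //.
by congr vtx; apply: val_inj; rewrite /= /bump add1n inordK addnS.
Qed.

Lemma act_subproof G p n (g : chain G n) (th : ordmap p n) (k : 'I_p) :
  let i := th (widen_ord (leqnSn p) k) in
  let j := th (lift ord0 k) in
  src (composite g i (j - i)) = vtx g i /\ tgt (composite g i (j - i)) = vtx g j.
Proof.
move=> i j; have ij : (i <= j)%N by apply: ofunP; rewrite lift0 /=.
have [|-> ->] := @composite_ends G n g i (j - i).
  by rewrite subnKC// -ltnS.
by rewrite subnKC// !inord_val.
Qed.

Definition act G p n (g : chain G n) (th : ordmap p n) : chain G p :=
  @Chain G p (fun i => vtx g (th i))
    (fun k => composite g (th (widen_ord (leqnSn p) k))
                (th (lift ord0 k) - th (widen_ord (leqnSn p) k)))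
    (fun k => (act_subproof g th k).1) (fun k => (act_subproof g th k).2).

(* [ruth m g n n'] is the component E_n -> E_n' of R_m^g. Since E is
   concentrated in degrees >= 0, R_m being of degree m - 1 means that these
   components vanish unless n' = n + m - 1. *)
Record rep (G : lieGroupoid) (E : nat -> vbundle (obj G)) := Rep {
  ruth :> forall (m : nat) (g : chain G m) (n n' : nat),
    {linear E n (vtx g ord0) -> E n' (vtx g ord_max)};
  ruth_deg : forall m (g : chain G m) n n', (n' + 1 != n + m)%N ->
    forall v, ruth g n n' v = 0;
  ruth_smooth : forall m n n',
    @smooth_hom (nerve G m) _ (E n) (E n')
      (fun g => vtx g ord0) (fun g => vtx g ord_max) (fun g => ruth g n n');
  ruth_unit : forall (g : chain G 1) n (v : E n (vtx g ord0)),
    degenerate g -> ruth g n n v = tr (vtx g ord_max) v;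
  ruth_degenerate : forall m (g : chain G m) n n' v, (2 <= m)%N ->
    degenerate g -> ruth g n n' v = 0;
  ruth_structure : forall m (g : chain G m) n n' (v : E n (vtx g ord0)),
    \sum_(1 <= k < m) (-1) ^+ k *:
       tr (vtx g ord_max)
         (ruth (act g (odelta m.-1 m k)) n n' (tr _ v)) =
    \sum_(0 <= k < m.+1) (-1) ^+ k *:
       tr (vtx g ord_max)
         (ruth (act g (otau (m - k) m)) (n + k).-1 n'
            (tr _ (ruth (act g (oiota k m)) n (n + k).-1 (tr _ v)))) }.

Definition is_index k n (a : ordmap k n) : Prop := injective a /\ a ord0 = ord0.

Record sindex (n : nat) := Index {
  deg : nat;
  imap :> ordmap deg n;
  imapP : is_index imap }.

HB.instance Definition _ n := gen_eqMixin (sindex n).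

Definition sfib G (E : nat -> vbundle (obj G)) n (g : chain G n) (a : sindex n) :
    lmodType R :=
  E (deg a) (vtx g (a ord_max)).

(* The total space, with elements (g, v); the direct sum over the finitely many
   indices is a product. *)
Definition semidirect G (E : nat -> vbundle (obj G)) (n : nat) : Type :=
  {g : chain G n & forall a : sindex n, sfib E g a}.

(* pi_a; stated for all order-preserving maps so that formulas need no side
   conditions, but only used when a is an index. *)
Definition spi G (E : nat -> vbundle (obj G)) n (p : semidirect E n)
    k (a : ordmap k n) : E k (vtx (projT1 p) (a ord_max)) :=
  match pselect (is_index a) with
  | left h => projT2 p (Index h)
  | right _ => 0
  end.

Definition face G (E : nat -> vbundle (obj G)) (rho : rep E) (i n : nat)
    (p : semidirect E n.+1) : semidirect E n :=
  let g := projT1 p in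
  existT _ (act g (odelta n n.+1 i)) (fun b : sindex n =>
    if i is 0 then
      let l := deg b in
      let b' := oprime b in
      \sum_(0 <= k < l.+2) (-1) ^+ l *:
         tr _ (rho _ (act g (ocomp b' (otau (l.+1 - k) l.+1))) k l
                 (tr _ (spi p (ocomp b' (oiota k l.+1)))))
      - \sum_(1 <= j < l.+1) (-1) ^+ j *:
         tr _ (spi p (ocomp b' (odelta l l.+1 j)))
    else spi p (ocomp (odelta n n.+1 i) b)).

Definition cochain G (E : nat -> vbundle (obj G)) (n : nat) := semidirect E n -> R.

Definition delta G (E : nat -> vbundle (obj G)) (rho : rep E) n
    (c : cochain E n) : cochain E n.+1 :=
  fun p => \sum_(r < n.+2) (-1) ^+ r * c (face rho r p).

(* c_a(g)(w) = c(g, v), where v_a = w is the only nonzero component of v. *)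
Definition component G (E : nat -> vbundle (obj G)) n (c : cochain E n)
    (a : sindex n) (g : chain G n) (w : sfib E g a) : R :=
  c (existT _ g (dfwith (fun b => 0 : sfib E g b) a w)).

Definition fiberwise_linear G (E : nat -> vbundle (obj G)) n (c : cochain E n) :
    Prop :=
  forall g (r : R) (v w : forall a, sfib E g a),
    c (existT _ g (fun a => r *: v a + w a)) =
    r * c (existT _ g v) + c (existT _ g w).

(* A fiberwise linear function on a vector bundle is smooth iff it is a smooth
   section of the dual bundle, here the direct sum of the x_{a(k)}^* E_k^*. *)
Definition C_lin G (E : nat -> vbundle (obj G)) n : set (cochain E n) :=
  [set c | fiberwise_linear c /\
     forall a : sindex n, @smooth_dual (nerve G n) _ (E (deg a))
       (fun g => vtx g (a ord_max)) (@component G E n c a)].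

Definition in_support G (E : nat -> vbundle (obj G)) n (c : cochain E n)
    (a : sindex n) : Prop :=
  exists g w, @component G E n c a g w <> 0.

Definition is_regular n (a : sindex n) : Prop :=
  forall i, a i = oiota (deg a) n i.

Definition is_mregular (m n : nat) (a : sindex n) : Prop :=
  forall i : 'I_(deg a).+1, (i <= minn (deg a) m)%N -> a i = i :> nat.

Definition supported G (E : nat -> vbundle (obj G)) n (P : sindex n -> Prop)
    (c : cochain E n) : Prop :=
  forall a, in_support c a -> P a.

Definition C_proj G (E : nat -> vbundle (obj G)) (rho : rep E) n :
    set (cochain E n) :=
  [set c | [/\ C_lin c, supported (@is_regular n) c &
               supported (@is_regular n.+1) (delta rho c)]].

Definition Fhat G (E : nat -> vbundle (obj G)) (rho : rep E) (m n : nat) :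
    set (cochain E n) :=
  [set c | [/\ C_lin c, supported (@is_mregular m n) c &
               supported (@is_mregular m n.+1) (delta rho c)]].

(* The spaces [A n], with the restrictions of [delta], form a complex. *)
Definition cochain_complex G (E : nat -> vbundle (obj G)) (rho : rep E)
    (A : forall n, set (cochain E n)) : Prop :=
  forall n,
    [/\ A n (fun=> 0),
        forall (r : R) c c', A n c -> A n c' -> A n (fun p => r * c p + c' p),
        forall c, A n c -> A n.+1 (delta rho c) &
        forall c, A n c -> delta rho (delta rho c) = (fun=> 0)].

Definition cocycle G (E : nat -> vbundle (obj G)) (rho : rep E)
    (A : forall n, set (cochain E n)) n (c : cochain E n) : Prop :=
  A n c /\ delta rho c = (fun=> 0).

Definition coboundary G (E : nat -> vbundle (obj G)) (rho : rep E)
    (A : forall n, set (cochain E n)) n : cochain E n -> Prop :=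
  if n is n'.+1 then fun c => exists2 b, A n' b & c = delta rho b
  else fun c => c = (fun=> 0).

(* For A contained in B: H^n(A) -> H^n(B) is injective and surjective. *)
Definition quasi_iso G (E : nat -> vbundle (obj G)) (rho : rep E)
    (A B : forall n, set (cochain E n)) : Prop :=
  forall n,
    (forall c : cochain E n, cocycle rho A c -> coboundary rho B c ->
       coboundary rho A c) /\
    (forall c : cochain E n, cocycle rho B c ->
       exists2 c', cocycle rho A c' & coboundary rho B (fun p => c p - c' p)).

Definition bounded_graded (B : manifold) (E : nat -> vbundle B) : Prop :=
  exists N, forall n, (N < n)%N -> forall x (v : E n x), v = 0.

End Smooth.

Arguments cinv [R T] c y.
Arguments tinv [R B fib] t x w.
Arguments C_lin [R G] E n _.
Arguments C_proj [R G E] rho n _.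
Arguments Fhat [R G E] rho m n _.

(* Main.v *)
Require Import Defs.
From mathcomp Require Import all_boot all_order all_algebra.
From mathcomp Require Import all_classical all_reals all_analysis.
From HB Require Import structures.
From mathcomp Require Import zify.
(* Imported again, as MathComp has its own [mul] and [mulA]. *)
Require Import Defs.

(* Smoothness of delta c reduces to the stability of [Cr] under composition, which
   is proved from the mean value theorem in the form
   h(z) - h(y) = sum_j A_j(z) (z_j - y_j), with A_j(z) -> D_j h(y).

   delta^2 = 0 follows from the simplicial identities for the faces; the only hard
   one, d_0 d_1 = d_0 d_0, is where (RH2) enters.

   If c is supported on m-regular indices and an index on [n+1] first skips
   j <= m, so that it is delta_j b, then the corresponding component of delta c at g
   is (-1)^j (c_b(d_j g) - c_b(d_0 g)). Hence, for c m-projectable, c_b(g) does not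
   depend on the first m vertices of g. Now let x be m-projectable with delta x
   supported on (m+1)-regular indices, and put
     h_a(g) = (-1)^m x_(delta_(m+1) a)(s_a g),
   where s_a g inserts in front of x_m the vertex x_q, q = a(m+1), by means of the
   inverse of the arrow x_m -> x_q. Since x_q survives in all the faces that matter,
   s_a behaves as an extra degeneracy, and x - delta h is (m+1)-projectable. So
   each quotient of the filtration is acyclic. Finally, m-projectable cochains of
   degree < m are projectable, so finitely many steps suffice in each degree. *)

Set Implicit Arguments.
Unset Strict Implicit.
Unset Printing Implicit Defensive.

Import Order.TTheory GRing.Theory Num.Theory.
Import numFieldNormedType.Exports.

Local Open Scope classical_set_scope.
Local Open Scope ring_scope.

(** * Functions of class C^k *)

(** The operators R matter for delta^2 = 0 but drop out of the argument on the filtration. In π_β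
    d_0 they act on the initial pieces β'ι_k, which are (m+1)-regular when β is m-regular, while
    vectors are always concentrated at an index skipping some j ≤ m+1. Of d_0 there only remains the
    term π_{β'δ_j}. The vertex inserted by the homotopy must keep its name under every contributing
    face. Repeating x_m fails: d_0 moves x_{m+1} to place m. At an index δ_{m+1} f, the vertex x_q
    with q = f(m+1) + 1 works: faces that remove a value of the index contribute 0, and d_0 turns q
    into f(m+1). As q > m, the inserted arrow runs backwards, hence the inverses. The formal
    obstacle is that fibers often lie over points that are equal only by proof. So [pi_at],
    [ruth_at] and [coef] take indices as functions on nat and leave the base point free; identities
    of indices and chains then rewrite without casts. *)

Section CrTheory.
Context {R : realType}.

Lemma Cr_continuous k n (O : set 'rV[R]_n) f :
  Cr k O f -> forall x, O x -> {for x, continuous f}.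
Proof. by case: k => [|k] []. Qed.

Lemma CrW k n (O : set 'rV[R]_n) f : Cr k.+1 O f -> Cr k O f.
Proof.
elim: k f => [|k IH] f [cf df]; split=> // i.
by have [dfi /IH] := df i.
Qed.

Lemma Cr_sub k n (O O' : set 'rV[R]_n) f : O' `<=` O -> Cr k O f -> Cr k O' f.
Proof.
move=> sO; elim: k f => [|k IH] f [cf df]; (split; first by move=> x /sO/cf) => // i.
by have [dfi /IH] := df i; split=> // x /sO/dfi.
Qed.

Lemma near_eq_continuous n (f g : 'rV[R]_n -> R) x :
  (\near x, f x = g x) -> {for x, continuous f} -> {for x, continuous g}.
Proof.
move=> fg cf; rewrite /prop_for /continuous_at -(nbhs_singleton fg).
apply: cvg_trans cf; exact: (@near_eq_cvg _ _ (nbhs x)).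
Qed.

(** As [O] is open, equality on [O] is equality near each of its points, so it passes to
    derivatives. *)
Lemma Cr_ext k n (O : set 'rV[R]_n) f g : open O ->
  (forall x, O x -> f x = g x) -> Cr k O f -> Cr k O g.
Proof.
move=> oO; elim: k f g => [|k IH] f g efg Hf.
all: have near_fg x : O x -> \near x, f x = g x
  by move=> Ox; apply: (filterS efg); exact: open_nbhs_nbhs.
  split=> // x Ox; exact: near_eq_continuous (near_fg _ Ox) (Cr_continuous Hf Ox).
split=> [x Ox|i].
  exact: near_eq_continuous (near_fg _ Ox) (Cr_continuous Hf Ox).
have [dfi Cfi] := Hf.2 i; split.
  by move=> x Ox; apply: near_eq_derivable (dfi x Ox); exact: near_fg.
by apply: IH Cfi => x Ox; apply: near_eq_derive; exact: near_fg.
Qed.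

Lemma Cr_cst k n (O : set 'rV[R]_n) (r : R) : Cr k O (fun=> r).
Proof.
elim: k r => [|k IH] r /=; (split; first by move=> x _; exact: cst_continuous) => // i.
split=> [x _|]; first exact: derivable_cst.
have -> : (fun x : 'rV[R]_n => 'D_(delta_mx 0 i) (fun=> r) x) = (fun=> 0).
  by apply: funext => x; exact: derive_cst.
exact: IH.
Qed.

Lemma Cr_add k n (O : set 'rV[R]_n) f g : open O ->
  Cr k O f -> Cr k O g -> Cr k O (fun x => f x + g x).
Proof.
move=> oO; elim: k f g => [|k IH] f g Hf Hg;
  (split; first by move=> x Ox; apply: (@continuousD R); 
     [exact: Cr_continuous Hf _ Ox | exact: Cr_continuous Hg _ Ox]) => // i.
have [dfi Cfi] := Hf.2 i; have [dgi Cgi] := Hg.2 i; split.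
  by move=> x Ox; apply: derivableD; [exact: dfi|exact: dgi].
apply: Cr_ext (IH _ _ Cfi Cgi) => // x Ox; rewrite -deriveD//.
  exact: dfi. exact: dgi.
Qed.

Lemma Cr_mul k n (O : set 'rV[R]_n) f g : open O ->
  Cr k O f -> Cr k O g -> Cr k O (fun x => f x * g x).
Proof.
move=> oO; elim: k f g => [|k IH] f g Hf Hg;
  (split; first by move=> x Ox; apply: (@continuousM R); 
     [exact: Cr_continuous Hf _ Ox | exact: Cr_continuous Hg _ Ox]) => // i.
have [dfi Cfi] := Hf.2 i; have [dgi Cgi] := Hg.2 i; split.
  by move=> x Ox; apply: derivableM; [exact: dfi|exact: dgi].
have := Cr_add oO (IH _ _ (CrW Hf) Cgi) (IH _ _ (CrW Hg) Cfi).
apply: Cr_ext => // x Ox; rewrite -deriveM//.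
  exact: dfi. exact: dgi.
Qed.

Lemma Cr_sum k n (O : set 'rV[R]_n) (I : Type) (r : seq I) (P : pred I) f : open O ->
  (forall i, Cr k O (f i)) -> Cr k O (fun x => \sum_(i <- r | P i) f i x).
Proof.
move=> oO Hf; elim: r => [|i r IH].
  by under eq_fun do rewrite big_nil; exact: Cr_cst.
under eq_fun do rewrite big_cons.
by case: (P i) => //; exact: Cr_add.
Qed.

Lemma coord_continuous_rV n (j : 'I_n) : continuous (fun x : 'rV[R]_n => x 0 j).
Proof. by move=> x; exact: coord_continuous. Qed.

Lemma Cr_coord k n (O : set 'rV[R]_n) j : Cr k O (fun x => x 0 j).
Proof.
have D i (x : 'rV[R]_n) :
    is_derive x (delta_mx 0 i) (fun x : 'rV[R]_n => x 0 j) (i == j)%:R.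
  have /derivable_mxP/(_ 0 j) := @derivable_id _ _ x (delta_mx 0 i).
  split=> //; have := @derive_id _ _ x (delta_mx 0 i).
  rewrite (derive_mx (@derivable_id _ _ x (delta_mx 0 i))) => /matrixP/(_ 0 j).
  by rewrite !mxE eqxx eq_sym.
case: k => [|k]; (split; first by move=> x _; exact: coord_continuous_rV) => // i.
split; first by move=> x Ox; exact: ex_derive.
under eq_fun do rewrite derive_val.
exact: Cr_cst.
Qed.

End CrTheory.

(** * The chain rule from partial derivatives *)

Section ChainRule.
Context {R : realType}.

Lemma nbhs_rV n (y : 'rV[R]_n) (P : set 'rV[R]_n) :
  nbhs y P <-> exists2 e : R, 0 < e &
    forall z : 'rV[R]_n, (forall j, `|z 0 j - y 0 j| < e) -> P z.
Proof.
split.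
  move=> /nbhs_ballP[e /= e0 He]; exists e => // z zy; apply: He; split=> // i j.
  by rewrite /ball /= ord1 distrC.
move=> [e e0 He]; apply/nbhs_ballP; exists e => // z [_ zy].
by apply: He => j; rewrite distrC; exact: zy.
Qed.

Lemma derive_line n (h : 'rV[R]_n -> R) (w v : 'rV[R]_n) (t : R) :
  derivable h (w + t *: v) v ->
  is_derive t 1 (fun s : R => h (w + s *: v)) ('D_v h (w + t *: v)).
Proof.
move=> dh.
have E : (fun a : R => a^-1 *: (((fun s : R => h (w + s *: v)) \o shift t) (a *: 1) -
      h (w + t *: v))) =
    (fun a : R => a^-1 *: ((h \o shift (w + t *: v)) (a *: v) - h (w + t *: v))).
  apply: funext => a /=; congr (_ *: (h _ - _)).
  by rewrite -[a *: 1]/(a * 1) mulr1 scalerDl addrCA.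
by split; rewrite /derivable /derive E.
Qed.

(** The bound |t| ≤ |d| treats both signs of [d] at once, since coordinate increments have
    either. *)
Lemma mean_value_line n (h : 'rV[R]_n -> R) (w v : 'rV[R]_n) (d : R) :
  (forall t, `|t| <= `|d| -> derivable h (w + t *: v) v) ->
  exists2 t, `|t| <= `|d| &
    h (w + d *: v) - h w = 'D_v h (w + t *: v) * d.
Proof.
move=> dh; set f := fun s : R => h (w + s *: v).
have f0 : f 0 = h w by rewrite /f scale0r addr0.
have main a b : a < b -> (forall t, t \in `[a, b] -> `|t| <= `|d|) ->
    exists2 t, `|t| <= `|d| & f b - f a = 'D_v h (w + t *: v) * (b - a).
  move=> ab Hab.
  have D t : t \in `[a, b] -> is_derive t 1 f ('D_v h (w + t *: v)).
    by move=> /Hab td; apply: derive_line; exact: dh.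
  have [t tab E] := @MVT R f (fun t => 'D_v h (w + t *: v)) a b ab
    (fun t tab => D t (subset_itv_oo_cc tab))
    (derivable_within_continuous (fun t tab => @ex_derive _ _ _ _ _ _ _ (D t tab))).
  by exists t => //; apply: Hab; exact: subset_itv_oo_cc.
case: (ltgtP d 0) => d0.
- have [|t td E] := main d 0 d0.
    move=> t; rewrite in_itv /= => /andP[dt t0].
    by rewrite !ler0_norm ?lerN2 //; exact: ltW.
  exists t => //; move: E; rewrite f0 => E.
  by rewrite -[LHS]opprB -/(f d) E sub0r mulrN opprK.
- have [|t td E] := main 0 d d0.
    move=> t; rewrite in_itv /= => /andP[t0 dt].
    by rewrite !ger0_norm //; exact: le_trans dt.
  by exists t => //; move: E; rewrite f0 subr0.
- by exists 0; rewrite ?normr0// d0 scale0r addr0 subrr mulr0.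
Qed.

(** Corner [k] of the path from [y] to [z] that changes one coordinate at a time. *)
Definition mixed n (y z : 'rV[R]_n) (k : nat) : 'rV[R]_n :=
  \row_j if (j < k)%N then z 0 j else y 0 j.

Lemma mixedS n (y z : 'rV[R]_n) (k : 'I_n) :
  mixed y z k.+1 = mixed y z k + (z 0 k - y 0 k) *: delta_mx 0 k.
Proof.
apply/rowP => j; rewrite !mxE ltnS eqxx /=.
case: (ltngtP j k) => jk.
- by rewrite -val_eqE /= (ltn_eqF jk) mulr0 addr0.
- by rewrite -val_eqE /= gtn_eqF// mulr0 addr0.
- by rewrite (val_inj jk) eqxx mulr1 addrC subrK.
Qed.

(** [Cr] speaks of partial derivatives only, so total differentiability has to be derived.
    Telescoping over the corners gives one mean value per coordinate, and [A j z] is the partial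
    derivative at the intermediate point. In no coordinate is that point farther from [y] than [z],
    so it tends to [y]. *)
Lemma hadamard n (U : set 'rV[R]_n) (h : 'rV[R]_n -> R) y : open U -> U y ->
  (forall i x, U x -> derivable h x (delta_mx 0 i)) ->
  (forall i, {for y, continuous (fun x => 'D_(delta_mx 0 i) h x)}) ->
  exists2 A : 'I_n -> 'rV[R]_n -> R,
    forall j, A j z @[z --> y] --> 'D_(delta_mx 0 j) h y &
    \forall z \near y, h z = h y + \sum_j A j z * (z 0 j - y 0 j).
Proof.
move=> oU Uy dh ch.
have [e e0 He] : exists2 e : R, 0 < e &
    forall z : 'rV[R]_n, (forall j, `|z 0 j - y 0 j| < e) -> U z.
  by apply/nbhs_rV; exact: open_nbhs_nbhs.
pose box (z : 'rV[R]_n) := forall j, `|z 0 j - y 0 j| < e.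
(* Intermediate points are chosen for all pairs (j, z) at once, arbitrarily for [z] outside the
   box. *)
have /choice[xi Hxi] : forall jz : 'I_n * 'rV[R]_n, exists x : 'rV[R]_n,
    box jz.2 ->
    (forall i, `|x 0 i - y 0 i| <= `|jz.2 0 i - y 0 i|) /\
    h (mixed y jz.2 jz.1.+1) - h (mixed y jz.2 jz.1) =
    'D_(delta_mx 0 jz.1) h x * (jz.2 0 jz.1 - y 0 jz.1).
  move=> [j z] /=; have [bz|] := pselect (box z); last by exists 0.
  have D t : `|t| <= `|z 0 j - y 0 j| -> forall i,
      `|(mixed y z j + t *: delta_mx 0 j) 0 i - y 0 i| <= `|z 0 i - y 0 i|.
    move=> td i; rewrite !mxE eqxx /=; case: (ltngtP i j) => ij.
    - by rewrite -val_eqE /= (ltn_eqF ij) mulr0 addr0.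
    - by rewrite -val_eqE /= gtn_eqF// mulr0 addr0 subrr normr0.
    - by rewrite (val_inj ij) eqxx mulr1 addrC addrA addNr add0r.
  have [t td E] := @mean_value_line n h (mixed y z j) (delta_mx 0 j) (z 0 j - y 0 j)
    (fun t td => dh _ _ (He _ (fun i => le_lt_trans (D t td i) (bz i)))).
  exists (mixed y z j + t *: delta_mx 0 j) => _; split; first exact: D.
  by rewrite mixedS E.
have near_box : \forall z \near y, box z by apply/nbhs_rV; exists e.
exists (fun j z => 'D_(delta_mx 0 j) h (xi (j, z))) => [j|].
  apply: (@cvg_comp _ _ _ (fun z => xi (j, z)) (fun x => 'D_(delta_mx 0 j) h x)
    _ (nbhs y)); last exact: ch.
  move=> P /nbhs_rV[d d0 Hd]; rewrite /nbhs /=.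
  have : \forall z \near y, box z /\ (forall i, `|z 0 i - y 0 i| < d).
    by apply: filterI => //; apply/nbhs_rV; exists d.
  apply: filterS => z [bz zd]; apply: Hd => i.
  by have [+ _] := Hxi (j, z) bz => /(_ i) /le_lt_trans; apply; exact: zd.
apply: filterS near_box => z bz.
have -> : h z = h (mixed y z n).
  by congr h; apply/rowP => j; rewrite mxE ltn_ord.
have {1}-> : h y = h (mixed y z 0).
  by congr h; apply/rowP => j; rewrite mxE.
apply/eqP; rewrite addrC -subr_eq -(telescope_sumr (fun k => h (mixed y z k)))//.
rewrite big_mkord; apply/eqP/eq_bigr => j _.
by have [_] := Hxi (j, z) bz.
Qed.

Lemma cvg_sum_fun (T I : Type) (F : set_system T) (FF : Filter F) (r : seq I)
    (f : I -> T -> R) (a : I -> R) :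
  (forall i, f i x @[x --> F] --> a i) ->
  \sum_(i <- r) f i x @[x --> F] --> \sum_(i <- r) a i.
Proof.
move=> fa; elim: r => [|i r IH].
  by under eq_fun do rewrite big_nil; rewrite big_nil; exact: cvg_cst.
by under eq_fun do rewrite big_cons; rewrite big_cons; apply: cvgD.
Qed.

(** Hadamard's form of [h] at [phi x] is divided by [a] along x + a v: the difference quotients of
    the coordinates of [phi] and the coefficients [A j] converge separately. *)
Lemma is_derive_comp_rV n m (U : set 'rV[R]_m)
    (phi : 'rV[R]_n -> 'rV[R]_m) (h : 'rV[R]_m -> R) x (v : 'rV[R]_n) :
  open U -> U (phi x) -> {for x, continuous phi} ->
  (forall j, derivable (fun x => phi x 0 j) x v) ->
  (forall i y, U y -> derivable h y (delta_mx 0 i)) ->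
  (forall i, {for phi x, continuous (fun y => 'D_(delta_mx 0 i) h y)}) ->
  is_derive x v (h \o phi)
    (\sum_j 'D_(delta_mx 0 j) h (phi x) * 'D_v (fun x => phi x 0 j) x).
Proof.
move=> oU Ux cphi dphi dh ch.
have [A cA nA] := hadamard oU Ux dh ch.
have c0 : (fun a : R => a *: v + x) @ 0^' --> x.
  have : (fun a : R => a *: v + x) @ 0 --> 0 *: v + x.
    by apply: cvgD; [apply: cvgZr_tmp; exact: cvg_id|exact: cvg_cst].
  rewrite scale0r add0r => H; apply: cvg_trans H.
  exact: cvg_app (@nbhs_dnbhs _ _).
have c1 : (fun a : R => phi (a *: v + x)) @ 0^' --> phi x.
  exact: cvg_comp c0 cphi.
have L : a^-1 *: (((h \o phi) \o shift x) (a *: v) - (h \o phi) x) @[a --> 0^'] -->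
    \sum_j 'D_(delta_mx 0 j) h (phi x) * 'D_v (fun x => phi x 0 j) x.
  have : (\sum_j A j (phi (a *: v + x)) *
       (a^-1 *: (phi (a *: v + x) 0 j - phi x 0 j))) @[a --> 0^'] -->
    \sum_j 'D_(delta_mx 0 j) h (phi x) * 'D_v (fun x => phi x 0 j) x.
    apply: cvg_sum_fun => j; apply: cvgM; last exact: dphi.
    exact: cvg_comp c1 (cA j).
  apply: cvg_trans; apply: near_eq_cvg.
  have : \forall a \near 0^', h (phi (a *: v + x)) = h (phi x) +
      \sum_j A j (phi (a *: v + x)) * (phi (a *: v + x) 0 j - phi x 0 j).
    exact: c1 _ nA.
  apply: filterS => a /= ->; rewrite (addrAC (h _)) subrr add0r scaler_sumr.
  apply: eq_bigr => j _; by rewrite mulrCA.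
split; first by apply/cvg_ex; eexists; exact: L.
exact: cvg_lim L.
Qed.

End ChainRule.

Section CrComp.
Context {R : realType}.

Lemma continuous_rV (T : topologicalType) m (phi : T -> 'rV[R]_m) (x : T) :
  (forall j, {for x, continuous (fun x => phi x 0 j)}) ->
  {for x, continuous phi}.
Proof.
move=> c P /nbhs_rV[e e0 He]; rewrite /nbhs /=.
have : \forall y \near x, forall j : 'I_m, `|phi y 0 j - phi x 0 j| < e.
  apply: filter_forall => j; have /cvgrPdist_lt/(_ e e0) := c j.
  by apply: filterS => y; rewrite distrC.
by apply: filterS => y /He.
Qed.

(** A partial derivative of the composite is a sum of products of (D_j h)(phi) with partials of the
    coordinates of [phi]; the first factors are of class C^k by induction, with [phi] fixed. *)
Lemma Cr_comp k n m (O : set 'rV[R]_n) (U : set 'rV[R]_m) phi h :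
  open O -> open U -> (forall x, O x -> U (phi x)) ->
  (forall j, Cr k O (fun x => phi x 0 j)) -> Cr k U h ->
  Cr k O (fun x => h (phi x)).
Proof.
move=> oO oU OU; elim: k h => [|k IH] h Hphi Hh.
all: have cphi x : O x -> {for x, continuous phi}
  by move=> Ox; apply: continuous_rV => j; exact: Cr_continuous (Hphi j) _ Ox.
all: have ch x : O x -> {for x, continuous (fun x => h (phi x))}
  by move=> Ox; apply: (@continuous_comp _ _ _ phi h);
     [exact: cphi | apply: Cr_continuous Hh _ (OU _ Ox)].
  by [].
split=> // i.
have D x : O x -> is_derive x (delta_mx 0 i) (fun x => h (phi x))
    (\sum_j 'D_(delta_mx 0 j) h (phi x) *
       'D_(delta_mx 0 i) (fun x => phi x 0 j) x).
  move=> Ox; apply: (@is_derive_comp_rV _ _ _ U phi h x _ oU (OU _ Ox) (cphi _ Ox)).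
  - by move=> j; apply: ((Hphi j).2 i).1.
  - by move=> j y Uy; apply: (Hh.2 j).1.
  - by move=> j; apply: Cr_continuous (Hh.2 j).2 _ (OU _ Ox).
split=> [x Ox|]; first by have [] := D x Ox.
apply: (@Cr_ext _ _ _ _ (fun x => \sum_j 'D_(delta_mx 0 j) h (phi x) *
       'D_(delta_mx 0 i) (fun x => phi x 0 j) x)) => //.
  by move=> x /D[].
apply: Cr_sum => // j; apply: Cr_mul => //; last exact: ((Hphi j).2 i).2.
by apply: IH (Hh.2 j).2 => l; exact: CrW (Hphi l).
Qed.

End CrComp.

(** * Smooth germs on embedded spaces *)

Section Germs.
Context {R : realType}.

Lemma open_continuous_preimage n m (W : set 'rV[R]_n) (T : 'rV[R]_n -> 'rV[R]_m)
    (O : set 'rV[R]_m) :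
  open W -> (forall x, W x -> {for x, continuous T}) -> open O ->
  open (W `&` T @^-1` O).
Proof.
rewrite !openE => oW cT oO x [Wx Ox]; apply: filterI; first exact: oW.
by apply: (cT x Wx); exact: oO.
Qed.

Lemma open_chart_overlap (T : topologicalType) (c c' : chart R T) :
  open (cmap c @` (cdom c `&` cdom c')).
Proof.
rewrite openE => y [x [cx c'x] <-]; rewrite /interior.
have cy : (cmap c @` cdom c) (cmap c x) by exists x.
have H1 := open_nbhs_nbhs (conj (@cimg_open _ _ c) cy).
have H2 : nbhs (cmap c x) (cinv c @^-1` cdom c').
  apply: (@cinv_cont _ _ c _ cy); rewrite cmapK//.
  by apply: open_nbhs_nbhs; split => //; exact: cdom_open.
apply: filterS (filterI H1 H2) => _ [[z cz <-]]; rewrite /preimage /= cmapK// => c'z.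
by exists z.
Qed.

Variable X : embspace R.
Implicit Types (c : forall i : fidx X, chart R (fac i)) (p q : X).

Definition in_charts c q := forall i, cdom (c i) (emb q i).

Definition charts_at c p := forall i, atlas (c i) /\ cdom (c i) (emb p i).

Lemma charts_at_in c p : charts_at c p -> in_charts c p.
Proof. by move=> H i; have [] := H i. Qed.

Lemma ex_charts_at p : exists c, charts_at c p.
Proof.
have H i : {c : chart R (fac i) | atlas c /\ cdom c (emb p i)}.
  by apply: cid; have [c] := atlas_cover (emb p i); exists c.
by exists (fun i => projT1 (H i)) => i; exact: projT2 (H i).
Qed.

Definition coord_dim c := #|{: {i : fidx X & 'I_(cdim (c i))}}|.

Definition block c (y : 'rV[R]_(coord_dim c)) i : 'rV[R]_(cdim (c i)) :=
  \row_a y 0 (enum_rank (Tagged (fun i => 'I_(cdim (c i))) a)).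

Lemma block_coords c q i : block (coords c q) i = cmap (c i) (emb q i).
Proof. by apply/rowP => a; rewrite !mxE enum_rankK. Qed.

Lemma Cr_block k c O i a : Cr k O (fun y : 'rV[R]_(coord_dim c) => block y i 0 a).
Proof. by under eq_fun do rewrite mxE; exact: Cr_coord. Qed.

Lemma block_continuous c i : continuous (fun y : 'rV[R]_(coord_dim c) => block y i).
Proof.
by move=> y; apply: continuous_rV => a; exact: (Cr_continuous (@Cr_block 0 c setT i a)).
Qed.

(** [X] carries no topology of its own; neighbourhoods are read off in product charts. *)
Definition nearX (D : set X) p := exists2 c, charts_at c p &
  exists O, [/\ open O, O (coords c p) &
    forall q, in_charts c q -> O (coords c q) -> D q].

(** Real-valued germs: by [smooth_nearP], all smoothness in the statement splits into these and
    [nearX]. *)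
Definition smooth_at (f : X -> R) p := exists2 c, charts_at c p &
  exists O, exists h, [/\ open O, O (coords c p), forall k, Cr k O h &
    forall q, in_charts c q -> O (coords c q) -> f q = h (coords c q)].

Definition transition c c' (y : 'rV[R]_(coord_dim c)) : 'rV[R]_(coord_dim c') :=
  \row_j let k := enum_val j in
    cmap (c' (tag k)) (cinv (c (tag k)) (block y (tag k))) 0 (tagged k).

Definition overlap c c' : set 'rV[R]_(coord_dim c) :=
  [set y | forall i, (cmap (c i) @` (cdom (c i) `&` cdom (c' i))) (block y i)].

Arguments overlap : clear implicits.

Lemma open_overlap c c' : open (overlap c c').
Proof.
rewrite openE => y Wy; rewrite /interior.
apply: (@filter_forall _ _ (fun i z =>
  (cmap (c i) @` (cdom (c i) `&` cdom (c' i))) (block z i)) (nbhs y)) => i.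
apply: (block_continuous (open_nbhs_nbhs (conj (@open_chart_overlap _ (c i) (c' i)) (Wy i)))).
Qed.

Lemma Cr_transition c c' p : charts_at c p -> charts_at c' p ->
  forall k j, Cr k (overlap c c') (fun y => transition c' y 0 j).
Proof.
move=> cp c'p k j; under eq_fun do rewrite mxE /=.
set i := tag (enum_val j); have [ai _] := cp i; have [a'i _] := c'p i.
have C := atlas_compat ai a'i (tagged (enum_val j)) k.
apply: (@Cr_comp _ k _ _ (overlap c c') _ (fun y => block y i) _
  (@open_overlap c c') (@open_chart_overlap _ (c i) (c' i)) _ _ C) => // a.
exact: Cr_block.
Qed.

Lemma overlap_coords c c' q : in_charts c q -> in_charts c' q ->
  overlap c c' (coords c q).
Proof. by move=> cq c'q i; rewrite block_coords; exists (emb q i) => //. Qed.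

Lemma coords_overlap c c' q : in_charts c q -> overlap c c' (coords c q) ->
  in_charts c' q.
Proof.
move=> cq Wq i; have := Wq i; rewrite block_coords => -[x [cx c'x] /(congr1 (cinv (c i)))].
by rewrite !cmapK// => <-.
Qed.

Lemma transition_coords c c' q : in_charts c q ->
  transition c' (coords c q) = coords c' q.
Proof. by move=> cq; apply/rowP => j; rewrite !mxE /= block_coords cmapK. Qed.

Lemma transition_continuous c c' p : charts_at c p -> charts_at c' p ->
  forall y, overlap c c' y -> {for y, continuous (transition (c := c) c')}.
Proof.
move=> cp c'p y Wy; apply: continuous_rV => j.
exact: (Cr_continuous (Cr_transition cp c'p 0 j)).
Qed.

(** Source of the independence of germs from charts: open sets of coordinates are carried from c' to
    c. *)
Lemma chart_change c c' p O' : charts_at c p -> charts_at c' p ->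
  open O' -> O' (coords c' p) ->
  let O := overlap c c' `&` transition c' @^-1` O' in
  [/\ open O, O (coords c p) & forall q, in_charts c q -> O (coords c q) ->
    in_charts c' q /\ O' (coords c' q)].
Proof.
move=> cp c'p oO' O'p O; split.
- apply: open_continuous_preimage => //; first exact: open_overlap.
  exact: transition_continuous cp c'p.
- split; first by apply: overlap_coords; exact: charts_at_in.
  by rewrite /preimage /= transition_coords//; exact: charts_at_in.
- move=> q cq [Wq]; rewrite /preimage /= transition_coords// => Oq; split=> //.
  exact: coords_overlap Wq.
Qed.

Lemma nearX_charts D p c : nearX D p -> charts_at c p ->
  exists O, [/\ open O, O (coords c p) &
    forall q, in_charts c q -> O (coords c q) -> D q].
Proof.
move=> [c' c'p [ O' [oO' O'p HO']]] cp.
have [oO Op HO] := chart_change cp c'p oO' O'p.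
by eexists; split; [exact: oO|exact: Op|move=> q cq /(HO _ cq)[]; exact: HO'].
Qed.

Lemma smoothf_charts f p c : smooth_at f p -> charts_at c p ->
  exists O, exists h, [/\ open O, O (coords c p), forall k, Cr k O h &
    forall q, in_charts c q -> O (coords c q) -> f q = h (coords c q)].
Proof.
move=> [c' c'p [ O' [h' [oO' O'p Ch' HO']]]] cp.
have [oO Op HO] := chart_change cp c'p oO' O'p.
exists (overlap c c' `&` transition c' @^-1` O'), (h' \o transition c').
split=> //.
  move=> k; apply: (Cr_comp oO oO') (Ch' k); first by move=> y [].
  move=> j; apply: Cr_sub (Cr_transition cp c'p k j).
  exact: subIsetl.
move=> q cq Oq; have [c'q O'q] := HO _ cq Oq.
by rewrite HO'//= transition_coords.
Qed.

Lemma nearXI D D' p : nearX D p -> nearX D' p -> nearX (D `&` D') p.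
Proof.
move=> ND ND'; have [c cp] := ex_charts_at p; exists c => //.
have [ O [oO Op HO]] := nearX_charts ND cp.
have [ O' [oO' Op' HO']] := nearX_charts ND' cp.
exists (O `&` O'); split; [exact: openI|by []|].
by move=> q cq [Oq O'q]; split; [exact: HO|exact: HO'].
Qed.

Lemma nearX_sub D D' p : D `<=` D' -> nearX D p -> nearX D' p.
Proof.
move=> DD' [c cp [ O [oO Op HO]]]; exists c => //; exists O; split=> // q cq Oq.
by apply: DD'; exact: HO.
Qed.

Lemma nearXT p : nearX setT p.
Proof. by have [c cp] := ex_charts_at p; exists c => //; exists setT; split=> //; exact: openT. Qed.

Lemma nearX_forall (I : finType) (D : I -> set X) p :
  (forall i, nearX (D i) p) -> nearX [set q | forall i, D i q] p.
Proof.
move=> ND; suff : nearX [set q | forall i, i \in enum I -> D i q] p.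
  by apply: nearX_sub => q H i; apply: H; rewrite mem_enum.
elim: (enum I) => [|i s IH]; first by apply: nearX_sub (nearXT p).
apply: nearX_sub (nearXI (ND i) IH) => q [Dq sq] j.
by rewrite inE => /predU1P[->//|]; exact: sq.
Qed.

Lemma smoothf_ext f g p : nearX [set q | f q = g q] p -> smooth_at f p -> smooth_at g p.
Proof.
move=> N Sf; have [c cp] := ex_charts_at p; exists c => //.
have [ O [oO Op HO]] := nearX_charts N cp.
have [ O' [h [oO' Op' Ch Hh]]] := smoothf_charts Sf cp.
exists (O `&` O'), h; split; [exact: openI|by []| |].
  by move=> k; apply: Cr_sub (Ch k); exact: subIsetr.
by move=> q cq [Oq O'q]; rewrite -Hh//; apply/esym; exact: HO.
Qed.

Lemma smoothf_eq f g p : f =1 g -> smooth_at f p -> smooth_at g p.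
Proof. by move=> /funext ->. Qed.

(** The first conclusion is a continuity statement that does not involve [h]; where only it is
    wanted, [h] = 0 is taken. *)
Lemma smoothf_comp m (phi : X -> 'rV[R]_m) (U : set 'rV[R]_m) (h : 'rV[R]_m -> R) p :
  (forall j, smooth_at (fun q => phi q 0 j) p) -> open U -> U (phi p) ->
  (forall k, Cr k U h) ->
  nearX [set q | U (phi q)] p /\ smooth_at (fun q => h (phi q)) p.
Proof.
move=> Sphi oU Up Ch; have [c cp] := ex_charts_at p.
have /choice[ O HO] j := smoothf_charts (Sphi j) cp.
have /choice[g Hg] := HO.
pose O1 := [set y | forall j, O j y].
have oO1 : open O1.
  rewrite openE => y Oy; apply: (@filter_forall _ _ O (nbhs y)) => j; apply: open_nbhs_nbhs.
  by split; [by have [] := Hg j|exact: Oy].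
pose G (y : 'rV[R]_(coord_dim c)) : 'rV[R]_m := \row_j g j y.
have CG k j : Cr k O1 (fun y => G y 0 j).
  have [_ _ /(_ k) C _] := Hg j; apply: (@Cr_ext _ _ _ _ (g j)) => //.
    by move=> y _; rewrite mxE.
  by apply: Cr_sub C => y; exact.
have EG q : in_charts c q -> O1 (coords c q) -> phi q = G (coords c q).
  by move=> cq Oq; apply/rowP => j; rewrite mxE; have [_ _ _ ->] := Hg j.
have O1p : O1 (coords c p) by move=> j; have [] := Hg j.
pose O2 := O1 `&` G @^-1` U.
have oO2 : open O2.
  apply: open_continuous_preimage => // y Oy; apply: continuous_rV => j.
  exact: (Cr_continuous (CG 0 j)).
have O2p : O2 (coords c p).
  by split=> //; rewrite /preimage /= -EG//; exact: charts_at_in.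
split; exists c => //.
  by exists O2; split=> // q cq [Oq]; rewrite /preimage /= -EG.
exists O2, (h \o G); split=> //.
  move=> k; apply: (Cr_comp oO2 oU) (Ch k); first by move=> y [].
  by move=> j; apply: Cr_sub (CG k j) => y [].
by move=> q cq [Oq _] /=; rewrite -EG.
Qed.

Lemma smoothf_cst r p : smooth_at (fun=> r) p.
Proof.
have [c cp] := ex_charts_at p; exists c => //.
exists setT, (fun=> r); split=> // [|k]; [exact: openT|exact: Cr_cst].
Qed.

Lemma smoothfD f g p : smooth_at f p -> smooth_at g p -> smooth_at (fun q => f q + g q) p.
Proof.
move=> Sf Sg; have [c cp] := ex_charts_at p; exists c => //.
have [ O [h [oO Op Ch Hh]]] := smoothf_charts Sf cp.
have [ O' [h' [oO' Op' Ch' Hh']]] := smoothf_charts Sg cp.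
have oI := openI oO oO'.
exists (O `&` O'), (fun y => h y + h' y); split=> //.
  move=> k; apply: Cr_add => //; [apply: Cr_sub (Ch k)|apply: Cr_sub (Ch' k)].
    exact: subIsetl. exact: subIsetr.
by move=> q cq [Oq O'q]; rewrite Hh ?Hh'.
Qed.

Lemma smoothfM f g p : smooth_at f p -> smooth_at g p -> smooth_at (fun q => f q * g q) p.
Proof.
move=> Sf Sg; have [c cp] := ex_charts_at p; exists c => //.
have [ O [h [oO Op Ch Hh]]] := smoothf_charts Sf cp.
have [ O' [h' [oO' Op' Ch' Hh']]] := smoothf_charts Sg cp.
have oI := openI oO oO'.
exists (O `&` O'), (fun y => h y * h' y); split=> //.
  move=> k; apply: Cr_mul => //; [apply: Cr_sub (Ch k)|apply: Cr_sub (Ch' k)].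
    exact: subIsetl. exact: subIsetr.
by move=> q cq [Oq O'q]; rewrite Hh ?Hh'.
Qed.

Lemma smoothf_sum (I : Type) (r : seq I) (f : I -> X -> R) p :
  (forall i, smooth_at (f i) p) -> smooth_at (fun q => \sum_(i <- r) f i q) p.
Proof.
move=> Sf; elim: r => [|i r IH].
  by under eq_fun do rewrite big_nil; exact: smoothf_cst.
by under eq_fun do rewrite big_cons; exact: smoothfD.
Qed.

Lemma smooth_nearP d (D : set X) (F : X -> 'rV[R]_d) p :
  smooth_near D F p <-> nearX D p /\ forall j, smooth_at (fun q => F q 0 j) p.
Proof.
split=> [[c cp [ O [h [oO Op Ch HO]]]]|[ND SF]].
  split=> [|j]; exists c => //.
    by exists O; split=> // q cq Oq; have [] := HO q cq Oq.
  exists O, (fun y => h y 0 j); split=> // q cq Oq.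
  by have [_ ->] := HO q cq Oq.
have [c cp] := ex_charts_at p; exists c => //.
have [ O' [oO' O'p HO']] := nearX_charts ND cp.
have /choice[ O HO] j := smoothf_charts (SF j) cp.
have /choice[g Hg] := HO.
have oI : open (O' `&` [set y | forall j, O j y]).
  apply: openI => //; rewrite openE => y Oy; apply: (@filter_forall _ _ O (nbhs y)) => j.
  by apply: open_nbhs_nbhs; split; [by have [] := Hg j|exact: Oy].
exists (O' `&` [set y | forall j, O j y]), (fun y => \row_j g j y); split=> //.
- by split=> // j; have [] := Hg j.
- move=> j k; have [_ _ /(_ k) C _] := Hg j; apply: (@Cr_ext _ _ _ _ (g j)) => //.
    by move=> y _; rewrite mxE.
  by apply: Cr_sub C => y [_]; exact.
- move=> q cq [ O'q Oq]; split; first exact: HO'.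
  by apply/rowP => j; rewrite mxE; have [_ _ _ ->] := Hg j.
Qed.

(** The definition of [smooth_map] provides one chart of [N]; compatibility of the atlas extends it
    to any chart at [F p]. *)
Lemma smooth_map_charts (N : manifold R) (F : X -> N) p (d : chart R N) :
  smooth_map F -> atlas d -> cdom d (F p) ->
  nearX [set q | cdom d (F q)] p /\ forall a, smooth_at (fun q => cmap d (F q) 0 a) p.
Proof.
move=> SF ad dp; have [c [ac cp /smooth_nearP[Nc Sc]]] := SF p.
pose U := cmap c @` (cdom c `&` cdom d).
have Up : U (cmap c (F p)) by exists (F p).
have key q : cdom c (F q) -> U (cmap c (F q)) -> cdom d (F q).
  by move=> cq [x [cx dx] /(congr1 (cinv c))]; rewrite !cmapK// => <-.
have S a := smoothf_comp Sc (@open_chart_overlap _ c d) Up (atlas_compat ac ad a).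
split=> [|a].
  have [NU _] := @smoothf_comp _ _ _ (fun=> 0) _ Sc (@open_chart_overlap _ c d) Up
    (fun k => Cr_cst k _ 0).
  by apply: nearX_sub (nearXI Nc NU) => q [cq Uq]; exact: key.
have [_] := S a; apply: smoothf_ext; apply: nearX_sub Nc => q cq /=.
by rewrite /= cmapK.
Qed.

Lemma smooth_map_emb i : @smooth_map R X (fac i) (fun q => emb q i).
Proof.
move=> p; have [c cp] := ex_charts_at p; have [ai ci] := cp i.
exists (c i); split=> //; apply/smooth_nearP; split=> [|a]; exists c => //.
  by exists setT; split=> // [|q cq _]; [exact: openT|exact: cq].
exists setT, (fun y => block y i 0 a); split=> // [|k|q cq _]; first exact: openT.
  exact: Cr_block.
by rewrite block_coords.
Qed.

End Germs.

(** * Pulling germs back along smooth maps *)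

Section Pullback.
Context {R : realType}.
Variables (X Y : embspace R) (Phi : X -> Y).
Hypothesis SPhi : forall i, @smooth_map R X (fac i) (fun q => emb (Phi q) i).

Lemma smoothf_coords (c : forall i : fidx Y, chart R (fac i)) p :
  charts_at c (Phi p) ->
  nearX [set q | in_charts c (Phi q)] p /\
  forall j, smooth_at (fun q => coords c (Phi q) 0 j) p.
Proof.
move=> cp; have S i := smooth_map_charts (SPhi i) (cp i).1 (cp i).2.
split=> [|j]; first by apply: nearX_forall => i; exact: (S i).1.
under eq_fun do rewrite mxE /=; exact: (S _).2.
Qed.

Lemma nearX_pullback (D : set Y) p : nearX D (Phi p) -> nearX (Phi @^-1` D) p.
Proof.
move=> [c cp [ O [oO Op HO]]]; have [Nc Sc] := smoothf_coords cp.
have [NU _] := @smoothf_comp _ _ _ _ _ (fun=> 0) _ Sc oO Op (fun k => Cr_cst k _ 0).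
by apply: nearX_sub (nearXI Nc NU) => q [cq Oq]; exact: HO.
Qed.

Lemma smoothf_pullback (f : Y -> R) p : smooth_at f (Phi p) -> smooth_at (f \o Phi) p.
Proof.
move=> [c cp [ O [h [oO Op Ch HO]]]]; have [Nc Sc] := smoothf_coords cp.
have [NU] := smoothf_comp Sc oO Op Ch; apply: smoothf_ext.
by apply: nearX_sub (nearXI Nc NU) => q [cq Oq] /=; rewrite HO.
Qed.

Lemma smooth_map_comp (N : manifold R) (F : Y -> N) :
  smooth_map F -> @smooth_map R X N (F \o Phi).
Proof.
move=> SF p; have [c [ac cp /smooth_nearP[Nc Sc]]] := SF (Phi p).
exists c; split=> //; apply/smooth_nearP; split; first exact: nearX_pullback Nc.
by move=> j; exact: (smoothf_pullback (Sc j)).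
Qed.

End Pullback.

(** * Smooth sections of dual and hom bundles *)

Section Transport.
Context {R : realType} {B : manifold R} {E : vbundle B}.

Lemma tr_id (x : B) (v : E x) : tr x v = v.
Proof. by rewrite /tr; case: pselect => // e; rewrite (Prop_irrelevance e erefl). Qed.

(** The disjunction excludes a detour through the default value: if x = z but y differs from both,
    the left side is 0. *)
Lemma tr_comp (x y z : B) (v : E x) : x = y \/ y = z -> tr z (tr y v) = tr z v.
Proof. by case=> [<-|<-]; rewrite tr_id. Qed.

Lemma tr_is_linear (x y : B) : linear (@tr R B E x y).
Proof.
move=> r v w; have [exy|nxy] := pselect (x = y); first by subst; rewrite !tr_id.
by rewrite /tr; case: pselect => // _; rewrite scaler0 addr0.
Qed.

HB.instance Definition _ (x y : B) :=
  GRing.isLinear.Build R (E x) (E y) _ (@tr R B E x y) (@tr_is_linear x y).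

Lemma trZ (x y : B) r (v : E x) : tr y (r *: v) = r *: tr y v.
Proof. exact: linearZ. Qed.

Lemma tr_sum (x y : B) (I : Type) (r : seq I) (v : I -> E x) :
  tr y (\sum_(i <- r) v i) = \sum_(i <- r) tr y (v i).
Proof. exact: linear_sum. Qed.

End Transport.

Section SmoothDual.
Context {R : realType} {B : manifold R}.
Implicit Types X Y : embspace R.

Definition fib_linear X (E : vbundle B) (f : X -> B) (S : forall q : X, E (f q) -> R) :=
  forall q r v w, S q (r *: v + w) = r * S q v + S q w.

(** Linearity is bundled in because a change of trivialization expands vectors in a frame. *)
Definition dual_section X (E : vbundle B) (f : X -> B) (S : forall q : X, E (f q) -> R) :=
  fib_linear S /\ smooth_dual S.

Definition hom_section X (E F : vbundle B) (f g : X -> B)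
    (T : forall q : X, E (f q) -> F (g q)) :=
  (forall q, linear (T q)) /\ smooth_hom T.

Lemma fib_linear_sum X (E : vbundle B) (f : X -> B) (S : forall q : X, E (f q) -> R) q
    (I : Type) (r : seq I) (a : I -> R) (v : I -> E (f q)) : fib_linear S ->
  S q (\sum_(i <- r) a i *: v i) = \sum_(i <- r) a i * S q (v i).
Proof.
move=> HS; have S0 : S q 0 = 0.
  by have := HS q (-1) 0 0; rewrite scaler0 addr0 mulN1r addNr.
by elim: r => [|i r IH]; rewrite ?big_nil// !big_cons HS IH.
Qed.

Lemma triv_expand (E : vbundle B) (b : triv E) x (v : E x) : tdom b x ->
  v = \sum_j (tmap b x v) 0 j *: tinv b x (delta_mx 0 j).
Proof.
move=> bx; apply: (can_inj (tmapK bx)); rewrite linear_sum {1}(row_sum_delta (tmap b x v)).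
by apply: eq_bigr => j _; rewrite linearZ /= tinvK.
Qed.

Lemma smooth_dualP X (E : vbundle B) (f : X -> B) (S : forall q : X, E (f q) -> R) :
  smooth_dual S <-> forall p, exists a : triv E, [/\ trivs a, tdom a (f p),
    nearX [set q | tdom a (f q)] p &
    forall i, smooth_at (fun q => S q (tinv a (f q) (delta_mx 0 i))) p].
Proof.
split=> H p; have [a] := H p.
  move=> [ta ap /smooth_nearP[Na Sa]]; exists a; split=> // i.
  by apply: smoothf_eq (Sa i) => q; rewrite mxE.
move=> [ta ap Na Sa]; exists a; split=> //; apply/smooth_nearP; split=> // i.
by apply: smoothf_eq (Sa i) => q; rewrite mxE.
Qed.

Lemma smooth_homP X (E F : vbundle B) (f g : X -> B)
    (T : forall q : X, E (f q) -> F (g q)) :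
  smooth_hom T <-> forall p, exists a : triv E, exists b : triv F,
    [/\ trivs a, trivs b, tdom a (f p), tdom b (g p) &
    nearX [set q | tdom a (f q) /\ tdom b (g q)] p /\
    forall i j, smooth_at (fun q =>
      tmap b (g q) (T q (tinv a (f q) (delta_mx 0 i))) 0 j) p].
Proof.
split=> H p; have [a [b]] := H p.
  move=> [ta tb ap bp /smooth_nearP[Na Sa]]; exists a, b; split=> //; split=> // i j.
  by apply: smoothf_eq (Sa (mxvec_index i j)) => q; rewrite mxvecE mxE.
move=> [ta tb ap bp [Na Sa]]; exists a, b; split=> //; apply/smooth_nearP; split=> // k.
by case/mxvec_indexP: k => i j; apply: smoothf_eq (Sa i j) => q; rewrite mxvecE mxE.
Qed.

(** The frame of [a] is expanded in that of a trivialization [b] where smoothness is known; the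
    coefficients are transition functions. *)
Lemma dual_section_triv X (E : vbundle B) (f : X -> B) (S : forall q : X, E (f q) -> R)
    (a : triv E) p :
  smooth_map f -> dual_section S -> trivs a -> tdom a (f p) ->
  nearX [set q | tdom a (f q)] p /\
  forall i, smooth_at (fun q => S q (tinv a (f q) (delta_mx 0 i))) p.
Proof.
move=> Sf [LS /smooth_dualP/(_ p)[b [tb bp Nb Sb]]] ta ap.
have /smooth_nearP[Nab Tab] := triv_compat ta tb ap bp.
have Sf' : forall i : fidx (man_space B),
    @smooth_map R X (fac i) (fun q => emb (f q : man_space B) i) by [].
have NabX := nearX_pullback Sf' Nab.
split=> [|i]; first by apply: nearX_sub NabX => q [].
have S1 : smooth_at (fun q => \sum_j tmap b (f q) (tinv a (f q) (delta_mx 0 i)) 0 j *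
    S q (tinv b (f q) (delta_mx 0 j))) p.
  apply: smoothf_sum => j; apply: smoothfM => //.
  by apply: smoothf_eq (smoothf_pullback Sf' (Tab (mxvec_index i j))) => q /=; rewrite mxvecE mxE.
apply: smoothf_ext S1; apply: nearX_sub NabX => q [aq bq] /=.
by rewrite [in RHS](triv_expand (tinv a (f q) (delta_mx 0 i)) bq) fib_linear_sum.
Qed.

Lemma dual_sectionD X (E : vbundle B) (f : X -> B) (S T : forall q : X, E (f q) -> R) :
  smooth_map f -> dual_section S -> dual_section T -> dual_section (fun q v => S q v + T q v).
Proof.
move=> Sf HS HT; split.
  by move=> q r v w; rewrite HS.1 HT.1 mulrDr addrACA.
apply/smooth_dualP => p; have /smooth_dualP/(_ p)[a [ta ap Na Sa]] := HS.2.
exists a; split=> // i; apply: smoothfD => //.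
by have [_] := dual_section_triv Sf HT ta ap; apply.
Qed.

Lemma dual_sectionZ X (E : vbundle B) (f : X -> B) (S : forall q : X, E (f q) -> R) r :
  dual_section S -> dual_section (fun q v => r * S q v).
Proof.
move=> HS; split.
  by move=> q s v w; rewrite HS.1 mulrDr mulrCA.
apply/smooth_dualP => p; have /smooth_dualP/(_ p)[a [ta ap Na Sa]] := HS.2.
by exists a; split=> // i; apply: smoothfM => //; exact: smoothf_cst.
Qed.

Lemma dual_section0 X (E : vbundle B) (f : X -> B) :
  smooth_map f -> @dual_section X E f (fun q => fun=> 0).
Proof.
move=> Sf; split; first by move=> q r v w; rewrite mulr0 addr0.
apply/smooth_dualP => p; have [a ta ap] := @triv_cover _ _ E (f p).
exists a; split=> //; last by move=> i; exact: smoothf_cst.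
have /smooth_nearP[Na _] := triv_compat ta ta ap ap.
have Sf' : forall i : fidx (man_space B),
    @smooth_map R X (fac i) (fun q => emb (f q : man_space B) i) by [].
by apply: nearX_sub (nearX_pullback Sf' Na) => q [].
Qed.

Lemma dual_section_sum X (E : vbundle B) (f : X -> B) (I : eqType) (r : seq I)
    (S : I -> forall q : X, E (f q) -> R) :
  smooth_map f -> (forall i, i \in r -> dual_section (S i)) ->
  dual_section (fun q v => \sum_(i <- r) S i q v).
Proof.
move=> Sf; elim: r => [_|i r IH HS].
  have -> : (fun (q : X) (v : E (f q)) => \sum_(i <- [::]) S i q v) = fun q => fun=> 0.
    by apply: functional_extensionality_dep => q; apply: funext => v; rewrite big_nil.
  exact: dual_section0.
have -> : (fun (q : X) (v : E (f q)) => \sum_(j <- i :: r) S j q v) =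
    fun q v => S i q v + \sum_(j <- r) S j q v.
  by apply: functional_extensionality_dep => q; apply: funext => v; rewrite big_cons.
apply: dual_sectionD => //; first by apply: HS; rewrite mem_head.
by apply: IH => j jr; apply: HS; rewrite in_cons jr orbT.
Qed.

Lemma dual_section_pullback X Y (Phi : X -> Y) (E : vbundle B) (f : Y -> B)
    (S : forall q : Y, E (f q) -> R) :
  (forall i, @smooth_map R X (fac i) (fun q => emb (Phi q) i)) -> dual_section S ->
  @dual_section X E (fun q => f (Phi q)) (fun q => S (Phi q)).
Proof.
move=> SPhi [LS SS]; split; first by move=> q; exact: LS.
apply/smooth_dualP => p; have /smooth_dualP/(_ (Phi p))[a [ta ap Na Sa]] := SS.
exists a; split=> //; first by apply: nearX_sub (nearX_pullback SPhi Na).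
by move=> i; exact: (smoothf_pullback SPhi (Sa i)).
Qed.

Lemma hom_section_pullback X Y (Phi : X -> Y) (E F : vbundle B) (f g : Y -> B)
    (T : forall q : Y, E (f q) -> F (g q)) :
  (forall i, @smooth_map R X (fac i) (fun q => emb (Phi q) i)) -> hom_section T ->
  @hom_section X E F (fun q => f (Phi q)) (fun q => g (Phi q)) (fun q => T (Phi q)).
Proof.
move=> SPhi [LT ST]; split; first by move=> q; exact: LT.
apply/smooth_homP => p; have /smooth_homP/(_ (Phi p))[a [b [ta tb ap bp [Na Sa]]]] := ST.
exists a, b; split=> //; split; first by apply: nearX_sub (nearX_pullback SPhi Na).
by move=> i j; exact: (smoothf_pullback SPhi (Sa i j)).
Qed.

Lemma dual_section_comp X (E F : vbundle B) (f g : X -> B)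
    (T : forall q : X, E (f q) -> F (g q)) (S : forall q : X, F (g q) -> R) :
  smooth_map g -> hom_section T -> dual_section S -> dual_section (fun q v => S q (T q v)).
Proof.
move=> Sg [LT ST] HS; split; first by move=> q r v w; rewrite LT HS.1.
apply/smooth_dualP => p; have /smooth_homP/(_ p)[a [b [ta tb ap bp [Na Sa]]]] := ST.
exists a; split=> //; first by apply: nearX_sub Na => q [].
move=> i.
have [_ Sb] := dual_section_triv Sg HS tb bp.
have S1 : smooth_at (fun q => \sum_j tmap b (g q) (T q (tinv a (f q) (delta_mx 0 i))) 0 j *
    S q (tinv b (g q) (delta_mx 0 j))) p.
  by apply: smoothf_sum => j; apply: smoothfM.
apply: smoothf_ext S1; apply: nearX_sub Na => q [aq bq] /=.
by rewrite [in RHS](triv_expand (T q (tinv a (f q) (delta_mx 0 i))) bq)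
  (fib_linear_sum _ _ _ HS.1).
Qed.

(** Extensionality turns the pointwise equality into [f = g], and then the transport is the
    identity. *)
Lemma dual_section_tr X (E : vbundle B) (f g : X -> B) (S : forall q : X, E (f q) -> R) :
  (forall q, f q = g q) -> dual_section S -> @dual_section X E g (fun q v => S q (tr (f q) v)).
Proof.
move=> /funext fg; subst g.
suff -> : (fun (q : X) (v : E (f q)) => S q (tr (f q) v)) = S by [].
by apply: functional_extensionality_dep => q; apply: funext => v; rewrite tr_id.
Qed.

Lemma hom_section_tr X (E F : vbundle B) (f g f' g' : X -> B)
    (T : forall q : X, E (f q) -> F (g q)) :
  (forall q, f q = f' q) -> (forall q, g q = g' q) -> hom_section T ->
  @hom_section X E F f' g' (fun q v => tr (g' q) (T q (tr (f q) v))).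
Proof.
move=> /funext ff /funext gg; subst f' g'.
suff -> : (fun (q : X) (v : E (f q)) => tr (g q) (T q (tr (f q) v))) = T by [].
by apply: functional_extensionality_dep => q; apply: funext => v; rewrite !tr_id.
Qed.

End SmoothDual.

(** * The nerve of a Lie groupoid *)

Section GroupoidAction.
Context {R : realType} {G : lieGroupoid R}.

Lemma chain_eq n (g h : chain G n) : vtx g =1 vtx h -> arr g =1 arr h -> g = h.
Proof.
case: g h => [v a sa ta] [v' a' sa' ta'] /= /funext ev /funext ea; subst v' a'.
by rewrite (Prop_irrelevance sa sa') (Prop_irrelevance ta ta').
Qed.

Definition pt n (g : chain G n) (i : nat) : obj G := vtx g (inord i).

Lemma compositeD n (g : chain G n) i a b : (i + (a + b) <= n)%N ->
  composite g i (a + b) = mul (composite g (i + a) b) (composite g i a).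
Proof.
elim: b => [|b IH] le_n.
  rewrite addn0 /=; have [|_ <-] := @composite_ends _ _ _ g i a.
    by rewrite addn0 in le_n.
  by rewrite mul_unil.
have le_n' : (i + (a + b) <= n)%N by apply: leq_trans le_n; rewrite addnS leq_add2l.
have lt_n : (i + (a + b) < n)%N by rewrite -!addnS.
rewrite addnS /= -addnA (insubT (fun m => (m < n)%N) lt_n) /=.
rewrite IH// mulA//.
  have [|_ ->] := @composite_ends _ _ _ g (i + a) b; first by rewrite -addnA.
  by rewrite src_arr; congr vtx; apply: val_inj; rewrite /= inordK -addnA// ltnW.
have [|-> _] := @composite_ends _ _ _ g (i + a) b; first by rewrite -addnA.
have [|_ ->//] := @composite_ends _ _ _ g i a.
by apply: leq_trans le_n'; rewrite leq_add2l leq_addr.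
Qed.

(** The arrow x_i -> x_n. Going through the last vertex spares [edge] a case distinction on the
    order of its ends. *)
Definition cone n (g : chain G n) (i : 'I_n.+1) : arw G := composite g i (n - i).

Lemma src_cone n (g : chain G n) i : src (cone g i) = vtx g i.
Proof.
have [|-> _] := @composite_ends _ _ _ g i (n - i); first by rewrite subnKC// -ltnS.
by rewrite inord_val.
Qed.

Lemma tgt_cone n (g : chain G n) i : tgt (cone g i) = pt g n.
Proof.
have le_i : (i <= n)%N by rewrite -ltnS.
by have [|_ ->] := @composite_ends _ _ _ g i (n - i); rewrite subnKC.
Qed.

(* The arrow x_i -> x_j of the chain, running backwards when j < i. *)
Definition edge n (g : chain G n) (i j : 'I_n.+1) : arw G :=
  mul (ginv (cone g j)) (cone g i).

Lemma src_edge n (g : chain G n) i j : src (edge g i j) = vtx g i.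
Proof. by rewrite src_mul ?src_cone// src_inv !tgt_cone. Qed.

Lemma tgt_edge n (g : chain G n) i j : tgt (edge g i j) = vtx g j.
Proof. by rewrite tgt_mul ?tgt_inv ?src_cone// src_inv !tgt_cone. Qed.

Lemma edge_refl n (g : chain G n) i : edge g i i = uni (vtx g i).
Proof. by rewrite /edge mul_invl src_cone. Qed.

Lemma mul_ginvK (a b c : arw G) : src a = tgt b -> c = mul a b ->
  mul (ginv a) c = b.
Proof.
move=> ab ->; rewrite mulA ?src_inv// mul_invl ab; exact: mul_unil.
Qed.

Lemma edge_trans n (g : chain G n) i j k :
  mul (edge g j k) (edge g i j) = edge g i k.
Proof.
have e : mul (cone g j) (edge g i j) = cone g i.
  rewrite /edge mulA ?src_inv ?tgt_inv ?tgt_cone// mul_invr tgt_cone.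
  by rewrite -(tgt_cone g i) mul_unil.
rewrite {1}/edge -mulA ?src_inv ?tgt_cone//; first by rewrite e.
by rewrite src_cone tgt_edge.
Qed.

Lemma edge_composite n (g : chain G n) (i j : 'I_n.+1) : (i <= j)%N ->
  edge g i j = composite g i (j - i).
Proof.
move=> ij; have le_j : (j <= n)%N by rewrite -ltnS.
apply: mul_ginvK.
  have [|_ ->] := @composite_ends _ _ _ g i (j - i); first by rewrite subnKC.
  by rewrite src_cone subnKC// inord_val.
have e : (j - i + (n - j) = n - i)%N by rewrite addnC addnBA// subnK.
have := @compositeD _ g i (j - i) (n - j); rewrite subnKC// e /cone => -> //.
by rewrite subnKC// (leq_trans ij).
Qed.

Lemma inordS n (i : 'I_n) : inord i.+1 = lift ord0 i :> 'I_n.+1.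
Proof. by apply: ord_inj; rewrite lift0 inordK ?ltnS. Qed.

Lemma inord_widen n (i : 'I_n) : inord i = widen_ord (leqnSn n) i :> 'I_n.+1.
Proof. by apply: ord_inj; rewrite inordK ?ltnS // ltnW. Qed.

Lemma arr_edge n (g : chain G n) (i : 'I_n) :
  arr g i = edge g (widen_ord (leqnSn n) i) (lift ord0 i).
Proof.
rewrite edge_composite; last by rewrite lift0 /=.
rewrite lift0 /= subSnn /= addn0 (insubT (fun m => (m < n)%N) (ltn_ord i)) /=.
rewrite inord_widen -src_arr.
suff -> : Sub (val i) (ltn_ord i) = i by rewrite mul_unir.
exact: val_inj.
Qed.

(* [f] need not be monotone, thanks to the inverses of the groupoid. *)
Definition nact n (g : chain G n) (p : nat) (f : nat -> nat) : chain G p.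
Proof.
refine (@Chain R G p (fun i => pt g (f i))
  (fun k : 'I_p => edge g (inord (f k)) (inord (f k.+1))) _ _) => k.
- by rewrite src_edge.
- by rewrite tgt_edge lift0.
Defined.

Lemma pt_nact n (g : chain G n) p f i : (i <= p)%N -> pt (nact g p f) i = pt g (f i).
Proof. by move=> ip; rewrite /pt /= inordK. Qed.

Lemma nact_ext n (g : chain G n) p f f' :
  (forall i, (i <= p)%N -> f i = f' i) -> nact g p f = nact g p f'.
Proof.
move=> ff; apply: chain_eq => i /=; first by rewrite ff// -ltnS.
by rewrite !ff// ltnW.
Qed.

(** Through this, all restrictions of chains compose as functions on nat. *)
Lemma act_nact n p (g : chain G n) (th : ordmap p n) :
  act g th = nact g p (fun i => th (inord i)).
Proof.
apply: chain_eq => i /=; first by rewrite /pt !inord_val.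
rewrite !inord_val inordS inord_widen edge_composite//.
by apply: ofunP; rewrite lift0 /=.
Qed.

Lemma composite_nact n (g : chain G n) p f i d : (i + d <= p)%N ->
  composite (nact g p f) i d = edge g (inord (f i)) (inord (f (i + d)%N)).
Proof.
elim: d => [|d IH] le_p /=.
  by rewrite addn0 edge_refl /pt inordK// ltnS -(addn0 i).
have lt_p : (i + d < p)%N by rewrite -addnS.
rewrite (insubT (fun m => (m < p)%N) lt_p) /= IH; last exact: ltnW.
by rewrite edge_trans addnS.
Qed.

Lemma edge_nact n (g : chain G n) p f (i j : 'I_p.+1) :
  edge (nact g p f) i j = edge g (inord (f i)) (inord (f j)).
Proof.
rewrite {1}/edge /cone !composite_nact ?subnKC -1?ltnS//.
by apply: mul_ginvK; rewrite ?edge_trans// src_edge tgt_edge.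
Qed.

(** The bound on [h] is essential: beyond p, [inord] falls back to vertex 0. *)
Lemma nact_nact n (g : chain G n) p f m h :
  (forall i, (i <= m)%N -> (h i <= p)%N) ->
  nact (nact g p f) m h = nact g m (f \o h).
Proof.
move=> hp; apply: chain_eq => i /=.
  by rewrite /pt /= inordK// ltnS hp// -ltnS.
by rewrite edge_nact !inordK// ltnS hp// ltnW.
Qed.

Lemma nact_id n (g : chain G n) f : (forall i, (i <= n)%N -> f i = i) ->
  nact g n f = g.
Proof.
move=> fi; apply: chain_eq => i /=; first by rewrite /pt fi ?inord_val// -ltnS.
by rewrite (fi i (ltnW (ltn_ord i))) (fi i.+1 (ltn_ord i)) arr_edge inordS inord_widen.
Qed.

Lemma smooth_mul (X : embspace R) (F H : X -> arw G) :
  (forall q, src (F q) = tgt (H q)) -> smooth_map F -> smooth_map H ->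
  smooth_map (fun q => mul (F q) (H q)).
Proof.
move=> FH SF SH.
pose Phi q : composable (@src _ G) (@tgt _ G) := exist _ (F q, H q) (FH q).
apply: (@smooth_map_comp _ X _ Phi _ _ _ (@mul_smooth _ G)) => -[] /=.
- exact: SF.
- exact: SH.
Qed.

Lemma smooth_ginv (X : embspace R) (F : X -> arw G) :
  smooth_map F -> smooth_map (fun q => ginv (F q)).
Proof.
move=> SF; exact: (@smooth_map_comp _ X (man_space (arw G)) F _ _ _ (@inv_smooth _ G)).
Qed.

Lemma smooth_vtx n (i : 'I_n.+1) :
  @smooth_map R (nerve G n) (obj G) (fun g => vtx g i).
Proof. exact: (@smooth_map_emb R (nerve G n) (inl i)). Qed.

Lemma smooth_arr n (i : 'I_n) :
  @smooth_map R (nerve G n) (arw G) (fun g => arr g i).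
Proof. exact: (@smooth_map_emb R (nerve G n) (inr i)). Qed.

Lemma smooth_composite n i d : (i + d <= n)%N ->
  @smooth_map R (nerve G n) (arw G) (fun g => composite g i d).
Proof.
elim: d => [|d IH] le_n /=.
  exact: (@smooth_map_comp _ (nerve G n) (man_space (obj G)) _
    (fun=> smooth_vtx (inord i)) _ _ (@uni_smooth _ G)).
have lt_n : (i + d < n)%N by rewrite -addnS.
rewrite (insubT (fun m => (m < n)%N) lt_n) /=.
apply: smooth_mul; [|exact: smooth_arr|exact: IH (ltnW lt_n)].
move=> q; have [_ ->] := composite_ends q (ltnW lt_n).
by rewrite src_arr; congr vtx; apply: val_inj; rewrite /= inordK// ltnW.
Qed.

Lemma smooth_edge n (i j : 'I_n.+1) :
  @smooth_map R (nerve G n) (arw G) (fun g => edge g i j).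
Proof.
have C (k : 'I_n.+1) : @smooth_map R (nerve G n) (arw G) (fun g => cone g k).
  by apply: smooth_composite; rewrite subnKC// -ltnS.
by apply: smooth_mul; [move=> q; rewrite src_inv !tgt_cone|exact: smooth_ginv|].
Qed.

(** Inversion in [G] is smooth, so [f] may go backwards; the smoothness of the homotopy rests on
    this. *)
Lemma smooth_nact n p f (i : fidx (nerve G p)) :
  @smooth_map R (nerve G n) (fac i) (fun g => emb (nact g p f : nerve G p) i).
Proof. case: i => i; [exact: smooth_vtx|exact: smooth_edge]. Qed.

End GroupoidAction.

(** * Indices and the components of the semi-direct product *)

Section Indices.
Local Open Scope nat_scope.

Lemma val_odelta p n k (i : 'I_p.+1) : odelta p n k i = minn (bump k i) n :> nat.
Proof. by rewrite /= inordK// ltnS geq_minr. Qed.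

Lemma val_oiota p n (i : 'I_p.+1) : oiota p n i = minn i n :> nat.
Proof. by rewrite /= inordK// ltnS geq_minr. Qed.

Lemma val_otau q n (i : 'I_q.+1) : otau q n i = minn (n - q + i) n :> nat.
Proof. by rewrite /= inordK// ltnS geq_minr. Qed.

(** The operation β -> β' on functions of nat. *)
Definition hat (f : nat -> nat) (i : nat) : nat := if i is i'.+1 then (f i').+1 else 0.

Lemma ordmap_eq p n (a b : ordmap p n) : (forall i, (i <= p)%N ->
  a (inord i) = b (inord i) :> nat) -> a = b.
Proof.
case: a b => [a Ha] [b Hb] /= ab.
have {}ab : a = b.
  by apply: funext => i; apply: ord_inj; rewrite -(inord_val i) ab// -ltnS.
by subst b; rewrite (Prop_irrelevance Ha Hb).
Qed.

(* Indices are handled as functions on nat restricted to {0,...,k}, so that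
   equalities between degrees never require a cast. *)
Definition isidx (n k : nat) (f : nat -> nat) :=
  [/\ f 0 = 0, (forall i j, (i < j <= k)%N -> (f i < f j)%N) & (f k <= n)%N].

Lemma isidx_le n k f i : isidx n k f -> (i <= k)%N -> (f i <= n)%N.
Proof.
move=> [_ fmon fk]; rewrite leq_eqVlt => /predU1P[->//|ik].
by apply: leq_trans fk; apply: ltnW; apply: fmon; rewrite ik leqnn.
Qed.

Lemma isidx_mono n k f i j : isidx n k f -> (i <= j <= k)%N -> (f i <= f j)%N.
Proof.
move=> [_ fmon _] /andP[]; rewrite leq_eqVlt => /predU1P[->//|ij jk].
by apply: ltnW; apply: fmon; rewrite ij.
Qed.

Lemma isidx_ge n k f i : isidx n k f -> (i <= k)%N -> (i <= f i)%N.
Proof.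
move=> H; elim: i => [//|i IH] ik; apply: leq_ltn_trans (IH (ltnW ik)) _.
by case: H => _ fmon _; apply: fmon; rewrite ltnSn.
Qed.

Lemma isidx_ext n k f f' : (forall i, (i <= k)%N -> f i = f' i) ->
  isidx n k f -> isidx n k f'.
Proof.
move=> ff [f0 fmon fk]; split; rewrite -?ff// => i j /andP[ij jk].
by rewrite -!ff// ?fmon ?ij//; exact: leq_trans (ltnW ij) jk.
Qed.

Lemma mkord_subproof n k f (H : isidx n k f) (i j : 'I_k.+1) : (i <= j)%N ->
  ((inord (f i) : 'I_n.+1) <= (inord (f j) : 'I_n.+1))%N.
Proof.
move=> ij; rewrite !inordK ?ltnS ?(isidx_le H) ?leq_ord//.
by rewrite (isidx_mono H)// ij leq_ord.
Qed.

Definition mkord n k f (H : isidx n k f) : ordmap k n := OMap (mkord_subproof H).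

Lemma mkordE n k f (H : isidx n k f) i : (i <= k)%N -> mkord H (inord i) = f i :> nat.
Proof. by move=> ik; rewrite /= !inordK// ltnS; exact: (isidx_le H). Qed.

Lemma is_index_isidx n k (a : ordmap k n) :
  is_index a <-> isidx n k (fun i => a (inord i)).
Proof.
split=> [[ainj a0]|[a0 amon ak]].
  split; first by rewrite -[inord 0]/(inord (ord0 : 'I_k.+1)) inord_val a0.
  - move=> i j /andP[ij jk]; have ik := leq_trans (ltnW ij) jk.
    rewrite ltn_neqAle ofunP ?inordK ?ltnS// ?andbT; last exact: ltnW.
    apply/eqP => /ord_inj/ainj/(congr1 (@nat_of_ord _)); rewrite !inordK// => e.
    by rewrite e ltnn in ij.
  - by rewrite -ltnS.
split.
  have lt (i j : 'I_k.+1) : (i < j)%N -> a i <> a j.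
    move=> ij e; have := amon i j; rewrite !inord_val e ltnn.
    by rewrite ij -ltnS ltn_ord => /(_ isT).
  move=> i j e; apply: ord_inj; case: (ltngtP i j) => // ij.
    by have := lt _ _ ij e.
  by have := lt _ _ ij (esym e).
apply: ord_inj; rewrite /= -a0; congr (nat_of_ord (a _)); apply: ord_inj.
by rewrite inordK.
Qed.

Lemma mkord_index n k f (H : isidx n k f) : is_index (mkord H).
Proof. by apply/is_index_isidx; apply: isidx_ext (H) => i ik; rewrite mkordE. Qed.

Definition mkidx n k f (H : isidx n k f) : sindex n := Index (mkord_index H).

Definition idx_val n (a : sindex n) (i : nat) : nat := a (inord i).

Lemma idx_valP n (a : sindex n) : isidx n (deg a) (idx_val a).
Proof. exact/is_index_isidx/imapP. Qed.

Lemma sindex_eq n (a b : sindex n) : deg a = deg b ->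
  (forall i, (i <= deg a)%N -> idx_val a i = idx_val b i) -> a = b.
Proof.
case: a b => [k a Ha] [k' b Hb] /= e; subst k' => ab.
have e : a = b by apply: ordmap_eq.
by subst b; rewrite (Prop_irrelevance Ha Hb).
Qed.

Lemma idx_val_max n (a : sindex n) : idx_val a (deg a) = a ord_max :> nat.
Proof. by rewrite /idx_val; congr (nat_of_ord (a _)); apply: ord_inj; rewrite inordK. Qed.

Lemma bump_leS r i : bump r i <= i.+1.
Proof. by rewrite /bump; case: (r <= i). Qed.

Lemma isidx_bump n k f r : (0 < r)%N -> isidx n k f -> isidx n.+1 k (bump r \o f).
Proof.
move=> r0 [f0 fmon fk]; split=> /=.
- by rewrite f0 /bump leqNgt r0.
- by move=> i j ij; rewrite ltnNge leq_bump2 -ltnNge fmon.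
- by apply: leq_trans (bump_leS r _) _; rewrite ltnS.
Qed.

Lemma isidx_hat n k f : isidx n k f -> isidx n.+1 k.+1 (hat f).
Proof.
by move=> [f0 fmon fk]; split=> // -[|i] [|j]//=; rewrite !ltnS => ij; exact: fmon.
Qed.

Lemma isidx_pre n k f : isidx n k.+1 f -> isidx n k f.
Proof.
move=> H; split; [by case: H| |exact: isidx_le H (leqnSn k)].
by case: H => _ fmon _ i j /andP[ij jk]; apply: fmon; rewrite ij leqW.
Qed.

Lemma isidx_preW n k k' f : (k' <= k)%N -> isidx n k f -> isidx n k' f.
Proof.
move=> /subnKC <-; elim: (k - k')%N => [|d IH]; first by rewrite addn0.
by rewrite addnS => /isidx_pre.
Qed.

Lemma isidx_compbump n k f j : (0 < j)%N -> isidx n k.+1 f -> isidx n k (f \o bump j).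
Proof.
move=> j0 H; have [f0 fmon fk] := H; split=> /=.
- by rewrite /bump leqNgt j0.
- move=> a b /andP[ab bk]; apply: fmon; rewrite ltnNge leq_bump2 -ltnNge ab /=.
  exact: leq_trans (bump_leS j b) _.
- by apply: (isidx_le H); exact: bump_leS.
Qed.

End Indices.

(** * Components of the faces *)

Section Components.
Context {R : realType} {G : lieGroupoid R} {E : nat -> vbundle (obj G)}.

Lemma spi_imap n (p : semidirect E n) (a : sindex n) : spi p (imap a) = projT2 p a.
Proof.
rewrite /spi; case: a => k a Ha /=; case: pselect => // h.
by rewrite (Prop_irrelevance h Ha).
Qed.

(* The component pi_f of [p], moved to the fiber at [y]; it is 0 when [f] is not
   an index or [y] is not the vertex it should be. *)
Definition pi_at n (p : semidirect E n) k f y : E k y :=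
  match pselect (isidx n k f) with
  | left H => tr y (spi p (mkord H))
  | right _ => 0
  end.

Lemma pi_at_ext n (p : semidirect E n) k f f' y :
  (forall i, (i <= k)%N -> f i = f' i) -> pi_at p k f y = pi_at p k f' y.
Proof.
move=> ff; rewrite /pi_at; case: pselect => H; case: pselect => H' //.
- suff -> : mkord H = mkord H' by [].
  by apply: ordmap_eq => i ik; rewrite !mkordE// ff.
- by case: H'; apply: isidx_ext H.
- by case: H; apply: isidx_ext H' => i ik; rewrite ff.
Qed.

Lemma spi_pi_at n (p : semidirect E n) k (a : ordmap k n) y :
  tr y (spi p a) = pi_at p k (fun i => a (inord i)) y.
Proof.
rewrite /pi_at; case: pselect => H.
  suff -> : mkord H = a by [].
  by apply: ordmap_eq => i ik; rewrite mkordE.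
rewrite /spi; case: pselect => h; last by rewrite linear0.
by case: H; apply/is_index_isidx.
Qed.

Lemma projT2_pi_at n (p : semidirect E n) (a : sindex n) y :
  tr y (projT2 p a : E (deg a) _) = pi_at p (deg a) (idx_val a) y.
Proof. by rewrite -spi_imap spi_pi_at. Qed.

Lemma pi_at_mkidx n (p : semidirect E n) k f (H : isidx n k f) y :
  pi_at p k f y = tr y (projT2 p (mkidx H) : E k _).
Proof.
rewrite -(spi_imap p (mkidx H)) spi_pi_at; apply: pi_at_ext => i ik.
by rewrite mkordE.
Qed.

(** Testing components at a free point [y] avoids comparing dependent families over chains that are
    only provably equal. *)
Lemma semidirect_eq n (p q : semidirect E n) : projT1 p = projT1 q ->
  (forall k f y, isidx n k f -> y = pt (projT1 p) (f k) -> pi_at p k f y = pi_at q k f y) ->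
  p = q.
Proof.
case: p q => [g v] [g' w] /= e; subst g' => H; congr existT.
apply: functional_extensionality_dep => a.
have := H (deg a) (idx_val a) (vtx g (a ord_max)) (idx_valP a).
rewrite -!projT2_pi_at /= !tr_id; apply.
by rewrite idx_val_max /pt inord_val.
Qed.

Variable rho : rep E.

(** R_m on the chain g f, between fibers over free points; by the convention on [tr] it is 0 unless
    these are the end vertices. *)
Definition ruth_at n (g : chain G n) m (f : nat -> nat) k l x y (v : E k x) : E l y :=
  tr y (rho m (nact g m f) k l (tr (vtx (nact g m f) ord0) v)).

Lemma ruth_at_is_linear n (g : chain G n) m f k l x y : linear (@ruth_at n g m f k l x y).
Proof. by move=> r v w; rewrite /ruth_at !linearP. Qed.

HB.instance Definition _ n (g : chain G n) m f k l x y :=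
  GRing.isLinear.Build R (E k x) (E l y) _ (@ruth_at n g m f k l x y)
    (@ruth_at_is_linear n g m f k l x y).

Lemma ruth_at_deg n (g : chain G n) m f k l x y (v : E k x) : (l + 1 != k + m)%N ->
  ruth_at g m f l y v = 0.
Proof. by move=> kl; rewrite /ruth_at ruth_deg ?linear0. Qed.

Lemma ruth_atZ n (g : chain G n) m f k l x y r (v : E k x) :
  ruth_at g m f l y (r *: v) = r *: ruth_at g m f l y v.
Proof. exact: linearZ. Qed.

Lemma ruth_atB n (g : chain G n) m f k l x y (v w : E k x) :
  ruth_at g m f l y (v - w) = ruth_at g m f l y v - ruth_at g m f l y w.
Proof. exact: linearB. Qed.

Lemma ruth_at_sum n (g : chain G n) m f k l x y (I : Type) (r : seq I) (v : I -> E k x) :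
  ruth_at g m f l y (\sum_(i <- r) v i) = \sum_(i <- r) ruth_at g m f l y (v i).
Proof. exact: linear_sum. Qed.

Lemma ruth_at_ext n (g : chain G n) m f f' k l x y (v : E k x) :
  (forall i, (i <= m)%N -> f i = f' i) ->
  ruth_at g m f l y v = ruth_at g m f' l y v.
Proof. by move=> ff; rewrite /ruth_at (nact_ext g ff). Qed.

Lemma ruth_at_nact n (g : chain G n) p f' m f k l x y (v : E k x) :
  (forall i, (i <= m)%N -> (f i <= p)%N) ->
  ruth_at (nact g p f') m f l y v = ruth_at g m (f' \o f) l y v.
Proof. by move=> fp; rewrite /ruth_at nact_nact. Qed.

Lemma ruth_at_act n (g : chain G n) m (th : ordmap m n) k l x y (v : E k x) :
  tr y (rho m (act g th) k l (tr (vtx (act g th) ord0) v)) =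
  ruth_at g m (fun i => th (inord i)) l y v.
Proof. by rewrite /ruth_at -act_nact. Qed.

Lemma pi_at_face_S n (p : semidirect E n.+1) r l f y : (0 < r)%N -> isidx n l f ->
  pi_at (face rho r p) l f y = pi_at p l (bump r \o f) y.
Proof.
case: r => // r _ H; rewrite (pi_at_mkidx _ H) /=.
apply: etrans (spi_pi_at p (ocomp (odelta n n.+1 r.+1) (mkord H)) y) _.
apply: pi_at_ext => i il; rewrite [LHS]val_odelta mkordE//; apply/minn_idPl.
exact: isidx_le (isidx_bump _ H) il.
Qed.

Lemma oprimeE l n (b : ordmap l n) i : (i <= l.+1)%N ->
  oprime b (inord i) = hat (fun i => b (inord i)) i :> nat.
Proof.
move=> il; rewrite /= /oprime_fun; case: unliftP => [j e|e].
  have := congr1 (@nat_of_ord _) e; rewrite lift0 inordK// => ->.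
  by rewrite lift0 /= inord_val.
by have := congr1 (@nat_of_ord _) e; rewrite inordK// => ->.
Qed.

(** The defining formula of d_0 with the casts absorbed: β'τ_{l+1-k} is [hat f] shifted by k, as
    τ_{l+1-k} starts at k. *)
Lemma pi_at_face_0 n (p : semidirect E n.+1) l f y : isidx n l f ->
  y = pt (projT1 p) (f l).+1 ->
  pi_at (face rho 0 p) l f y =
  \sum_(0 <= k < l.+2) (-1) ^+ l *:
     ruth_at (projT1 p) (l.+1 - k) (fun i => hat f (k + i)) l y
       (pi_at p k (hat f) (pt (projT1 p) (hat f k)))
  - \sum_(1 <= j < l.+1) (-1) ^+ j *: pi_at p l (hat f \o bump j) y.
Proof.
move=> H ey; rewrite (pi_at_mkidx _ H) /=.
set z := vtx _ _; have ez : z = y.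
  rewrite /z /= ey /pt; congr vtx; apply: ord_inj.
  rewrite !inordK ?ltnS ?geq_minr ?(isidx_le H)//.
  by apply/minn_idPl; rewrite ltnS; exact: (isidx_le H).
have hatE k (th : ordmap k l.+1) i : (i <= k)%N ->
    ocomp (oprime (mkord H)) th (inord i) = hat f (th (inord i)) :> nat.
  move=> ik; have -> : ocomp (oprime (mkord H)) th (inord i) =
      oprime (mkord H) (inord (th (inord i))) by rewrite inord_val.
  rewrite oprimeE ?leq_ord//.
  have : (th (inord i) < l.+2)%N by [].
  by case: (nat_of_ord (th _)) => [//|j]; rewrite /hat !ltnS => jl; rewrite mkordE.
rewrite linearB /=; congr (_ - _); rewrite linear_sum;
  apply: eq_big_nat => k /andP[k0 kl].
  rewrite !linearZ /=; congr (_ *: _).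
  rewrite tr_comp; last by right.
  pose c := act (projT1 p) (ocomp (oprime (mkord H)) (otau (l.+1 - k) l.+1)).
  apply: (@etrans _ _ (tr y (rho (l.+1 - k)%N c k l
    (tr (vtx c ord0) (pi_at p k (hat f) (pt (projT1 p) (hat f k))))))); last first.
    rewrite ruth_at_act; apply: ruth_at_ext => i ik.
    rewrite hatE// val_otau inordK// subKn//; congr hat; apply/minn_idPl.
    by rewrite -(subnKC (kl : k <= l.+1)%N) leq_add2l.
  apply: (congr1 (fun u => tr y (rho (l.+1 - k)%N c k l u))).
  apply: etrans (spi_pi_at p (ocomp (oprime (mkord H)) (oiota k l.+1)) _) _.
  set z' := vtx _ ord0.
  have -> : z' = pt (projT1 p) (hat f k).
    rewrite /z' /pt /=; congr vtx; apply: ord_inj.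
    have -> : inord (minn (l.+1 - (l.+1 - k) + 0) l.+1) =
        otau (l.+1 - k) l.+1 (inord 0).
      by rewrite /= inordK.
    rewrite [LHS]hatE// val_otau inordK// subKn// addn0 (minn_idPl _)//.
    by rewrite inordK// ltnS; exact: (isidx_le (isidx_hat H)).
  rewrite tr_id; apply: pi_at_ext => i ik.
  rewrite hatE// val_oiota inordK//; congr hat; apply/minn_idPl.
  exact: leq_trans ik kl.
rewrite !linearZ /=; congr (_ *: _).
rewrite tr_comp; last by right.
apply: etrans (spi_pi_at p (ocomp (oprime (mkord H)) (odelta l l.+1 k)) _) _.
apply: pi_at_ext => i ik; rewrite hatE// val_odelta inordK//=.
congr hat; apply/minn_idPl; exact: leq_trans (bump_leS _ _) _.
Qed.

End Components.

(** * Simplicial identities *)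

(** The cosimplicial identity for the maps δ. *)
Lemma bump_bump i j x : (i < j)%N -> bump j (bump i x) = bump i (bump j.-1 x).
Proof.
move=> ij; rewrite /bump.
case: (leqP i x) => ?; case: (leqP j.-1 x) => ? /=; rewrite ?add0n ?add1n;
  by [case: (leqP j x.+1) => ? /=; try case: (leqP i x.+1) => ?; lia
     |case: (leqP j x) => ? /=; try case: (leqP i x) => ?; lia
     |case: (leqP j x) => ? /=; try case: (leqP i x.+1) => ?; lia
     |case: (leqP j x.+1) => ? /=; try case: (leqP i x) => ?; lia].
Qed.

(** * Rearrangements of double sums *)

Section NatSums.
Context {M : zmodType}.

Lemma exchange_triangle n (H : nat -> nat -> M) :
  \sum_(0 <= k < n) \sum_(0 <= j < k.+1) H k j =
  \sum_(0 <= j < n) \sum_(0 <= q < n - j) H (j + q)%N j.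
Proof.
elim: n => [|n IH]; first by rewrite !big_geq.
rewrite big_nat_recr//= IH [RHS]big_nat_recr//= subSnn big_nat1 addn0.
rewrite [X in _ + X]big_nat_recr//= addrA; congr (_ + _).
rewrite -big_split /=; apply: eq_big_nat => j /andP[_ jn].
by rewrite subSn ?(ltnW jn)// [RHS]big_nat_recr//= subnKC// ltnW.
Qed.

(** The last row and the last column cancel each other, and the same sum for a smaller N remains. *)
Lemma alternating_square N (F : nat -> nat -> M) :
  (forall r s, (s < r <= N)%N -> F r s = - F s r.-1) ->
  \sum_(0 <= r < N.+1) \sum_(0 <= s < N) F r s = 0.
Proof.
elim: N => [|N IH] HF; first by rewrite big_nat1 big_geq.
rewrite big_nat_recr//=; under eq_big_nat do rewrite big_nat_recr//=.
rewrite big_split /= IH ?add0r; last first.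
  by move=> r s /andP[sr rN]; apply: HF; rewrite sr leqW.
rewrite -big_split /= big_nat big1// => r /andP[_ rN].
by rewrite [X in _ + X]HF ?subrr// rN leqnn.
Qed.

(** The terms with a ≤ i give all W u v with 1 ≤ u ≤ v, those with i < a minus all W u v with 2 ≤ u
    ≤ v; the row u = 1 is left. *)
Lemma alternating_shift N (D W : nat -> nat -> M) :
  (forall i a, (a <= i)%N -> D i a = W a i) ->
  (forall i a, (i < a)%N -> D i a = - W i.+1 a) ->
  \sum_(1 <= i < N.+1) \sum_(1 <= a < N.+1) D i a = \sum_(1 <= a < N.+1) W 1%N a.
Proof.
move=> Dle Dgt; elim: N => [|N IH]; first by rewrite !big_geq.
rewrite big_nat_recr//= [RHS]big_nat_recr//= -IH.
under eq_big_nat do rewrite big_nat_recr//=.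
rewrite big_split /= -addrA; congr (_ + _).
have -> : \sum_(1 <= i < N.+1) D i N.+1 = - \sum_(1 <= i < N.+1) W i.+1 N.+1.
  by rewrite -sumrN; apply: eq_big_nat => i /andP[_ iN]; exact: Dgt.
have -> : \sum_(1 <= a < N.+2) D N.+1 a = \sum_(1 <= a < N.+2) W a N.+1.
  by apply: eq_big_nat => a /andP[_ aN]; exact: Dle.
by rewrite [\sum_(1 <= a < N.+2) _]big_nat_recl//= addrC addrK.
Qed.

End NatSums.

Section Simplicial.
Context {R : realType} {G : lieGroupoid R} {E : nat -> vbundle (obj G)}.
Variable rho : rep E.

Local Notation ruth_at := (ruth_at rho).

Lemma ruth_at_act_tr n (h : chain G n) m (th : ordmap m n) k l x x' y z (v : E k x) :
  z = y -> x = x' \/ x' = vtx (act h th) ord0 ->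
  tr y (tr z (rho m (act h th) k l (tr (vtx (act h th) ord0) (tr x' v)))) =
  ruth_at h m (fun i => th (inord i)) l y v.
Proof. by move=> zy xx; rewrite tr_comp; [rewrite tr_comp// ruth_at_act|right]. Qed.

Lemma ruth_at_tr n (g : chain G n) m f k l x x' y (v : E k x) : x' = pt g (f 0%N) ->
  ruth_at g m f l y (tr x' v) = ruth_at g m f l y v.
Proof. by move=> ex; rewrite /ruth_at tr_comp//; right. Qed.

(** (RH2) for the chain g f. The degree [(k + i).-1] is truncated only for k = i = 0, where R_0 is 0
    on E_0. *)
Lemma ruth_at_structure n (g : chain G n) m f k l x y (v : E k x) :
  x = pt g (f 0%N) -> y = pt g (f m) ->
  \sum_(1 <= i < m) (-1) ^+ i *: ruth_at g m.-1 (f \o bump i) l y v =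
  \sum_(0 <= i < m.+1) (-1) ^+ i *: ruth_at g (m - i) (fun a => f (i + a)%N) l y
    (ruth_at g i f (k + i).-1 (pt g (f i)) v).
Proof.
move=> ex ey; set h := nact g m f.
have hx : vtx h ord0 = x by rewrite ex.
have hy : vtx h ord_max = y by rewrite ey.
have := congr1 (tr y) (ruth_structure rho l (tr (vtx h ord0) v : E k _)).
rewrite !tr_sum => e; apply: etrans (etrans _ e) _ => {e};
    apply: eq_big_nat => i /andP[i0 im]; rewrite trZ; congr (_ *: _).
  apply/esym; apply: etrans (@ruth_at_act_tr _ h _ (odelta m.-1 m i) k l x (vtx h ord0)
    y (vtx h ord_max) v hy (or_introl (esym hx))) _.
  rewrite ruth_at_nact; last by move=> a _; rewrite leq_ord.
  apply: ruth_at_ext => a am /=; congr f; rewrite inordK ?geq_minr ?ltnS ?geq_minr//.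
  rewrite inordK//; apply/minn_idPl; apply: leq_trans (bump_leS i a) _; lia.
have mi j : (j <= i)%N -> minn j m = j by move=> ji; apply/minn_idPl; lia.
rewrite tr_comp; last by right.
rewrite ruth_at_act.
set w := rho i _ _ _ _.
have -> : ruth_at g i f (k + i).-1 (pt g (f i)) v = tr (pt g (f i)) w.
  rewrite /w tr_comp; last by left; rewrite hx.
  rewrite ruth_at_act ruth_at_nact; last by move=> a _; rewrite leq_ord.
  by apply: ruth_at_ext => a am /=; rewrite inordK ?ltnS ?geq_minr// inordK// mi.
rewrite ruth_at_tr ?addn0//.
rewrite ruth_at_nact; last by move=> a _; rewrite leq_ord.
apply: ruth_at_ext => a am /=; congr f; rewrite inordK ?geq_minr ?ltnS ?geq_minr//.
by rewrite inordK// subKn//; apply/minn_idPl; lia.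
Qed.

Lemma face_base n (p : semidirect E n.+1) r : (r <= n.+1)%N ->
  projT1 (face rho r p) = nact (projT1 p) n (bump r).
Proof.
move=> rn; rewrite /= act_nact; apply: nact_ext => i ilen.
by rewrite val_odelta inordK//; apply/minn_idPl; exact: leq_trans (bump_leS r i) _.
Qed.

Lemma pt_face n (p : semidirect E n.+1) r i : (r <= n.+1)%N -> (i <= n)%N ->
  pt (projT1 (face rho r p)) i = pt (projT1 p) (bump r i).
Proof. by move=> rn ilen; rewrite face_base// pt_nact. Qed.

End Simplicial.

Section SimplicialIdentities.
Context {R : realType} {G : lieGroupoid R} {E : nat -> vbundle (obj G)}.
Variable rho : rep E.

Local Notation ruth_at := (ruth_at rho).
Local Notation face := (face rho).

Lemma pi_at_face_S_face_S n (p : semidirect E n.+2) i j l f y :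
  (0 < i < j)%N -> isidx n l f ->
  pi_at (face i (face j p)) l f y = pi_at (face j.-1 (face i p)) l f y.
Proof.
move=> /andP[i0 ij] H; have j0 : (0 < j.-1)%N by lia.
rewrite !pi_at_face_S//; try exact: isidx_bump; try lia.
by apply: pi_at_ext => a _ /=; rewrite bump_bump.
Qed.

Lemma hat_bump j f : (0 < j)%N -> hat (bump j.-1 \o f) = bump j \o hat f.
Proof. by case: j => // j _; apply: funext => -[|i] //=; rewrite bumpS. Qed.

Lemma pi_at_face_0_face_S n (p : semidirect E n.+2) j l f y :
  (1 < j <= n.+2)%N -> isidx n l f -> y = pt (projT1 p) (bump j (f l).+1) ->
  pi_at (face 0 (face j p)) l f y = pi_at (face j.-1 (face 0 p)) l f y.
Proof.
move=> /andP[j1 jn] H ey; have j0 : (0 < j.-1)%N by lia.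
have fl : (f l <= n)%N by case: H.
have eyj : y = pt (projT1 p) ((bump j.-1 \o f) l).+1.
  by rewrite ey -bumpS prednK// ltnW.
rewrite pi_at_face_0//; last by rewrite pt_face.
rewrite pi_at_face_S// (pi_at_face_0 _ (isidx_bump j0 H) eyj) hat_bump; last exact: ltnW.
congr (_ - _); apply: eq_big_nat => k /andP[k0 kl]; congr (_ *: _).
  have hk i : (i <= l.+1)%N -> (hat f i <= n.+1)%N.
    exact: isidx_le (isidx_hat H).
  rewrite pt_face ?hk// face_base// ruth_at_nact; last by move=> a ak; apply: hk; lia.
  by rewrite pi_at_face_S ?(ltnW j1)//; apply: isidx_preW (isidx_hat H); lia.
rewrite pi_at_face_S ?(ltnW j1)//.
by apply: isidx_compbump => //; exact: isidx_hat.
Qed.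

Section FirstTwoFaces.
Variables (n : nat) (p : semidirect E n.+2) (l : nat) (f : nat -> nat) (y : obj G).
Hypotheses (H : isidx n l f) (ey : y = pt (projT1 p) (f l).+2).

Let phi := hat (hat f).
Let g := projT1 p.

(* In d_0 d_0 the terms in two components of R are the [T k j]; (RH2) rewrites
   their alternating sum in terms of the [X i j], in which the vertex i is
   skipped. The latter then cancel except for those with i = 1, which make up
   d_0 d_1. *)
Let X i j : E l y := ruth_at g (l.+1 - j) (fun a => phi (bump i (j + a))) l y
  (pi_at p j (phi \o bump i) (pt g (phi (bump i j)))).

Let phi_bump1 : bump 1 \o hat f = phi \o bump 1.
Proof. by apply: funext => -[|i]. Qed.

Let phi_bump i : (0 < i)%N -> hat (hat f \o bump i) = phi \o bump i.+1.
Proof.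
by move=> i0; apply: funext => -[|a] //=; rewrite bumpS.
Qed.

Let Hh := isidx_hat H.

Let Hphi : isidx n.+2 l.+2 phi. Proof. exact: isidx_hat Hh. Qed.

Lemma pi_at_face01 : pi_at (face 0 (face 1 p)) l f y =
  \sum_(0 <= j < l.+2) (-1) ^+ l *: X 1 j -
  \sum_(1 <= i < l.+1) (-1) ^+ i *: pi_at p l (phi \o bump 1 \o bump i) y.
Proof.
have fl : (f l <= n)%N by case: H.
rewrite pi_at_face_0//; last by rewrite pt_face.
congr (_ - _); apply: eq_big_nat => k /andP[k0 kl]; congr (_ *: _).
  have hk i : (i <= l.+1)%N -> (hat f i <= n.+1)%N by exact: isidx_le Hh.
  rewrite pt_face ?hk// face_base// ruth_at_nact; last by move=> a ak; apply: hk; lia.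
  rewrite pi_at_face_S//; last first.
    by apply: isidx_preW Hh; lia.
  have E1 a : bump 1 (hat f a) = phi (bump 1 a).
    by rewrite -[RHS]/((phi \o bump 1) a) -phi_bump1.
  by rewrite phi_bump1 E1 /X; apply: ruth_at_ext => a _ /=; rewrite E1.
rewrite pi_at_face_S//.
  by apply: pi_at_ext => a _ /=; rewrite -[RHS]/((phi \o bump 1) (bump k a)) -phi_bump1.
by apply: isidx_compbump => //; exact: isidx_hat.
Qed.

Let T k j : E l y := ruth_at g (l.+2 - k) (fun a => phi (k + a)) l y
  (ruth_at g (k - j) (fun a => phi (j + a)) k.-1 (pt g (phi k))
    (pi_at p j phi (pt g (phi j)))).

Lemma pi_at_face00 : pi_at (face 0 (face 0 p)) l f y =
  \sum_(0 <= k < l.+2) (-1) ^+ l *: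
    (\sum_(0 <= j < k.+2) (-1) ^+ k *: T k.+1 j -
     \sum_(1 <= i < k.+1) (-1) ^+ i *: X i k)
  - \sum_(1 <= i < l.+1) (-1) ^+ i *:
    (\sum_(0 <= j < l.+2) (-1) ^+ l *: X i.+1 j -
     \sum_(1 <= a < l.+1) (-1) ^+ a *: pi_at p l (phi \o bump i.+1 \o bump a) y).
Proof.
have fl : (f l <= n)%N by case: H.
rewrite pi_at_face_0//; last by rewrite pt_face.
congr (_ - _); apply: eq_big_nat => k /andP[k0 kl]; congr (_ *: _).
  have hk i : (i <= l.+1)%N -> (hat f i <= n.+1)%N by exact: isidx_le Hh.
  rewrite pt_face ?hk// face_base// ruth_at_nact; last by move=> a ak; apply: hk; lia.
  rewrite pi_at_face_0//; last first.
    by apply: isidx_preW Hh; lia.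
  rewrite ruth_atB !ruth_at_sum; congr (_ - _); apply: eq_big_nat => j /andP[j0 jk].
    by rewrite ruth_atZ.
  rewrite ruth_atZ; congr (_ *: _).
  have bk a : bump j (k + a) = (k + a).+1 by rewrite /bump; lia.
  rewrite /X -[in phi (bump j k)](addn0 k) bk addn0.
  by apply: ruth_at_ext => a _; rewrite bk.
have kl' : bump k l = l.+1 by rewrite /bump; lia.
rewrite pi_at_face_0//; last by rewrite /= kl'.
  by rewrite phi_bump.
by apply: isidx_compbump => //; exact: isidx_hat.
Qed.

Let T00 : T 0 0 = 0.
Proof.
rewrite /T (_ : ruth_at g (0 - 0) _ 0.-1 _ _ = 0) ?linear0//.
exact: ruth_at_deg.
Qed.

(** (RH2) for the part of the chain from position j on; renumbering the skipped position by j
    produces the sign (-1)^(j + i). *)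
Let sum_T_row j : (j < l.+3)%N ->
  \sum_(0 <= q < l.+3 - j) (-1) ^+ q *: T (j + q) j =
  \sum_(j.+1 <= i < l.+2) (-1) ^+ (j + i) *: X i j.
Proof.
move=> jl; pose f' a := phi (j + a).
have ej : pt g (phi j) = pt g (f' 0%N) by rewrite /f' addn0.
have eyj : y = pt g (f' (l.+2 - j)%N) by rewrite /f' subnKC.
have := @ruth_at_structure _ _ _ rho _ g (l.+2 - j) f' j l _ y
  (pi_at p j phi (pt g (phi j))) ej eyj.
rewrite -subSn// => e; apply: etrans (etrans _ (esym e)) _.
  apply: eq_big_nat => q /andP[_ ql]; congr (_ *: _).
  by rewrite /T addKn subnDA; apply: ruth_at_ext => a _; rewrite /f' addnA.
rewrite -[j.+1]add1n big_addn.
apply: eq_big_nat => i /andP[i1 il].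
have -> : (-1) ^+ (j + (i + j)) = (-1) ^+ i :> R.
  by rewrite addnCA addnn -signr_odd oddD odd_double addbF signr_odd.
congr (_ *: _).
have bj a : bump (i + j) (j + a) = (j + bump i a)%N by rewrite /bump; lia.
have bj' a : (a <= j)%N -> bump (i + j) a = a by rewrite /bump; lia.
rewrite /X bj'// (@pi_at_ext _ _ _ _ p j (phi \o bump (i + j)) phi).
  have -> : (l.+2 - j).-1 = (l.+1 - j)%N by lia.
  by apply: ruth_at_ext => a _; rewrite /= bj.
by move=> a aj /=; rewrite bj'.
Qed.

(** Grouped by j, each row is an instance of (RH2). The vanishing [T 0 0] completes the triangle 0 ≤
    j ≤ k ≤ l+2. *)
Lemma sum_T : \sum_(0 <= k < l.+2) \sum_(0 <= j < k.+2) (-1) ^+ k *: T k.+1 j =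
  - \sum_(0 <= j < l.+2) \sum_(j.+1 <= i < l.+2) (-1) ^+ i *: X i j.
Proof.
pose K k j := - (-1) ^+ k *: T k j.
have -> : \sum_(0 <= k < l.+2) \sum_(0 <= j < k.+2) (-1) ^+ k *: T k.+1 j =
    \sum_(0 <= k < l.+3) \sum_(0 <= j < k.+1) K k j.
  rewrite [RHS]big_nat_recl//= big_nat1 {1}/K T00 scaler0 add0r.
  by apply: eq_bigr => k _; apply: eq_bigr => j _; rewrite /K exprS mulN1r opprK.
rewrite exchange_triangle -sumrN.
have -> : \sum_(0 <= j < l.+2) - (\sum_(j.+1 <= i < l.+2) (-1) ^+ i *: X i j) =
    \sum_(0 <= j < l.+3) - (\sum_(j.+1 <= i < l.+2) (-1) ^+ i *: X i j).
  by rewrite [RHS]big_nat_recr//= [in RHS](@big_geq _ _ _ l.+3)// oppr0 addr0.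
apply: eq_big_nat => j /andP[_ jl].
have -> : \sum_(0 <= q < l.+3 - j) K (j + q)%N j =
    - (-1) ^+ j *: (\sum_(0 <= q < l.+3 - j) (-1) ^+ q *: T (j + q) j).
  rewrite scaler_sumr; apply: eq_bigr => q _.
  by rewrite /K scalerA mulNr -exprD.
rewrite sum_T_row// scaleNr scaler_sumr; congr (- _); apply: eq_bigr => i _.
have e : (-1) ^+ (j + (j + i)) = (-1) ^+ i :> R.
  by rewrite addnA addnn -signr_odd oddD odd_double signr_odd.
by rewrite scalerA -exprD e.
Qed.

(** The [X i j] with i ≤ j come from the R-free terms of the inner d_0, those with i > j from (RH2).
    The outer R-free terms then remove all i ≥ 2. Terms without any R are left to
    [alternating_shift]. *)
Lemma pi_at_face00_face01 : pi_at (face 0 (face 0 p)) l f y = pi_at (face 0 (face 1 p)) l f y.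
Proof.
pose S i := \sum_(0 <= j < l.+2) X i j.
pose Z a i : E l y := pi_at p l (phi \o bump a \o bump i) y.
rewrite pi_at_face00 pi_at_face01.
have -> : \sum_(0 <= k < l.+2) (-1) ^+ l *:
    (\sum_(0 <= j < k.+2) (-1) ^+ k *: T k.+1 j -
     \sum_(1 <= i < k.+1) (-1) ^+ i *: X i k) =
    - ((-1) ^+ l *: \sum_(1 <= i < l.+2) (-1) ^+ i *: S i).
  rewrite -scaler_sumr big_split /= sum_T sumrN -opprD -scalerN; congr (_ *: - _).
  rewrite -big_split /=; under [RHS]eq_bigr do rewrite scaler_sumr.
  rewrite [RHS]exchange_big_nat /=; apply: eq_big_nat => j /andP[_ jl].
  by rewrite [RHS](@big_cat_nat _ _ _ j.+1)//= addrC.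
have -> : \sum_(1 <= i < l.+1) (-1) ^+ i *:
    (\sum_(0 <= j < l.+2) (-1) ^+ l *: X i.+1 j -
     \sum_(1 <= a < l.+1) (-1) ^+ a *: pi_at p l (phi \o bump i.+1 \o bump a) y) =
    (-1) ^+ l *: (\sum_(1 <= i < l.+1) (-1) ^+ i *: S i.+1) -
    \sum_(1 <= i < l.+1) \sum_(1 <= a < l.+1) (-1) ^+ (i + a) *: Z i.+1 a.
  rewrite scaler_sumr -sumrB; apply: eq_bigr => i _; rewrite scalerBr; congr (_ - _).
    by rewrite scalerA mulrC -scalerA -scaler_sumr.
  by rewrite scaler_sumr; apply: eq_bigr => a _; rewrite scalerA -exprD.
rewrite (@alternating_shift _ l (fun i a => (-1) ^+ (i + a) *: Z i.+1 a)
  (fun i a => (-1) ^+ (i + a) *: Z i a)); last 2 first.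
- move=> i a ai; rewrite addnC; congr (_ *: _); apply: pi_at_ext => x _ /=.
  by rewrite bump_bump.
- by move=> i a ia; rewrite addSn exprS mulN1r scaleNr opprK.
rewrite [\sum_(1 <= i < l.+2) _]big_nat_recl// expr1 scaleN1r -scaler_sumr.
have -> : \sum_(1 <= i < l.+1) (-1) ^+ i.+1 *: S i.+1 =
    - \sum_(1 <= i < l.+1) (-1) ^+ i *: S i.+1.
  by rewrite -sumrN; apply: eq_bigr => i _; rewrite exprS mulN1r scaleNr.
rewrite -[- S 1%N - _]opprD scalerN opprK scalerDr opprB addrA addrAC addrK; congr (_ + _).
by rewrite -sumrN; apply: eq_bigr => i _; rewrite add1n exprS mulN1r scaleNr.
Qed.

End FirstTwoFaces.
End SimplicialIdentities.

(** * The differential squares to zero *)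

Section DeltaSquare.
Context {R : realType} {G : lieGroupoid R} {E : nat -> vbundle (obj G)}.
Variable rho : rep E.

Lemma face_face n (p : semidirect E n.+2) i j : (i < j <= n.+2)%N ->
  face rho i (face rho j p) = face rho j.-1 (face rho i p).
Proof.
move=> /andP[ij jn]; have le_in : (i <= n.+1)%N by lia.
have jn1 : (j.-1 <= n.+1)%N by lia.
apply: semidirect_eq => [|k f y H].
  rewrite !face_base//; last exact: leqW.
  rewrite !nact_nact => [|a an|a an]; try (by apply: leq_trans (bump_leS _ _) _).
  by apply: nact_ext => a _ /=; rewrite bump_bump.
have fk : (f k <= n)%N by case: H.
rewrite !pt_face// => [ey|]; last by apply: leq_trans (bump_leS _ _) _.
case: i ij le_in ey => [|i] ij le_in ey; last exact: pi_at_face_S_face_S.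
case: j ij jn {jn1} ey => [//|[|j]] ij jn ey; first by rewrite -pi_at_face00_face01.
exact: pi_at_face_0_face_S.
Qed.

Lemma delta_delta n (c : cochain E n) : delta rho (delta rho c) = fun=> 0.
Proof.
apply: funext => p; rewrite /delta.
pose F r s := (-1) ^+ r * ((-1) ^+ s * c (face rho s (face rho r p))).
rewrite -(big_mkord xpredT (fun r => (-1) ^+ r *
  \sum_(s < n.+2) (-1) ^+ s * c (face rho s (face rho r p)))).
rewrite -[RHS](@alternating_square _ n.+2 F).
  apply: eq_bigr => r _; rewrite -(big_mkord xpredT (fun s => (-1) ^+ s *
    c (face rho s (face rho r p)))) mulr_sumr.
  by apply: eq_bigr.
move=> r s /andP[sr rn]; rewrite /F face_face ?sr// mulrCA -{1}(prednK (leq_ltn_trans _ sr))//.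
by rewrite exprS mulN1r mulNr mulrN.
Qed.

End DeltaSquare.

(** * Linear cochains *)

Section LinearCochains.
Context {R : realType} {G : lieGroupoid R} {E : nat -> vbundle (obj G)}.

Lemma deg_le n (a : sindex n) : (deg a <= n)%N.
Proof.
by apply: leq_trans (isidx_ge (idx_valP a) (leqnn _)) _; case: (idx_valP a).
Qed.

(** Degree and values inject the indices into a finite type; the list makes the decomposition of a
    cochain a finite sum. *)
Lemma ex_enum_sindex n : exists2 s : seq (sindex n), uniq s & forall a, a \in s.
Proof.
pose code (a : sindex n) : 'I_n.+1 * {ffun 'I_n.+1 -> 'I_n.+1} :=
  (inord (deg a), [ffun i : 'I_n.+1 => a (inord i)]).
have code_inj : injective code.
  move=> a b [/(congr1 (@nat_of_ord _)) + /ffunP ab].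
  rewrite !inordK ?ltnS ?deg_le// => e; apply: sindex_eq => // i ia.
  have := ab (inord i); rewrite !ffunE inordK ?ltnS; last first.
    exact: leq_trans ia (deg_le a).
  by rewrite /idx_val => ->.
pose decode (x : 'I_n.+1 * {ffun 'I_n.+1 -> 'I_n.+1}) : option (sindex n) :=
  if pselect (exists a, code a = x) is left H then Some (projT1 (cid H)) else None.
have codeK : pcancel code decode.
  move=> a; rewrite /decode; case: pselect => [H|[]]; last by exists a.
  by congr Some; apply: code_inj; exact: projT2 (cid H).
exists (undup (pmap decode (enum {: 'I_n.+1 * {ffun 'I_n.+1 -> 'I_n.+1}}))).
  exact: undup_uniq.
move=> a; rewrite mem_undup mem_pmap; apply/mapP; exists (code a).
  by rewrite mem_enum.
by rewrite codeK.
Qed.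

Definition single n (g : chain G n) (a : sindex n) (w : sfib E g a) : semidirect E n :=
  existT _ g (dfwith (fun b => 0 : sfib E g b) a w).

Lemma pi_at_single_eq n (g : chain G n) (a : sindex n) w f y :
  (forall i, (i <= deg a)%N -> f i = idx_val a i) ->
  pi_at (@single n g a w) (deg a) f y = tr y (w : E (deg a) _).
Proof.
by move=> fa; rewrite (pi_at_ext _ _ fa) -projT2_pi_at /= dfwithin.
Qed.

Lemma pi_at_single_neq n (g : chain G n) (a : sindex n) w k f y :
  ~ (k = deg a /\ forall i, (i <= k)%N -> f i = idx_val a i) ->
  pi_at (@single n g a w) k f y = 0.
Proof.
move=> nfa; rewrite /pi_at; case: pselect => // H.
rewrite (_ : spi _ _ = 0) ?linear0//.
apply: etrans (spi_imap (single w) (mkidx H)) _; rewrite /= dfwithout//.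
apply/eqP => e; apply: nfa; rewrite e; split=> // i ik.
by rewrite /idx_val mkordE.
Qed.

Lemma fib_lin0 n (c : cochain E n) g : fiberwise_linear c ->
  c (existT _ g (fun a => 0 : sfib E g a)) = 0.
Proof.
move=> Lc; have := Lc g (-1) (fun a => 0) (fun a => 0).
rewrite mulN1r addNr => <-; congr (c (existT _ g _)).
by apply: functional_extensionality_dep => a; rewrite scaler0 addr0.
Qed.

Lemma cochain_expand n (c : cochain E n) g (v : forall a, sfib E g a) s :
  fiberwise_linear c -> uniq s -> (forall a, a \in s) ->
  c (existT _ g v) = \sum_(a <- s) component c (v a).
Proof.
move=> Lc us ins.
have -> : v = (fun a => if a \in s then v a else 0).
  by apply: functional_extensionality_dep => a; rewrite ins.
(* Components of [v] are switched on one index at a time. *)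
suff H : forall s', uniq s' ->
    c (existT _ g (fun a => if a \in s' then v a else 0)) =
    \sum_(a <- s') component c (v a).
  by rewrite H//; apply: eq_bigr => a _; rewrite ins.
elim=> [_|a s' IH /= /andP[nas us']]; first by rewrite big_nil fib_lin0.
rewrite big_cons -IH// -[component c _]mul1r -Lc; congr (c (existT _ g _)).
apply: functional_extensionality_dep => b; rewrite in_cons scale1r.
case: eqVneq => [->|nba] /=; first by rewrite dfwithin (negbTE nas) addr0.
by rewrite dfwithout 1?eq_sym// add0r.
Qed.

Lemma component_linear n (c : cochain E n) (a : sindex n) : fiberwise_linear c ->
  fib_linear (X := nerve G n) (E := E (deg a)) (f := fun g => vtx g (a ord_max))
    (@component R G E n c a).
Proof.
move=> Lc g r v w; rewrite /component -Lc; congr (c (existT _ g _)).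
apply: functional_extensionality_dep => b.
have [<-|nab] := eqVneq a b; first by rewrite !dfwithin.
by rewrite !dfwithout// scaler0 addr0.
Qed.

Definition smooth_component n (c : cochain E n) (a : sindex n) :=
  @dual_section R _ (nerve G n) (E (deg a)) (fun g => vtx g (a ord_max))
    (@component R G E n c a).

Lemma C_linP n (c : cochain E n) :
  C_lin E n c <-> fiberwise_linear c /\ forall a, smooth_component c a.
Proof.
split=> -[Lc Sc]; split=> // a; last exact: (Sc a).2.
by split; [exact: component_linear|exact: Sc].
Qed.

Lemma C_lin0 n : C_lin E n (fun=> 0).
Proof.
apply/C_linP; split=> [g r v w|a]; first by rewrite mulr0 addr0.
exact: (@dual_section0 _ _ (nerve G n) _ _ (smooth_vtx _)).
Qed.

Lemma C_lin_comb n (r : R) (c c' : cochain E n) :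
  C_lin E n c -> C_lin E n c' -> C_lin E n (fun p => r * c p + c' p).
Proof.
move=> /C_linP[Lc Sc] /C_linP[Lc' Sc']; apply/C_linP; split=> [g s v w|a].
  by rewrite Lc Lc' !mulrDr !mulrA (mulrC r s) addrACA.
apply: (@dual_sectionD _ _ (nerve G n)); first exact: smooth_vtx.
  by apply: dual_sectionZ; exact: Sc.
exact: Sc'.
Qed.

Lemma spi_linear n (g : chain G n) r (v w : forall a, sfib E g a) k (th : ordmap k n) :
  spi (existT _ g (fun a => r *: v a + w a) : semidirect E n) th =
  r *: spi (existT _ g v : semidirect E n) th + spi (existT _ g w : semidirect E n) th.
Proof. by rewrite /spi; case: pselect => // _; rewrite scaler0 addr0. Qed.

Variable rho : rep E.

Lemma face_linear n i (g : chain G n.+1) r (v w : forall a, sfib E g a) :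
  face rho i (existT _ g (fun a => r *: v a + w a) : semidirect E n.+1) =
  existT _ (act g (odelta n n.+1 i)) (fun b =>
    r *: projT2 (face rho i (existT _ g v : semidirect E n.+1)) b +
    projT2 (face rho i (existT _ g w : semidirect E n.+1)) b).
Proof.
congr existT; apply: functional_extensionality_dep => b /=.
case: i => [|i]; last exact: (spi_linear r v w (ocomp (odelta n n.+1 i.+1) b)).
rewrite scalerBr addrACA -opprD !scaler_sumr -!big_split /=; congr (_ - _);
  by apply: eq_bigr => k _; rewrite spi_linear !linearP.
Qed.

Lemma delta_fiberwise_linear n (c : cochain E n) :
  fiberwise_linear c -> fiberwise_linear (delta rho c).
Proof.
move=> Lc g r v w; rewrite /delta mulr_sumr -big_split /=.
apply: eq_bigr => i _; by rewrite face_linear Lc mulrDr mulrCA.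
Qed.

Lemma smooth_act n p (th : ordmap p n) (i : fidx (nerve G p)) :
  @smooth_map R (nerve G n) (fac i) (fun g => emb (act g th : nerve G p) i).
Proof.
have -> : (fun g : nerve G n => emb (act g th : nerve G p) i) =
    (fun g => emb (nact g p (fun i => th (inord i)) : nerve G p) i).
  by apply: funext => g; rewrite act_nact.
exact: smooth_nact.
Qed.

Lemma hom_section_ruth_at n m f k l (x y : nerve G n -> obj G) :
  (forall g, x g = pt g (f 0%N)) -> (forall g, y g = pt g (f m)) ->
  @hom_section _ _ (nerve G n) (E k) (E l) x y (fun g v => ruth_at rho g m f l (y g) v).
Proof.
move=> ex ey.
have S0 : @hom_section _ _ (nerve G m) (E k) (E l) _ _ (fun g => rho m g k l).
  by split; [move=> g; exact: linearP|exact: ruth_smooth].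
have S1 := hom_section_pullback (@smooth_nact _ _ n m f) S0.
have := @hom_section_tr _ _ (nerve G n) _ _ _ _ x y _ _ _ S1; apply=> g.
  by rewrite ex.
by rewrite ey.
Qed.

(** On vectors concentrated at [a], the projection to [f] is either a transport or 0. *)
Lemma dual_section_pi_at_single n (a : sindex n) k f (x : nerve G n -> obj G)
    (L : forall g : nerve G n, E k (x g) -> R) :
  smooth_map x -> (forall g, x g = pt g (f k)) -> dual_section L ->
  @dual_section _ _ (nerve G n) (E (deg a)) (fun g => vtx g (a ord_max))
    (fun g w => L g (pi_at (@single n g a w) k f (x g))).
Proof.
move=> Sx ex SL.
have [[ek fa]|nfa] := pselect (k = deg a /\ forall i, (i <= k)%N -> f i = idx_val a i).
  subst k.
  have -> : (fun (g : nerve G n) w => L g (pi_at (@single n g a w) (deg a) f (x g))) =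
      (fun g w => L g (tr (x g) (w : E (deg a) (vtx g (a ord_max))))).
    apply: functional_extensionality_dep => g; apply: funext => w.
    by rewrite pi_at_single_eq.
  apply: (@dual_section_tr _ _ (nerve G n)) => // g.
  by rewrite ex fa// idx_val_max /pt inord_val.
have -> : (fun (g : nerve G n) w => L g (pi_at (@single n g a w) k f (x g))) =
    (fun g => fun=> 0).
  apply: functional_extensionality_dep => g; apply: funext => w.
  rewrite pi_at_single_neq//; have := SL.1 g (-1) 0 0.
  by rewrite scaler0 addr0 mulN1r addNr.
by apply: (@dual_section0 _ _ (nerve G n)); exact: smooth_vtx.
Qed.

(** Each component of delta c is a finite sum of components of c pulled back along a face of the
    nerve and, for d_0, possibly composed with some R_m on a subchain. *)
Lemma C_lin_delta n (c : cochain E n) : C_lin E n c -> C_lin E n.+1 (delta rho c).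
Proof.
move=> /C_linP[Lc Sc]; apply/C_linP; split=> [|a]; first exact: delta_fiberwise_linear.
have [sI us ins] := ex_enum_sindex n.
have E1 : (@component R G E n.+1 (delta rho c) a) = (fun (g : nerve G n.+1) w =>
    \sum_(r <- index_enum 'I_n.+2) \sum_(b <- sI) (-1) ^+ r *
      component c (projT2 (face rho r (@single n.+1 g a w)) b)).
  apply: functional_extensionality_dep => g; apply: funext => w.
  apply: eq_bigr => r _; rewrite -mulr_sumr; congr (_ * _).
  exact: (@cochain_expand n c (act g (odelta n n.+1 r))
    (projT2 (face rho r (@single n.+1 g a w)))).
rewrite /smooth_component E1.
apply: (@dual_section_sum _ _ (nerve G n.+1)) => [|r _]; first exact: smooth_vtx.
apply: (@dual_section_sum _ _ (nerve G n.+1)) => [|b _]; first exact: smooth_vtx.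
apply: (@dual_sectionZ _ _ (nerve G n.+1)).
pose y (g : nerve G n.+1) := vtx (act g (odelta n n.+1 r)) (b ord_max).
pose S (g : nerve G n.+1) (v : E (deg b) (y g)) :=
  @component R G E n c b (act g (odelta n n.+1 r)) v.
have SS : dual_section S by exact: (dual_section_pullback (smooth_act (odelta n n.+1 r)) (Sc b)).
have Sy : smooth_map y by exact: smooth_vtx.
have rn : (r <= n.+1)%N by rewrite -ltnS.
have ey g : y g = pt g (bump r (idx_val b (deg b))).
  rewrite -(pt_face rho (existT _ g (fun=> 0)))//; last by case: (idx_valP b).
  by rewrite idx_val_max /pt inord_val.
have -> : (fun (g : nerve G n.+1) w =>
    component c (projT2 (face rho r (@single n.+1 g a w)) b)) =
    (fun g w => S g (pi_at (face rho r (@single n.+1 g a w)) (deg b) (idx_val b) (y g))).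
  apply: functional_extensionality_dep => g; apply: funext => w.
  by rewrite -projT2_pi_at tr_id.
(* A positive face merely selects a component; d_0 needs its full formula. *)
have [r0|r0] := posnP r; last first.
  have -> : (fun (g : nerve G n.+1) w =>
      S g (pi_at (face rho r (@single n.+1 g a w)) (deg b) (idx_val b) (y g))) =
      (fun g w => S g (pi_at (@single n.+1 g a w) (deg b) (bump r \o idx_val b) (y g))).
    apply: functional_extensionality_dep => g; apply: funext => w.
    by rewrite pi_at_face_S//; exact: idx_valP.
  exact: dual_section_pi_at_single.
set l := deg b; set phi := hat (idx_val b).
have ey0 g : y g = pt g (phi l.+1) by rewrite ey r0.
have -> : (fun (g : nerve G n.+1) w =>
    S g (pi_at (face rho r (@single n.+1 g a w)) l (idx_val b) (y g))) =
    (fun g w => \sum_(k <- index_iota 0 l.+2) (-1) ^+ l *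
       S g (ruth_at rho g (l.+1 - k) (fun i => phi (k + i)%N) l (y g)
         (pi_at (@single n.+1 g a w) k phi (pt g (phi k)))) +
     \sum_(j <- index_iota 1 l.+1) - (-1) ^+ j *
       S g (pi_at (@single n.+1 g a w) l (phi \o bump j) (y g))).
  apply: functional_extensionality_dep => g; apply: funext => w.
  rewrite r0 pi_at_face_0; [|exact: idx_valP|exact: ey0].
  rewrite addrC -scaleN1r SS.1 mulN1r.
  rewrite (fib_linear_sum _ _ _ SS.1) (fib_linear_sum _ _ _ SS.1) -sumrN addrC.
  by congr (_ + _); apply: eq_bigr => j _; rewrite mulNr.
apply: (@dual_sectionD _ _ (nerve G n.+1)); first exact: smooth_vtx.
  apply: (@dual_section_sum _ _ (nerve G n.+1)) => [|k]; first exact: smooth_vtx.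
  rewrite mem_index_iota => /andP[_ kl]; apply: (@dual_sectionZ _ _ (nerve G n.+1)).
  apply: (@dual_section_pi_at_single _ a k phi (fun g => pt g (phi k)) (fun g v =>
    S g (ruth_at rho g (l.+1 - k) (fun i => phi (k + i)%N) l (y g) v))) => //.
    exact: smooth_vtx.
  apply: (@dual_section_comp _ _ (nerve G n.+1) _ _ (fun g => pt g (phi k)) y
    (fun g v => ruth_at rho g (l.+1 - k) (fun i => phi (k + i)%N) l (y g) v) S) => //.
  by apply: hom_section_ruth_at => g; rewrite ?addn0// subnKC// ey0.
apply: (@dual_section_sum _ _ (nerve G n.+1)) => [|j]; first exact: smooth_vtx.
rewrite mem_index_iota => /andP[j1 jl]; apply: (@dual_sectionZ _ _ (nerve G n.+1)).
apply: dual_section_pi_at_single => // g; rewrite ey0 /comp.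
by have -> : bump j l = l.+1 by rewrite /bump; lia.
Qed.

End LinearCochains.

(** * Components of cochains at indices given as functions on nat *)

Section RawComponents.
Context {R : realType} {G : lieGroupoid R} {E : nat -> vbundle (obj G)}.

Definition single_at n (g : chain G n) k f (H : isidx n k f) y (w : E k y) : semidirect E n :=
  @single R G E n g (mkidx H) (tr _ w).

Lemma pi_at_sgl_eq n (g : chain G n) k f (H : isidx n k f) y (w : E k y) f' y' :
  y = pt g (f k) -> (forall i, (i <= k)%N -> f' i = f i) ->
  pi_at (single_at g H w) k f' y' = tr y' w.
Proof.
move=> ey ff; apply: etrans (@pi_at_single_eq _ _ _ n g (mkidx H) (tr _ w) f' y' _) _.
  by move=> i ik; rewrite ff// /idx_val mkordE.
by apply: tr_comp; left; rewrite ey.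
Qed.

Lemma pi_at_sgl_neq n (g : chain G n) k f (H : isidx n k f) y (w : E k y) k' f' y' :
  ~ (k' = k /\ forall i, (i <= k)%N -> f' i = f i) ->
  pi_at (single_at g H w) k' f' y' = 0.
Proof.
move=> nff; apply: pi_at_single_neq => -[/= ek ff]; apply: nff; split=> // i ik.
by rewrite ff ?ek// /idx_val mkordE.
Qed.

(** The c_f(g)(w) of the decomposition of a linear cochain. *)
Definition coef n (c : cochain E n) k f (g : chain G n) y (w : E k y) : R :=
  if pselect (isidx n k f) is left H then c (single_at g H w) else 0.

Lemma coefE n (c : cochain E n) k f (g : chain G n) y (w : E k y) (H : isidx n k f) :
  coef c f g w = c (single_at g H w).
Proof.
rewrite /coef; case: pselect => // H'; by rewrite (Prop_irrelevance H' H).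
Qed.

Lemma coef_ext n (c : cochain E n) k f f' (g : chain G n) y (w : E k y) :
  (forall i, (i <= k)%N -> f i = f' i) -> coef c f g w = coef c f' g w.
Proof.
move=> ff; rewrite /coef; case: pselect => H; case: pselect => H' //.
- have e : mkord H = mkord H' by apply: ordmap_eq => i ik; rewrite !mkordE// ff.
  rewrite /single_at /mkidx; move: (mkord_index H) (mkord_index H'); rewrite -e => Ha Hb.
  by rewrite (Prop_irrelevance Ha Hb).
- by case: H'; apply: isidx_ext H.
- by case: H; apply: isidx_ext H' => i ik; rewrite ff.
Qed.

Lemma component_coef n (c : cochain E n) (a : sindex n) g (w : sfib E g a) :
  component c w = coef c (idx_val a) g (w : E (deg a) _).
Proof.
rewrite (coefE _ _ _ (idx_valP a)) /component; congr c.
apply: semidirect_eq => // k f y H ey.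
have [[ek ff]|nff] := pselect (k = deg a /\ forall i, (i <= deg a)%N -> f i = idx_val a i).
  subst k; rewrite pi_at_sgl_eq//; last by rewrite idx_val_max /pt inord_val.
  exact: pi_at_single_eq.
rewrite pi_at_sgl_neq//; apply: pi_at_single_neq => -[ek ff]; apply: nff; split=> // i ik.
by apply: ff; rewrite ek.
Qed.

End RawComponents.

(** * Regular cochains *)

Section RegularIndices.
Local Open Scope nat_scope.

Definition mreg m k (f : nat -> nat) := forall i, i <= k -> i <= m -> f i = i.

Lemma is_mregularP m n (a : sindex n) : is_mregular m a <-> mreg m (deg a) (idx_val a).
Proof.
split=> [H i ia im|H i im].
  by have := H (inord i); rewrite inordK ?ltnS// leq_min ia im => /(_ isT).
move: im; rewrite leq_min => /andP[ia im].
by rewrite -(H _ ia im) /idx_val inord_val.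
Qed.

Lemma mreg_ext m k f f' : (forall i, i <= k -> f i = f' i) -> mreg m k f -> mreg m k f'.
Proof. by move=> ff H i ik im; rewrite -ff// H. Qed.

Lemma not_mreg m k f : ~ mreg m k f ->
  exists2 j, j <= k /\ j <= m & f j <> j /\ forall i, i < j -> f i = i.
Proof.
move=> nH; pose P j := [&& j <= k, j <= m & f j != j].
have exP : exists j, P j.
  apply: contra_notP nH => nP i ik im; apply/eqP/negPn/negP => fi.
  by apply: nP; exists i; rewrite /P ik im fi.
case: (ex_minnP exP) => j /and3P[jk jm /eqP fj] jmin.
exists j => //; split=> // i ij; apply/eqP/negPn/negP => fi.
by have := jmin i; rewrite /P fi (leq_trans (ltnW ij) jk) (leq_trans (ltnW ij) jm)
  leqNgt ij => /(_ isT).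
Qed.

Lemma isidx_unbump n k f r : 0 < r <= n.+1 -> isidx n.+1 k f ->
  (forall i, i <= k -> f i <> r) ->
  isidx n k (unbump r \o f) /\ forall i, i <= k -> bump r (unbump r (f i)) = f i.
Proof.
move=> /andP[r0 rn] H fr; have [f0 fmon fk] := H.
have K i : i <= k -> bump r (unbump r (f i)) = f i.
  by move=> ik; have := fr i ik; rewrite /bump /unbump; lia.
split=> //; split=> /=.
- by rewrite f0 /unbump; lia.
- move=> i j /andP[ij jk]; have ik := leq_trans (ltnW ij) jk.
  by rewrite -ltnS -[_.+1]add0n; have := fmon i j; rewrite ij jk => /(_ isT);
     have := fr i ik; have := fr j jk; rewrite /unbump; lia.
- by have := fr k (leqnn k); rewrite /unbump; lia.
Qed.

(* At the first vertex j skipped by a non-regular index, the index factors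
   through the coface delta_j. *)
Lemma not_mreg_coface m n k phi : isidx n.+1 k phi -> ~ mreg m k phi ->
  exists j f, [/\ 0 < j <= m, j <= k, isidx n k f,
    forall i, i < j -> f i = i & forall i, i <= k -> phi i = bump j (f i)].
Proof.
move=> H /not_mreg[j [jk jm] [phij phii]].
have j0 : 0 < j by case: j phij {jk jm phii} => // [[]]; case: H.
have phij' : j < phi j by have := isidx_ge H jk; lia.
have [|i ik e|Hf K] := @isidx_unbump n k phi j _ H.
- by rewrite j0 /=; have := isidx_le H jk; lia.
- case: (ltnP i j) => ij; first by move: e; rewrite phii//; lia.
  by have := @isidx_mono _ _ _ j i H; rewrite ij ik => /(_ isT); lia.
exists j, (unbump j \o phi); split=> //; first by rewrite j0.
  by move=> i ij /=; rewrite phii// /unbump; lia.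
by move=> i ik /=; rewrite K.
Qed.

End RegularIndices.

(** * The positive faces in the components of delta c *)

Section DeltaComponents.
Context {R : realType} {G : lieGroupoid R} {E : nat -> vbundle (obj G)}.

Lemma component0 n (c : cochain E n) (a : sindex n) g : fiberwise_linear c ->
  @component R G E n c a g 0 = 0.
Proof.
move=> Lc; rewrite -[RHS](fib_lin0 g Lc); congr (c (existT _ g _)).
apply: functional_extensionality_dep => b; have [<-|ab] := eqVneq a b.
  by rewrite dfwithin.
by rewrite dfwithout.
Qed.

Lemma coefP n (c : cochain E n) k f (g : chain G n) y r (v w : E k y) :
  fiberwise_linear c -> coef c f g (r *: v + w) = r * coef c f g v + coef c f g w.
Proof.
move=> Lc; rewrite /coef; case: pselect => [H|_]; last by rewrite mulr0 addr0.
rewrite /single_at linearP.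
exact: (@component_linear R G E n c (mkidx H) Lc g r (tr _ v) (tr _ w)).
Qed.

Lemma coefZ n (c : cochain E n) k f (g : chain G n) y r (v : E k y) :
  fiberwise_linear c -> coef c f g (r *: v) = r * coef c f g v.
Proof.
move=> Lc; have := coefP f g r v 0 Lc; rewrite addr0 => ->.
have -> : coef c f g (0 : E k y) = 0; last by rewrite addr0.
have := coefP f g (-1) (0 : E k y) 0 Lc.
by rewrite scaler0 addr0 mulN1r addNr.
Qed.

Definition mregular m n (c : cochain E n) := forall k f (g : chain G n) y (w : E k y),
  ~ mreg m k f -> coef c f g w = 0.

Lemma mregularP m n (c : cochain E n) :
  supported (is_mregular m (n := n)) c <-> mregular m c.
Proof.
split=> H.
  move=> k f g y w nf; rewrite /coef; case: pselect => // Hf.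
  apply: contrapT => nz; apply: nf.
  have /is_mregularP : is_mregular m (mkidx Hf).
    by apply: H; exists g, (tr _ w).
  by apply: mreg_ext => i ik; rewrite /idx_val mkordE.
move=> a [g [w nz]]; apply/is_mregularP; apply: contrapT => na.
by apply: nz; rewrite component_coef H.
Qed.

Lemma mregularW m m' n (c : cochain E n) : (m <= m')%N -> mregular m' c -> mregular m c.
Proof.
move=> mm H k f g y w nf; apply: H => f'; apply: nf => i ik im.
by apply: f' => //; exact: leq_trans mm.
Qed.

(* A cochain supported on m-regular indices only sees the m-regular components
   of its argument. *)
Lemma cochain_single m n (c : cochain E n) (p : semidirect E n) k f y (w : E k y)
    (H : isidx n k f) :
  fiberwise_linear c -> mregular m c -> y = pt (projT1 p) (f k) ->
  pi_at p k f y = w ->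
  (forall k' f' y', isidx n k' f' -> mreg m k' f' ->
    ~ (k' = k /\ forall i, (i <= k)%N -> f' i = f i) -> pi_at p k' f' y' = 0) ->
  c p = coef c f (projT1 p) w.
Proof.
case: p => g v /= Lc Rc ey Vw V0.
have [s us ins] := ex_enum_sindex n.
rewrite (cochain_expand _ Lc us ins) (bigD1_seq (mkidx H))//= big1 ?addr0.
  rewrite component_coef; apply: (@etrans _ _ (coef c f g (v (mkidx H) : E k _))).
    by apply: coef_ext => i ik; rewrite /idx_val mkordE.
  have -> : w = tr y (v (mkidx H) : E k _) by rewrite -Vw (pi_at_mkidx _ H).
  have ev : y = vtx g (mkord H ord_max) by rewrite ey.
  by rewrite ev tr_id.
move=> b nb; have [Rb|nRb] := pselect (mreg m (deg b) (idx_val b)); last first.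
  by rewrite component_coef Rc.
rewrite (_ : v b = 0) ?component0//.
rewrite -[LHS]tr_id (@projT2_pi_at _ _ _ n (existT _ g v) b) V0//; first exact: idx_valP.
move=> [eb fb]; move/eqP: nb; apply; apply: sindex_eq => //= i ib.
have ik : (i <= k)%N by rewrite -eb.
by rewrite fb// /idx_val mkordE.
Qed.

Lemma cochain_zero m n (c : cochain E n) (p : semidirect E n) :
  fiberwise_linear c -> mregular m c ->
  (forall k' f' y', isidx n k' f' -> mreg m k' f' -> pi_at p k' f' y' = 0) ->
  c p = 0.
Proof.
case: p => g v /= Lc Rc V0.
have [s us ins] := ex_enum_sindex n.
rewrite (cochain_expand _ Lc us ins) big1// => b _.
have [Rb|nRb] := pselect (mreg m (deg b) (idx_val b)); last by rewrite component_coef Rc.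
rewrite (_ : v b = 0) ?component0//.
by rewrite -[LHS]tr_id (@projT2_pi_at _ _ _ n (existT _ g v) b) V0//; exact: idx_valP.
Qed.

(** Indices start at 0; hence the lemmas on regular cochains apply, at m = 0, to every cochain. *)
Lemma mregular0 n (c : cochain E n) : mregular 0 c.
Proof.
move=> k f g y w nf; rewrite /coef; case: pselect => // H; case: nf => i ik.
by rewrite leqn0 => /eqP ->; case: H.
Qed.

Variable rho : rep E.

(** Since π_β d_r = π_{δ_r β} and δ_r is injective, the r-th face of a vector concentrated at δ_r f
    is concentrated at f. *)
Lemma term_pos_in n (c : cochain E n) r k f phi (g : chain G n.+1) y (w : E k y)
    (H : isidx n.+1 k phi) :
  fiberwise_linear c -> (0 < r <= n.+1)%N -> isidx n k f ->
  (forall i, (i <= k)%N -> phi i = bump r (f i)) -> y = pt g (phi k) ->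
  c (face rho r (single_at g H w)) = coef c f (nact g n (bump r)) w.
Proof.
move=> Lc /andP[r0 rn] Hf phif ey; rewrite -(face_base rho (single_at g H w))//.
apply: (@cochain_single 0) => //; first exact: mregular0.
- by rewrite pt_face//; [rewrite -phif|case: Hf].
- rewrite pi_at_face_S// pi_at_sgl_eq// ?tr_id// => i ik.
  by rewrite phif.
- move=> k' f' y' Hf' _ nf'; rewrite pi_at_face_S//; apply: pi_at_sgl_neq => -[ek ff].
  apply: nf'; split=> // i ik; have := ff i ik; rewrite phif//=.
  exact: (can_inj (bumpK r)).
Qed.

(** No δ_r β takes the value r, so every component of this face is 0. *)
Lemma term_pos_out n (c : cochain E n) r k phi (g : chain G n.+1) y (w : E k y)
    (H : isidx n.+1 k phi) i :
  fiberwise_linear c -> (0 < r)%N -> (i <= k)%N -> phi i = r ->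
  c (face rho r (single_at g H w)) = 0.
Proof.
move=> Lc r0 ik phir; apply: (@cochain_zero 0) => //; first exact: mregular0.
move=> k' f' y' Hf' _; rewrite pi_at_face_S//; apply: pi_at_sgl_neq => -[ek ff].
have := ff i ik; rewrite phir /= => /eqP.
by rewrite eq_sym (negbTE (neq_bump r (f' i))).
Qed.

End DeltaComponents.

(** * The face d_0 in the components of delta c *)

Section TermZero.
Context {R : realType} {G : lieGroupoid R} {E : nat -> vbundle (obj G)}.

Lemma pi_at_pt n (p : semidirect E n) k f y :
  pi_at p k f y = tr y (pi_at p k f (pt (projT1 p) (f k))).
Proof.
rewrite /pi_at; case: pselect => [H|_]; last by rewrite linear0.
by rewrite tr_comp//; left.
Qed.

Variables (rho : rep E) (m n : nat) (c : cochain E n) (j k : nat) (f phi : nat -> nat).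
Variables (g : chain G n.+1) (y : obj G) (w : E k y).
Hypotheses (Lc : fiberwise_linear c) (Rc : mregular m c) (jm : (0 < j <= m.+1)%N).
Hypotheses (jk : (j <= k)%N) (Hf : isidx n k f) (fj : forall i, (i < j)%N -> f i = i).
Hypotheses (phif : forall i, (i <= k)%N -> phi i = bump j (f i)).
Hypotheses (H : isidx n.+1 k phi) (ey : y = pt g (phi k)).

Let p := single_at g H w.

Let fge i : (i <= k)%N -> (i <= f i)%N.
Proof. exact: isidx_ge Hf. Qed.

Let phi_ge i : (j <= i <= k)%N -> phi i = (f i).+1.
Proof. by move=> /andP[ji ik]; rewrite phif// /bump; have := fge ik; lia. Qed.

(** Kills the R-terms: [hat f'] fixes j ≤ m+1, whereas [phi] moves it. *)
Let pi_at_initial k' f' q y' : mreg m k' f' -> (q <= k'.+1)%N -> pi_at p q (hat f') y' = 0.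
Proof.
move=> mf qk; apply: pi_at_sgl_neq => -[eq ff].
have := ff j jk; rewrite phi_ge ?leqnn//; have := fge jk.
have -> : hat f' j = j.
  case: j jm jk => // j' /andP[_ jm'] jk' /=; rewrite mf//.
  by rewrite -ltnS (leq_trans jk')// -eq.
lia.
Qed.

(** For i < j the composite skips i too early to be [phi], for i > j it fails to skip j; at i = j it
    determines f'. *)
Let pi_at_inner k' f' i y' : mreg m k' f' -> (0 < i <= k')%N ->
  ~ (i = j /\ k' = k /\ forall a, (a <= k)%N -> f' a = f a) ->
  pi_at p k' (hat f' \o bump i) y' = 0.
Proof.
move=> mf /andP[i0 ik'] nij; apply: pi_at_sgl_neq => -[ek ff]; subst k'.
have hat_reg a : (0 < a <= m.+1)%N -> (a <= k.+1)%N -> hat f' a = a.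
  by case: a => // a am ak /=; rewrite mf.
case: (ltngtP i j) => ij.
- have ik : (i <= k)%N by lia.
  have := ff i ik; rewrite /= {1}/bump leqnn add1n hat_reg; [|lia|lia].
  by rewrite phif// fj// /bump; lia.
- have := ff j jk; rewrite /= (_ : bump i j = j); last by rewrite /bump; lia.
  by rewrite hat_reg ?phi_ge//; [have := fge jk; lia|lia|lia].
- subst i; apply: nij; split=> //; split=> // a ak; case: (ltnP a j) => aj.
    by rewrite fj// mf//; lia.
  have := ff a ak; rewrite phi_ge ?aj//= (_ : bump j a = a.+1); last by rewrite /bump; lia.
  by case.
Qed.

Let pi_at_other k' f' y' : isidx n k' f' -> mreg m k' f' ->
  ~ (k' = k /\ forall i, (i <= k)%N -> f' i = f i) -> pi_at (face rho 0 p) k' f' y' = 0.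
Proof.
move=> Hf' mf' nf'; rewrite pi_at_pt (_ : pi_at _ _ _ _ = 0) ?linear0//.
have fk' : (f' k' <= n)%N by case: Hf'.
rewrite pi_at_face_0//; last by rewrite pt_face.
rewrite big_nat big1 ?sub0r; last first.
  by move=> q /andP[_ qk]; rewrite (pi_at_initial _ mf') ?linear0 ?scaler0.
rewrite big_nat big1 ?oppr0// => i /andP[i1 ik].
rewrite (pi_at_inner _ mf') ?scaler0 ?i1//; move=> [_]; exact: nf'.
Qed.

(** Up to components invisible to [c], the face is -(-1)^j w, concentrated at f. The case j = m+1 is
    covered because β' is regular one step further than β. *)
Lemma term_zero : c (face rho 0 p) = - (-1) ^+ j * coef c f (nact g n (bump 0)) w.
Proof.
rewrite -coefZ// -(face_base rho p)//.
have fk : (f k <= n)%N by case: Hf.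
have pk : phi k = (f k).+1 by rewrite phi_ge// jk leqnn.
(* If [f] is not m-regular, no component visible to [c] is left. *)
have [Rf|nRf] := pselect (mreg m k f); last first.
  rewrite Rc//; apply: (cochain_zero Lc Rc) => k' f' y' Hf' mf'.
  by apply: pi_at_other => // -[ek ff]; apply: nRf; subst k'; apply: mreg_ext mf'.
apply: (cochain_single Hf Lc Rc).
- by rewrite pt_face// -[bump 0 _]/((f k).+1) -pk.
- rewrite pi_at_face_0//; last by rewrite -pk.
  rewrite big_nat big1 ?sub0r; last first.
    by move=> q /andP[_ qk]; rewrite (pi_at_initial _ Rf) ?linear0 ?scaler0.
  rewrite (bigD1_seq j) ?iota_uniq//=; last by rewrite mem_index_iota; lia.
  rewrite big_seq_cond big1 ?addr0; last first.
    move=> i /andP[]; rewrite mem_index_iota => /andP[i1 ik] ij.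
    by rewrite (pi_at_inner _ Rf) ?scaler0// ?i1//; move=> [e _]; rewrite e eqxx in ij.
  rewrite scaleNr; congr (- (_ *: _)).
  rewrite pi_at_sgl_eq// ?tr_id// => i ik /=; case: (ltnP i j) => ij.
    rewrite phif// fj// (_ : bump j i = i); last by rewrite /bump; lia.
    by case: i ik ij => // i ik ij /=; rewrite fj//; lia.
  by rewrite phi_ge ?ij// (_ : bump j i = i.+1)// /bump; lia.
- by move=> k' f' y' Hf' mf' nf'; exact: pi_at_other.
Qed.

End TermZero.

(** * Projectability as invariance under faces *)

Section DeltaRegular.
Context {R : realType} {G : lieGroupoid R} {E : nat -> vbundle (obj G)}.
Variable rho : rep E.

Section Coface.
Variables (m n : nat) (c : cochain E n) (j k : nat) (f phi : nat -> nat).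
Variables (g : chain G n.+1) (y : obj G) (w : E k y).
Hypotheses (Lc : fiberwise_linear c) (Rc : mregular m c).
Hypotheses (jk : (j <= k)%N) (Hf : isidx n k f) (fj : forall i, (i < j)%N -> f i = i).
Hypotheses (phif : forall i, (i <= k)%N -> phi i = bump j (f i)).
Hypotheses (ey : y = pt g (phi k)).

Let H : (0 < j)%N -> isidx n.+1 k phi.
Proof.
by move=> j0; apply: isidx_ext (isidx_bump j0 Hf) => i ik; rewrite phif.
Qed.

(** Only r = 0 and r = j contribute. Any other r is a value of [phi], or else [phi] factors through
    δ_r and the factor still moves j, so that [c] vanishes on it. *)
Lemma delta_coface : (0 < j <= m)%N ->
  coef (delta rho c) phi g w =
  (-1) ^+ j * (coef c f (nact g n (bump j)) w - coef c f (nact g n (bump 0)) w).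
Proof.
move=> /andP[j0 jm]; have kn : (k <= n)%N.
  exact: leq_trans (isidx_ge Hf (leqnn k)) (isidx_le Hf (leqnn k)).
rewrite (coefE _ _ _ (H j0)) /delta.
pose F r := (-1) ^+ r * c (face rho r (single_at g (H j0) w)).
rewrite -(big_mkord xpredT F) big_nat_recl//.
rewrite [X in _ + X](bigD1_seq j.-1) ?iota_uniq//=; last first.
  by rewrite mem_index_iota; lia.
rewrite prednK// big_seq_cond big1 ?addr0.
  rewrite /F expr0 mul1r (term_zero rho w Lc Rc _ jk Hf fj phif (H j0) ey); last by lia.
  rewrite (term_pos_in rho w (H j0) Lc _ Hf phif ey); last by lia.
  by rewrite mulrBr addrC mulNr.
move=> r /andP[]; rewrite mem_index_iota => /andP[_ rn] rj; rewrite /F.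
have [[i ik phir]|nphi] := pselect (exists2 i, (i <= k)%N & phi i = r.+1).
  by rewrite (term_pos_out rho g w (H j0) Lc (ltn0Sn r) ik phir) mulr0.
have phir i : (i <= k)%N -> phi i <> r.+1 by move=> ik e; apply: nphi; exists i.
have [|Hf' K] := isidx_unbump _ (H j0) phir; first by rewrite /=; lia.
rewrite (term_pos_in rho w (H j0) Lc _ Hf' _ ey); [|lia|by move=> i ik /=; rewrite K].
rewrite Rc ?mulr0// => /(_ j jk jm) /=.
have phij : (j < phi j)%N by rewrite phif// /bump; have := isidx_ge Hf jk; lia.
have phi_small i : (i < j)%N -> phi i = i.
  by move=> ij; rewrite phif ?fj// /bump; lia.
have : (j <= r)%N.
  rewrite leqNgt; apply/negP => rj'; apply: (phir r.+1); first by lia.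
  by apply: phi_small; lia.
by have := phir j jk; rewrite /unbump; lia.
Qed.

(** The faces 1 to m vanish because [phi] takes these values. Later ones need not vanish and are
    kept, to be matched face by face in [htpy_homotopy]. *)
Lemma delta_coface_next : j = m.+1 ->
  exists H' : isidx n.+1 k phi,
  coef (delta rho c) phi g w =
  \sum_(m.+1 <= r < n.+2) (-1) ^+ r * c (face rho r (single_at g H' w)) -
  (-1) ^+ m.+1 * coef c f (nact g n (bump 0)) w.
Proof.
move=> jm; have j0 : (0 < j)%N by rewrite jm.
have kn : (k <= n)%N by exact: leq_trans (isidx_ge Hf (leqnn k)) (isidx_le Hf (leqnn k)).
exists (H j0); rewrite (coefE _ _ _ (H j0)) /delta.
pose F r := (-1) ^+ r * c (face rho r (single_at g (H j0) w)).
rewrite -(big_mkord xpredT F) big_ltn// /F expr0 mul1r.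
rewrite (term_zero rho w Lc Rc _ jk Hf fj phif (H j0) ey); last by lia.
rewrite (@big_cat_nat _ _ _ m.+1)//=; last by lia.
rewrite big_nat big1 ?add0r; first by rewrite addrC jm mulNr.
move=> r /andP[r0 rm]; have rj : (r < j)%N by lia.
have phir : phi r = r by rewrite phif ?fj// /bump; lia.
by rewrite (term_pos_out rho g w (H j0) Lc r0 _ phir) ?mulr0//; lia.
Qed.

End Coface.

Lemma proj_invariant m n (c : cochain E n) j k f (g : chain G n.+1) y (w : E k y) :
  fiberwise_linear c -> mregular m c -> mregular m (delta rho c) -> (0 < j <= m)%N ->
  (j <= k)%N -> isidx n k f -> (forall i, (i < j)%N -> f i = i) ->
  y = pt g (bump j (f k)) ->
  coef c f (nact g n (bump j)) w = coef c f (nact g n (bump 0)) w.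
Proof.
move=> Lc Rc Rdc jm jk Hf fj ey.
have := @delta_coface m n c j k f (bump j \o f) g y w Lc Rc jk Hf fj
  (fun _ _ => erefl) ey jm.
rewrite Rdc => [/esym/eqP|/(_ j jk)/=]; last first.
  by case/andP: jm => _ jm /(_ jm); rewrite /bump; have := isidx_ge Hf jk; lia.
by rewrite mulf_eq0 signr_eq0 /= subr_eq0 => /eqP.
Qed.

(** Converse of [proj_invariant], through which the homotopy is seen to be m-projectable. *)
Lemma mregular_delta m n (c : cochain E n) : fiberwise_linear c -> mregular m c ->
  (forall j k f (g : chain G n.+1) y (w : E k y), (0 < j <= m)%N -> (j <= k)%N ->
    isidx n k f -> (forall i, (i < j)%N -> f i = i) -> y = pt g (bump j (f k)) ->
    coef c f (nact g n (bump j)) w = coef c f (nact g n (bump 0)) w) ->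
  mregular m (delta rho c).
Proof.
move=> Lc Rc Hc k phi g y w nphi.
have [H|nH] := pselect (isidx n.+1 k phi); last by rewrite /coef; case: pselect.
have [j [f [jm jk Hf fj phif]]] := not_mreg_coface H nphi.
(* [single_at] transports [w] anyway, so [w] may be taken over the right vertex. *)
suff W y' (w' : E k y') : y' = pt g (phi k) -> coef (delta rho c) phi g w' = 0.
  have -> : coef (delta rho c) phi g w =
      coef (delta rho c) phi g (tr (pt g (phi k)) w).
    rewrite !(coefE _ _ _ H) /single_at tr_comp//; right.
    by rewrite /pt; congr vtx; apply: ord_inj; rewrite /= !inordK.
  exact: W.
move=> ey; rewrite (delta_coface w' Lc Rc jk Hf fj phif ey jm) (Hc j)//.
  by rewrite subrr mulr0.
by rewrite ey phif.
Qed.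

(* Projectability lets the first m vertices be shifted one at a time, so they can
   all be replaced by x_q. *)
Lemma proj_shift m n (c : cochain E n) k f (g : chain G n) y (w : E k y) q :
  fiberwise_linear c -> mregular m c -> mregular m (delta rho c) ->
  (m <= k)%N -> isidx n k f -> mreg m k f -> y = pt g (f k) -> (q <= n)%N ->
  coef c f g w = coef c f (nact g n (fun i => if (i < m)%N then q else i)) w.
Proof.
move=> Lc Rc Rdc mk Hf mf ey qn.
have kn : (k <= n)%N by exact: leq_trans (isidx_ge Hf (leqnn k)) (isidx_le Hf (leqnn k)).
have [m0|m0] := posnP m.
  by subst m; rewrite nact_id.
have fk : (m <= f k)%N by exact: leq_trans mk (isidx_ge Hf (leqnn k)).
(* Stage t: the first m vertices are x_t, ..., x_{m-1} followed by t copies of x_q. *)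
pose phit t i := if (i < m)%N then (if (i + t < m)%N then i + t else q)%N else i.
have -> : nact g n (fun i => if (i < m)%N then q else i) = nact g n (phit m).
  apply: nact_ext => i _; rewrite /phit; case: ifP => // _.
  by rewrite ltnNge leq_addl.
elim: {-2}m (leqnn m) => [|t IH] tm.
  rewrite nact_id// => i _; rewrite /phit addn0; by case: (i < m)%N.
rewrite IH; last exact: ltnW.
(* [h] inserts one more x_q in front of x_m: its face d_m is stage t, its face d_0 is stage t+1. *)
pose eta i := if (i < m)%N then phit t i else if i == m then q else i.-1.
pose h := nact g n.+1 eta.
have bn r i : (i <= n)%N -> (bump r i <= n.+1)%N by move=> ni; exact: leq_trans (bump_leS r i) _.
have -> : nact g n (phit t) = nact h n (bump m).
  rewrite nact_nact; last exact: bn.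
  apply: nact_ext => i _ /=; rewrite /eta /bump; case: (ltnP i m) => im.
    by rewrite add0n im.
  by rewrite add1n ifN -?leqNgt ?leqW// ifN ?gtn_eqF// /phit ltnNge im.
have -> : nact g n (phit t.+1) = nact h n (bump 0).
  rewrite nact_nact; last exact: bn.
  apply: nact_ext => i _ /=; rewrite /eta /phit /bump leq0n add1n /=.
  case: (ltngtP i.+1 m) => im.
  - by rewrite addSnnS.
  - by [].
  - by rewrite -im addnS ltnS ltnNge leq_addr.
apply: (@proj_invariant m) => //.
- by rewrite m0 leqnn.
- by move=> i im; apply: mf; lia.
- rewrite pt_nact; last exact: bn (isidx_le Hf (leqnn k)).
  rewrite ey; congr pt; rewrite /eta /bump fk add1n ifN -?leqNgt ?leqW//.
  by rewrite ifN// gtn_eqF.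
Qed.

End DeltaRegular.

(** * The contracting homotopy *)

Section Homotopy.
Context {R : realType} {G : lieGroupoid R} {E : nat -> vbundle (obj G)}.

Lemma coef_tr n (c : cochain E n) k f (g : chain G n) y y' (w : E k y) : y = y' ->
  coef c f g (tr y' w) = coef c f g w.
Proof. by move=> e; subst y'; rewrite tr_id. Qed.

Lemma dual_section_coef n p (c : cochain E n) (h : nat -> nat) k f (H : isidx n k f)
    (y : nerve G p -> obj G) :
  C_lin E n c -> (forall i, (i <= n)%N -> (h i <= p)%N) ->
  (forall g, y g = pt g (h (f k))) ->
  @dual_section R _ (nerve G p) (E k) y (fun g w => coef c f (nact g n h) w).
Proof.
move=> /C_linP[Lc Sc] hp ey.
have S1 := dual_section_pullback (@smooth_nact _ _ p n h) (Sc (mkidx H)).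
have ez g : vtx (nact g n h) (mkord H ord_max) = y g.
  rewrite ey /= /pt; congr (vtx _ (inord (h _))).
  by rewrite inordK ?ltnS ?(isidx_le H).
have := @dual_section_tr _ _ (nerve G p) _ _ y _ ez S1.
suff -> : (fun (q : nerve G p) (v : E k (y q)) =>
    component c (tr (vtx (nact q n h) (mkidx H ord_max)) v : sfib E _ (mkidx H))) =
  (fun g w => coef c f (nact g n h) w) by [].
apply: functional_extensionality_dep => g; apply: funext => w.
by rewrite (coefE _ _ _ H).
Qed.

Definition enum_sindex n : seq (sindex n) := s2val (cid2 (ex_enum_sindex n)).

Lemma enum_sindex_uniq n : uniq (enum_sindex n).
Proof. by rewrite /enum_sindex; case: cid2. Qed.

Lemma mem_enum_sindex n a : a \in enum_sindex n.
Proof. by rewrite /enum_sindex; case: cid2. Qed.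

(* Inserts x_q in front of the vertices x_m, ..., x_n, which is possible because
   arrows can be inverted; the vertices before it are irrelevant. *)
Definition cone_shift (m q i : nat) : nat := if (i <= m)%N then q else i.-1.

Variables (m n : nat) (x : cochain E n.+1).

(** An m-regular index of degree at most m is already (m+1)-regular, so only degrees above m call
    for a correction, and there a(m+1) exists. *)
Definition htpy : cochain E n := fun p => \sum_(a <- enum_sindex n)
  (if `[< mreg m (deg a) (idx_val a) /\ (m < deg a)%N >] then (-1) ^+ m *
    coef x (bump m.+1 \o idx_val a)
      (nact (projT1 p) n.+1 (cone_shift m (idx_val a m.+1))) (projT2 p a : E (deg a) _)
   else 0).

Hypothesis Cx : C_lin E n.+1 x.

Let Lx : fiberwise_linear x. Proof. by have /C_linP[] := Cx. Qed.

Lemma htpy_linear : fiberwise_linear htpy.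
Proof.
move=> g r v w; rewrite /htpy /= mulr_sumr -big_split /=; apply: eq_bigr => a _.
case: ifP => _; last by rewrite mulr0 addr0.
by rewrite coefP// mulrDr mulrCA.
Qed.

Lemma coef_htpy k f (g : chain G n) y (w : E k y) : isidx n k f ->
  y = pt g (f k) ->
  coef htpy f g w = if `[< mreg m k f /\ (m < k)%N >] then
    (-1) ^+ m * coef x (bump m.+1 \o f) (nact g n.+1 (cone_shift m (f m.+1))) w else 0.
Proof.
move=> H ey; rewrite (coefE _ _ _ H) /htpy.
rewrite (bigD1_seq (mkidx H)) ?enum_sindex_uniq ?mem_enum_sindex//= big1 ?addr0.
  have -> : `[< mreg m k (idx_val (mkidx H)) /\ (m < k)%N >] = `[< mreg m k f /\ (m < k)%N >].
    apply/asboolP/asboolP => -[mf mk]; split=> //; apply: mreg_ext mf => i ik;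
      by rewrite /idx_val mkordE.
  case: asboolP => // -[mf mk]; congr (_ * _).
  rewrite {2}/idx_val mkordE// dfwithin.
  have ev : y = vtx g (mkord H ord_max) by rewrite ey.
  apply: etrans (coef_tr _ _ _ _ ev) _; apply: coef_ext => i ik /=.
  by rewrite /idx_val mkordE.
move=> b nb; case: ifP => // _; rewrite dfwithout 1?eq_sym//.
have := coefP (bump m.+1 \o idx_val b) (nact g n.+1 (cone_shift m (idx_val b m.+1)))
  (-1) (0 : E (deg b) (vtx g (b ord_max))) 0 Lx.
by rewrite scaler0 addr0 mulN1r addNr => ->; rewrite mulr0.
Qed.

Lemma htpy_C_lin : C_lin E n htpy.
Proof.
apply/C_linP; split=> [|a]; first exact: htpy_linear.
have Ha := idx_valP a; rewrite /smooth_component.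
have -> : @component R G E n htpy a = (fun (g : nerve G n) (w : E (deg a) (vtx g (a ord_max))) =>
   if `[< mreg m (deg a) (idx_val a) /\ (m < deg a)%N >] then (-1) ^+ m *
     coef x (bump m.+1 \o idx_val a) (nact g n.+1 (cone_shift m (idx_val a m.+1))) w else 0).
  apply: functional_extensionality_dep => g; apply: funext => w.
  rewrite component_coef coef_htpy//.
  by rewrite idx_val_max /pt inord_val.
case: asboolP => [[mf mk]|_]; last first.
  by apply: (@dual_section0 _ _ (nerve G n)); exact: smooth_vtx.
apply: (@dual_sectionZ _ _ (nerve G n)).
apply: (dual_section_coef (isidx_bump (ltn0Sn m) Ha)) => //.
  move=> i ik; rewrite /cone_shift; case: ifP => // _; last by lia.
  exact: isidx_le Ha mk.
move=> g; rewrite /cone_shift /=; have := isidx_ge Ha (leqnn _) => fk.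
have -> : bump m.+1 (idx_val a (deg a)) = (idx_val a (deg a)).+1.
  by rewrite /bump; lia.
rewrite ifN; last by lia.
by rewrite /= idx_val_max /pt inord_val.
Qed.

Lemma htpy_mregular : mregular m htpy.
Proof.
move=> k f g y w nf; have [H|nH] := pselect (isidx n k f); last first.
  by rewrite /coef; case: pselect.
have -> : coef htpy f g w = coef htpy f g (tr (pt g (f k)) w).
  by rewrite !(coefE _ _ _ H) /single_at tr_comp//; right.
by rewrite coef_htpy//; case: asboolP => // -[].
Qed.

Variable rho : rep E.
Hypotheses (Rx : mregular m x) (Rdx : mregular m (delta rho x)).

(** [cone_shift] discards the vertices before x_m, and from m on δ_j and δ_0 agree for j ≤ m. *)
Lemma htpy_delta_mregular : mregular m (delta rho htpy).
Proof.
apply: mregular_delta; [exact: htpy_linear|exact: htpy_mregular|].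
move=> j k f g y w /andP[j0 jm] jk Hf fj ey.
have fk : (f k <= n)%N by exact: isidx_le Hf (leqnn k).
have bk : bump 0 (f k) = bump j (f k).
  by have := isidx_ge Hf (leqnn k); rewrite /bump; lia.
have bn r i : (i <= n)%N -> (bump r i <= n.+1)%N.
  by move=> ni; exact: leq_trans (bump_leS r i) _.
rewrite !coef_htpy//; [|by rewrite pt_nact// bk|by rewrite pt_nact].
case: asboolP => // -[mf mk]; congr (_ * _).
have fm : (m < f m.+1 <= n)%N by rewrite (isidx_ge Hf mk) (isidx_le Hf mk).
have cn i : (i <= n.+1)%N -> (cone_shift m (f m.+1) i <= n)%N.
  by rewrite /cone_shift; case: ifP; lia.
rewrite !nact_nact//.
rewrite (@nact_ext _ _ _ g _ _ (bump 0 \o cone_shift m (f m.+1)))// => i _ /=.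
by rewrite /cone_shift /bump; case: ifP; lia.
Qed.

(** The vanishing of delta x at δ_{m+1} [phi] over the chain [s] is compared with the formula for
    delta h at [phi] over [g]: d_0 s gives back x at [g], d_{m+1} s corresponds to d_0 g, and
    d_{r+1} s to d_r g for r > m. *)
Lemma htpy_homotopy k phi (g : chain G n.+1) y (w : E k y) :
  mregular m.+1 (delta rho x) -> ~ mreg m.+1 k phi -> isidx n.+1 k phi ->
  y = pt g (phi k) ->
  coef (delta rho htpy) phi g w = coef x phi g w.
Proof.
move=> Rdx' nphi Hphi ey.
have [mphi|nmphi] := pselect (mreg m k phi); last first.
  by rewrite htpy_delta_mregular// Rx.
have [j [f [jm jk Hf fj phif]]] := not_mreg_coface Hphi nphi.
have ej : j = m.+1.
  apply/eqP; rewrite eqn_leq; case/andP: jm => j0 -> /=; rewrite ltnNge; apply/negP => jm.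
  by have := mphi j jk jm; rewrite phif// /bump; have := isidx_ge Hf jk; lia.
subst j; have mk := jk.
have fge i : (i <= k)%N -> (i <= f i)%N by exact: isidx_ge Hf.
have fle i : (i <= k)%N -> (f i <= n)%N by exact: isidx_le Hf.
have phi_big i : (m < i <= k)%N -> phi i = (f i).+1.
  by move=> /andP[mi ik]; rewrite phif// /bump; have := fge i ik; lia.
have [H1 e1] := delta_coface_next rho w htpy_linear htpy_mregular jk Hf fj phif ey erefl.
(* Equals f(m+1) + 1: the vertex f(m+1) of d_0 g is x_q in [g]. *)
set q := phi m.+1.
have qn : (m < q <= n.+1)%N.
  by rewrite /q phi_big ?leqnn//; have := fge _ mk; have := fle _ mk; lia.
(* The vertices 0, ..., m of [s] are all x_q; then come x_m, x_{m+1}, ... *)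
pose s := nact g n.+2 (cone_shift m q).
have cn i : (i <= n.+2)%N -> (cone_shift m q i <= n.+1)%N.
  by rewrite /cone_shift; case: ifP; lia.
have bn r i : (i <= n.+1)%N -> (bump r i <= n.+2)%N.
  by move=> ni; exact: leq_trans (bump_leS r i) _.
pose psi := bump m.+1 \o phi.
have psik : psi k = (phi k).+1.
  by rewrite /psi /= /bump phi_big ?leqnn ?andbT//; have := fge k (leqnn k); lia.
have eys : y = pt s (psi k).
  rewrite pt_nact; last by rewrite psik ltnS; exact: isidx_le Hphi (leqnn k).
  rewrite ey psik /cone_shift ifN// phi_big ?leqnn ?andbT//.
  by have := fge k (leqnn k); lia.
have phi_small i : (i < m.+1)%N -> phi i = i.
  by move=> im; apply: mphi; lia.
have [H2] := delta_coface_next rho w Lx Rx jk Hphi phi_small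
  (fun _ _ => erefl : psi _ = bump m.+1 (phi _)) eys erefl.
(* [psi] moves m+1, so delta x has no component there. *)
rewrite Rdx'; last first.
  move=> /(_ m.+1 mk (leqnn _)); rewrite /psi /= phi_big ?leqnn// /bump.
  by have := fge _ mk; lia.
(* d_0 s is [g] with its first m vertices replaced by x_q, which x does not notice. *)
have -> : coef x phi (nact s n.+1 (bump 0)) w = coef x phi g w.
  have qn' : (q <= n.+1)%N by case/andP: qn.
  rewrite nact_nact//.
  rewrite [RHS](@proj_shift _ _ _ rho m n.+1 x k phi g y w q Lx Rx Rdx (ltnW mk) Hphi
    mphi ey qn').
  by congr (coef x phi _ w); apply: nact_ext => i _ /=; rewrite /cone_shift /bump leq0n add1n.
rewrite big_ltn; last by have := leq_trans (fge _ (leqnn k)) (fle _ (leqnn k)); lia.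
(* Without x_m, [s] continues after x_q with x_{m+1}: this is the cone shift of d_0 g. *)
have H3 : coef x phi (nact s n.+1 (bump m.+1)) w =
    (-1) ^+ m * coef htpy f (nact g n (bump 0)) w.
  rewrite coef_htpy//; last first.
    by rewrite pt_nact ?fle// ey phi_big// leqnn andbT.
  rewrite ifT; last by apply/asboolP; split=> // i ik im; apply: fj; lia.
  rewrite mulrA -exprD addnn -signr_odd odd_double mul1r.
  rewrite !nact_nact//; last first.
    move=> i il; have := fle _ mk; rewrite /cone_shift; case: ifP; lia.
    exact: bn.
  rewrite (@coef_ext _ _ _ _ x k phi (bump m.+1 \o f))//; congr (coef x _ _ w).
  apply: nact_ext => i _ /=; rewrite /cone_shift /q phi_big ?leqnn// /bump.
  by case: ifP; case: ifP; lia.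
rewrite (term_pos_in rho w H2 Lx _ Hphi _ eys)//; last first.
  by have := leq_trans (fge _ (leqnn k)) (fle _ (leqnn k)); lia.
rewrite H3.
(* If [phi] takes the value r, both sides are 0. Otherwise x_q is not the vertex removed, and
   inserting it commutes with the face. *)
have H4 r : (m.+1 <= r < n.+2)%N -> x (face rho r.+1 (single_at s H2 w)) =
    (-1) ^+ m * htpy (face rho r (single_at g H1 w)).
  move=> /andP[mr rn].
  have [[i ik phir]|nphir] := pselect (exists2 i, (i <= k)%N & phi i = r).
    rewrite (term_pos_out rho g w H1 htpy_linear _ ik phir) ?mulr0; last lia.
    apply: (term_pos_out rho s w H2 Lx (ltn0Sn r) ik).
    by rewrite /psi /= phir /bump; lia.
  have phir i : (i <= k)%N -> phi i <> r by move=> ik e; apply: nphir; exists i.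
  have [|Hf2 K] := isidx_unbump _ H1 phir; first by lia.
  set f2 := unbump r \o phi in Hf2.
  have f2phi i : (i <= k)%N -> phi i = bump r (f2 i) by move=> ik; rewrite /f2 /= K.
  rewrite (term_pos_in rho w H1 htpy_linear _ Hf2 f2phi ey); last lia.
  have f2fm : bump r (f2 m.+1) = q by rewrite -f2phi.
  have f2m i : (i <= m)%N -> f2 i = i.
    by move=> im; rewrite /f2 /= phi_small// /unbump; lia.
  rewrite coef_htpy//; last first.
    by rewrite pt_nact -?f2phi// (isidx_le Hf2 (leqnn k)).
  rewrite ifT; last by apply/asboolP; split=> // i _ im; exact: f2m.
  rewrite mulrA -exprD addnn -signr_odd odd_double mul1r.
  have Hf2' := isidx_bump (ltn0Sn m) Hf2.
  rewrite (term_pos_in rho w H2 Lx _ Hf2' _ eys); [|lia|].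
    congr (coef x _ _ w); rewrite !nact_nact//; last first.
        move=> i il; have := isidx_le Hf2 mk; rewrite /cone_shift; case: ifP; lia.
      exact: bn.
    apply: nact_ext => i _ /=; rewrite /cone_shift.
    case: (leqP i m) => im.
      by rewrite f2fm ifT// /bump; lia.
    by rewrite ifN; rewrite /bump; lia.
  move=> i ik; rewrite /psi /= f2phi// [RHS]bump_bump//.
rewrite big_add1 /=.
have -> : \sum_(m.+1 <= i < n.+2) (-1) ^+ i.+1 * x (face rho i.+1 (single_at s H2 w)) =
    - ((-1) ^+ m * \sum_(m.+1 <= r < n.+2) (-1) ^+ r * htpy (face rho r (single_at g H1 w))).
  rewrite mulr_sumr -sumrN; apply: eq_big_nat => r mr.
  by rewrite H4// exprS mulN1r mulNr mulrCA.
rewrite e1 => /esym/eqP; rewrite subr_eq0 => /eqP e2.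
apply: (@mulfI _ ((-1) ^+ m.+1)); first by rewrite signr_eq0.
rewrite -e2 mulrBr exprS; set A := \sum_(_ <= _ < _) _; set B := coef htpy _ _ _.
by rewrite !mulN1r !mulNr mulrN !opprK addrC.
Qed.

End Homotopy.

(** * The filtration *)

Section Filtration.
Context {R : realType} {G : lieGroupoid R} {E : nat -> vbundle (obj G)}.
Variable rho : rep E.

Lemma FhatP m n (c : cochain E n) :
  Fhat rho m n c <-> [/\ C_lin E n c, mregular m c & mregular m (delta rho c)].
Proof. by split=> -[Cc /mregularP Rc /mregularP Rd]. Qed.

Lemma is_regularP n (a : sindex n) : is_regular a <-> mreg (deg a) (deg a) (idx_val a).
Proof.
have mi (i : 'I_(deg a).+1) : minn i n = i.
  by apply/minn_idPl; exact: leq_trans (leq_ord i) (deg_le a).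
split=> H i; first by move=> ia _; rewrite /idx_val H val_oiota mi inordK.
by apply: ord_inj; rewrite val_oiota mi -{1}(inord_val i); exact: H (leq_ord i) (leq_ord i).
Qed.

(** Indices into [n] have degree at most n, so M-regularity controls all their values. *)
Lemma supported_regularP n M (c : cochain E n) : (n <= M)%N ->
  supported (@is_regular n) c <-> mregular M c.
Proof.
move=> nM; apply: (iff_trans _ (mregularP M c)).
have aM (a : sindex n) : (deg a <= M)%N := leq_trans (deg_le a) nM.
split=> H a /H.
  by move=> /is_regularP Ra; apply/is_mregularP => i ia _; exact: Ra.
move=> /is_mregularP Ra; apply/is_regularP => i ia _; apply: Ra => //.
exact: leq_trans ia (aM a).
Qed.

(** The inequality is strict because delta c lives in degree n+1. *)
Lemma C_proj_Fhat n M (c : cochain E n) : (n < M)%N -> C_proj rho n c <-> Fhat rho M n c.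
Proof.
move=> nM; split=> [[Cc /(supported_regularP _ (ltnW nM)) Rc /(supported_regularP _ nM) Rd]|].
  by apply/FhatP; split.
by move=> /FhatP[Cc /(supported_regularP _ (ltnW nM)) Rc /(supported_regularP _ nM) Rd]; split.
Qed.

Lemma FhatW m m' n (c : cochain E n) : (m <= m')%N -> Fhat rho m' n c -> Fhat rho m n c.
Proof. by move=> mm /FhatP[Cc Rc Rd]; apply/FhatP; split=> //; exact: mregularW mm _. Qed.

Lemma C_proj_FhatW m n (c : cochain E n) : C_proj rho n c -> Fhat rho m n c.
Proof.
move=> /(@C_proj_Fhat _ (maxn m n.+1)) H; apply: FhatW (H _); last by rewrite leq_max leqnn orbT.
exact: leq_maxl.
Qed.

Lemma Fhat0 n (c : cochain E n) : Fhat rho 0 n c <-> C_lin E n c.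
Proof.
split=> [/FhatP[]//|Cc]; apply/FhatP; split=> //; exact: mregular0.
Qed.

Lemma delta_comb n (r : R) (c c' : cochain E n) :
  delta rho (fun p => r * c p + c' p) = (fun p => r * delta rho c p + delta rho c' p).
Proof.
apply: funext => p; rewrite /delta mulr_sumr -big_split /=.
by apply: eq_bigr => i _; rewrite mulrDr mulrCA.
Qed.

Lemma delta_cst0 n : delta rho (fun _ : semidirect E n => 0) = fun=> 0.
Proof. by apply: funext => p; rewrite /delta big1// => i _; rewrite mulr0. Qed.

Lemma delta_sub n (c c' : cochain E n) :
  delta rho (fun p => c p - c' p) = (fun p => delta rho c p - delta rho c' p).
Proof.
have -> : (fun p => c p - c' p) = (fun p => -1 * c' p + c p).
  by apply: funext => p; rewrite mulN1r addrC.
by rewrite delta_comb; apply: funext => p; rewrite mulN1r addrC.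
Qed.

Lemma mregular_comb m n (r : R) (c c' : cochain E n) :
  mregular m c -> mregular m c' -> mregular m (fun p => r * c p + c' p).
Proof.
move=> Rc Rc' k f g y w nf; have := Rc k f g y w nf; have := Rc' k f g y w nf.
by rewrite /coef; case: pselect => // H -> ->; rewrite mulr0 addr0.
Qed.

Lemma mregular_cst0 m n : mregular m (fun _ : semidirect E n => 0).
Proof. by move=> k f g y w _; rewrite /coef; case: pselect. Qed.

Lemma Fhat_cst0 m n : Fhat rho m n (fun=> 0).
Proof.
by apply/FhatP; rewrite delta_cst0; split; [exact: C_lin0|exact: mregular_cst0|exact: mregular_cst0].
Qed.

Lemma Fhat_comb m n (r : R) (c c' : cochain E n) :
  Fhat rho m n c -> Fhat rho m n c' -> Fhat rho m n (fun p => r * c p + c' p).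
Proof.
move=> /FhatP[Cc Rc Rd] /FhatP[Cc' Rc' Rd']; apply/FhatP; rewrite delta_comb.
by split; [exact: C_lin_comb|exact: mregular_comb|exact: mregular_comb].
Qed.

Lemma Fhat_sub m n (c c' : cochain E n) :
  Fhat rho m n c -> Fhat rho m n c' -> Fhat rho m n (fun p => c p - c' p).
Proof.
move=> Fc Fc'; have := Fhat_comb (-1) Fc' Fc.
by congr Fhat; apply: funext => p; rewrite mulN1r addrC.
Qed.

Lemma Fhat_delta m n (c : cochain E n) : Fhat rho m n c -> Fhat rho m n.+1 (delta rho c).
Proof.
move=> /FhatP[Cc Rc Rd]; apply/FhatP; split=> //; first exact: C_lin_delta.
by rewrite delta_delta; exact: mregular_cst0.
Qed.

(** The level may vary with the degree in order to include [C_proj]; as delta keeps the level m n,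
    the disjunction says how this is read in degree n+1. *)
Lemma complex_of (A : forall n, set (cochain E n)) (m : nat -> nat) :
  (forall n c, A n c <-> Fhat rho (m n) n c) ->
  (forall n, (m n.+1 <= m n)%N \/ forall c, A n.+1 c <-> Fhat rho (m n) n.+1 c) ->
  cochain_complex rho A.
Proof.
move=> AF mA n; split.
- by apply/AF; exact: Fhat_cst0.
- by move=> r c c' /AF Fc /AF Fc'; apply/AF; exact: Fhat_comb.
- move=> c /AF /Fhat_delta Fd; case: (mA n) => [mm|H]; last exact/H.
  by apply/AF; exact: FhatW Fd.
- by move=> c _; exact: delta_delta.
Qed.

(** Asking for delta x to be (m+1)-regular rather than 0 serves both halves of the
    quasi-isomorphism: x may be a cocycle or a primitive of one. *)
Lemma Fhat_step m n (x : cochain E n) : Fhat rho m n x -> mregular m.+1 (delta rho x) ->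
  exists2 x', Fhat rho m.+1 n x' & coboundary rho (Fhat rho m) (fun p => x p - x' p).
Proof.
case: n x => [|n] x /FhatP[Cx Rx Rdx] Rdx'.
  (* [0] has a single index, so every cochain of degree 0 is regular and [x] needs no correction. *)
  exists x; last by apply: funext => p; rewrite subrr.
  apply/FhatP; split=> // k f g y w nf; rewrite /coef; case: pselect => // H.
  case: nf => i ik _; have k0 : (k <= 0)%N.
    by apply: leq_trans (isidx_ge H (leqnn k)) (isidx_le H (leqnn k)).
  have -> : i = 0%N by lia.
  by case: H.
have Fb : Fhat rho m n (htpy m x).
  apply/FhatP; split; [exact: htpy_C_lin|exact: htpy_mregular|exact: htpy_delta_mregular].
pose x' p := x p - delta rho (htpy m x) p.
exists x'; last first.
  by exists (htpy m x) => //; apply: funext => p; rewrite /x' opprB addrC subrK.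
apply/FhatP; split.
- have Fx : Fhat rho m n.+1 x by apply/FhatP.
  by have /FhatP[] := Fhat_sub Fx (Fhat_delta Fb).
- move=> k phi g y w nphi.
  have [H|nH] := pselect (isidx n.+1 k phi); last by rewrite /coef; case: pselect.
  suff W y' (w' : E k y') : y' = pt g (phi k) -> coef x' phi g w' = 0.
    have -> : coef x' phi g w = coef x' phi g (tr (pt g (phi k)) w).
      by rewrite !(coefE _ _ _ H) /single_at tr_comp//; right.
    exact: W.
  move=> ey; have := htpy_homotopy Cx Rx Rdx w' Rdx' nphi H ey.
  by rewrite !(coefE _ _ _ H) /x' => ->; rewrite subrr.
- rewrite delta_sub delta_delta; have -> : (fun p => delta rho x p - 0) = delta rho x.
    by apply: funext => p; rewrite subr0.
  exact: Rdx'.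
Qed.

Lemma coboundary_delta (A : forall n, set (cochain E n)) n (x x' : cochain E n) :
  coboundary rho A (fun p => x p - x' p) -> delta rho x' = delta rho x.
Proof.
move=> cb; suff d0 : delta rho (fun p => x p - x' p) = fun=> 0.
  apply: funext => p; have := congr1 (fun f => f p) d0; rewrite delta_sub => /eqP.
  by rewrite subr_eq0 => /eqP.
by case: n x x' cb => [|n] x x' /= => [->|[b _ ->]]; [exact: delta_cst0|exact: delta_delta].
Qed.

Lemma Fhat_quasi_iso m : quasi_iso rho (Fhat rho m.+1) (Fhat rho m).
Proof.
move=> n; split=> [c [Fc dc]|c [Fc dc]].
  case: n c Fc dc => [//|n] c Fc dc [b Fb ecb].
  (* Here delta b = c is (m+1)-regular although [b] need not be. *)
  have [|b' Fb' cb] := Fhat_step Fb; first by rewrite -ecb; case/FhatP: Fc.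
  by exists b' => //; rewrite ecb (coboundary_delta cb).
have [|c' Fc' cb] := Fhat_step Fc; first by rewrite dc; exact: mregular_cst0.
by exists c' => //; split=> //; rewrite (coboundary_delta cb).
Qed.

Lemma Fhat_iter M n (x : cochain E n) : C_lin E n x ->
  (forall m, mregular m (delta rho x)) ->
  exists2 x', Fhat rho M n x' & coboundary rho (C_lin E) (fun p => x p - x' p).
Proof.
move=> Cx Rd; elim: M => [|M [x' Fx' cb]].
  exists x; first exact/Fhat0.
  have -> : (fun p => x p - x p) = fun=> 0 by apply: funext => p; rewrite subrr.
  by case: n {x Cx Rd} => [//|n]; exists (fun=> 0); rewrite ?delta_cst0//; exact: C_lin0.
have [|x2 Fx2 cb2] := Fhat_step Fx'; first by rewrite (coboundary_delta cb).
exists x2 => //; case: n x x' x2 Cx Rd Fx' cb Fx2 cb2 => [|n] x x' x2 Cx Rd Fx' cb Fx2 cb2.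
  apply: funext => p; have e := congr1 (fun f => f p) cb; have e2 := congr1 (fun f => f p) cb2.
  by move: e e2 => /= /eqP; rewrite subr_eq0 => /eqP -> ->.
move: cb cb2 => [b Cb eb] [b2 /FhatP[Cb2 _ _] eb2].
exists (fun p => 1 * b p + b2 p); first exact: C_lin_comb.
rewrite delta_comb -eb -eb2; apply: funext => p.
by rewrite mul1r addrA subrK.
Qed.

Lemma C_proj_quasi_iso : quasi_iso rho (C_proj rho) (C_lin E).
Proof.
move=> n; split=> [c [Pc dc]|c [Cc dc]].
  case: n c Pc dc => [//|n] c Pc dc [b Cb ecb].
  (* In degree n, n+1 steps reach the projectable cochains. *)
  have [|b' Fb' cb] := @Fhat_iter n.+1 _ _ Cb.
    by move=> m; rewrite -ecb; have /FhatP[] := C_proj_FhatW m Pc.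
  exists b'; first by apply/(C_proj_Fhat _ (ltnSn n)).
  by rewrite ecb (coboundary_delta cb).
have [|c' Fc' cb] := @Fhat_iter n.+1 _ _ Cc.
  by move=> m; rewrite dc; exact: mregular_cst0.
exists c' => //; split; first by apply/(C_proj_Fhat _ (ltnSn n)).
by rewrite (coboundary_delta cb).
Qed.

End Filtration.

Theorem proposition5p4 (R : realType) (G : lieGroupoid R)
    (E : nat -> vbundle (obj G)) (E_bounded : bounded_graded E) (rho : rep E) :
  [/\ cochain_complex rho (C_lin E),
      (forall m, cochain_complex rho (Fhat rho m)) &
      cochain_complex rho (C_proj rho)] /\
  [/\ (forall n, Fhat rho 0 n = C_lin E n),
      (forall m n, Fhat rho m.+1 n `<=` Fhat rho m n) &
      (forall m n, C_proj rho n `<=` Fhat rho m n)] /\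
  (forall m, quasi_iso rho (Fhat rho m.+1) (Fhat rho m)) /\
  quasi_iso rho (C_proj rho) (C_lin E).
Proof.
split; [split|split; [split|split]].
- exact: (complex_of (m := fun=> 0) (fun n c => iff_sym (Fhat0 rho c))
    (fun=> or_introl (leqnn _))).
- by move=> m; exact: (complex_of (m := fun=> m) (fun n c => iff_refl _)
    (fun=> or_introl (leqnn _))).
(* Level n+2 describes [C_proj] in degree n and also in degree n+1, where delta lands. *)
- apply: (complex_of (m := fun n => n.+2)) => [n c|n]; first exact: C_proj_Fhat.
  by right=> c; exact: C_proj_Fhat.
- by move=> n; apply/seteqP; split=> c /Fhat0.
- by move=> m n c; exact: FhatW.
- by move=> m n c; exact: C_proj_FhatW.
- exact: Fhat_quasi_iso.
- exact: C_proj_quasi_iso.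
Qed.
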